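(* For every fixed integer $\ell \geq 2$, the decision problem $\mathcal{L}_\ell$-Cluster Editing is NP-complete.
   Context: All graphs are finite, simple and undirected. A clique is a complete graph. For an integer $\ell \geq 2$, an $\ell$-clique is a connected complete $\ell$-partite graph. Let $\mathcal{L}_\ell$ be the family of graphs that are cliques or $\ell$-cliques. An $\mathcal{L}_\ell$-cluster graph is a graph each of whose connected components is a clique or an $\ell$-clique. An edition set $F$ for a graph $G$ is a set of unordered pairs of distinct vertices of $G$, no pair occurring twice, each marked either $-$ (the pair is an edge of $G$, to be deleted) or $+$ (the pair is a non-edge of $G$, to be added); $G+F$ is the graph obtained by performing these editions. The decision problem $\mathcal{L}_\ell$-Cluster Editing: given a graph $G$ and a nonnegative integer $k$, decide whether there exists an edition set $F$ with $|F| \leq k$ such that $G+F$ is an $\mathcal{L}_\ell$-cluster graph. *)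

(* Defs.v *)
From mathcomp Require Import all_boot all_order all_algebra.

Set Implicit Arguments.
Unset Strict Implicit.
Unset Printing Implicit Defensive.

(* A deterministic machine has [ntapes.+1] two-way infinite tapes over the alphabet
   [option (bool + extra)]: [None] is the blank, [Some (inl b)] is the
   input/output symbol [b], and [extra] holds auxiliary tape symbols. *)

Definition word := seq bool.

Inductive direction := Left | Stay | Right.

Definition shift (d : direction) (z : int) : int :=
  match d with
  | Left => (z - 1)%R
  | Stay => z
  | Right => (z + 1)%R
  end.

Definition symbol (extra : finType) : Type := option (bool + extra).

Record machine := Machine {
  ntapes : nat;
  extra : finType;
  state : finType;
  start : state;
  halting : pred state;
  delta : state -> {ffun 'I_ntapes.+1 -> symbol extra} ->
          state * {ffun 'I_ntapes.+1 -> symbol extra * direction} }.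

Record config (M : machine) := Config {
  cstate : state M;
  head : 'I_(ntapes M).+1 -> int;
  tape : 'I_(ntapes M).+1 -> int -> symbol (extra M) }.

Definition word_symbol (M : machine) (x : word) (i : nat) : symbol (extra M) :=
  nth None [seq Some (inl b) | b <- x] i.

Definition init (M : machine) (x : word) : config M :=
  Config (start M) (fun=> 0%R)
    (fun t z => match z with
                | Posz i => if t == ord0 then word_symbol M x i else None
                | Negz _ => None
                end).

(* Halting configurations are fixed points, so that "halts within [t] steps"
   can be read off the configuration reached after exactly [t] steps. *)
Definition step (M : machine) (c : config M) : config M :=
  if halting (cstate c) then c else
  let: (q, act) := delta (cstate c) [ffun t => tape c t (head c t)] in
  Config q (fun t => shift (act t).2 (head c t))
    (fun t z => if z == head c t then (act t).1 else tape c t z).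

(* The output is the content of the last tape from cell 0 up to the first
   blank. *)
Definition outputs (M : machine) (c : config M) (y : word) : Prop :=
  forall i : nat, i <= size y -> tape c ord_max (Posz i) = word_symbol M y i.

Definition computes_within (M : machine) (f : word -> word) (T : nat -> nat) :
    Prop :=
  forall x : word,
    let c := iter (T (size x)) (@step M) (init M x) in
    halting (cstate c) /\ outputs c (f x).

Definition language := word -> Prop.

(* Every polynomial over [nat] is bounded by some [a * n ^ d + a]. *)
Definition polytime (f : word -> word) : Prop :=
  exists (M : machine) (a d : nat),
    computes_within M f (fun n => a * n ^ d + a).

Definition in_P (L : language) : Prop :=
  exists chi : word -> bool,
    polytime (fun x => [:: chi x]) /\ forall x, L x <-> chi x.

(* Self-delimiting pairing: every bit of [x] is preceded by a [true], and a
   [false] separates [x] from [y]. *)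
Definition pair_word (x y : word) : word :=
  flatten [seq [:: true; b] | b <- x] ++ false :: y.

Definition in_NP (L : language) : Prop :=
  exists (V : language) (a d : nat),
    in_P V /\
    forall x, L x <->
      exists y : word, size y <= a * size x ^ d + a /\ V (pair_word x y).

Definition poly_reducible (L1 L2 : language) : Prop :=
  exists f : word -> word, polytime f /\ forall x, L1 x <-> L2 (f x).

Definition NP_hard (L : language) : Prop :=
  forall L' : language, in_NP L' -> poly_reducible L' L.

Definition NP_complete (L : language) : Prop := in_NP L /\ NP_hard L.

Definition simple_graph (T : finType) (e : rel T) : Prop :=
  symmetric e /\ irreflexive e.

Definition connected (T : finType) (e : rel T) : Prop :=
  forall x y, connect e x y.

Definition clique (T : finType) (e : rel T) : Prop :=
  forall x y, e x y = (x != y).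

(* The parts are the fibres of [part]; some of them may be empty, which is why
   connectedness of an [l]-clique is a separate requirement. *)
Definition complete_multipartite (l : nat) (T : finType) (e : rel T) : Prop :=
  exists part : T -> 'I_l, forall x y, e x y = (part x != part y).

Definition lclique (l : nat) (T : finType) (e : rel T) : Prop :=
  connected e /\ complete_multipartite l e.

Definition induced (T : finType) (e : rel T) (C : {set T}) :
    rel {x : T | x \in C} :=
  fun x y => e (val x) (val y).

Definition component (T : finType) (e : rel T) (x : T) : {set T} :=
  [set y | connect e x y].

Definition cluster_graph (l : nat) (T : finType) (e : rel T) : Prop :=
  forall x : T,
    clique (induced e (C := component e x)) \/
    lclique l (induced e (C := component e x)).

(* An edition is an unordered pair together with a mark: [true] stands for
   [+] (addition) and [false] for [-] (deletion). *)

Definition edition_set (T : finType) (e : rel T) (F : {set {set T} * bool}) :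
    Prop :=
  (forall p mark, (p, mark) \in F ->
     exists x y, [/\ x != y, p = [set x; y] & e x y = ~~ mark]) /\
  {in F &, injective fst}.

Definition edit (T : finType) (e : rel T) (F : {set {set T} * bool}) : rel T :=
  fun x y => e x y && (([set x; y], false) \notin F)
             || (([set x; y], true) \in F).

Definition cluster_editable (l : nat) (T : finType) (e : rel T) (k : nat) :
    Prop :=
  exists F : {set {set T} * bool},
    [/\ edition_set e F, #|F| <= k & cluster_graph l (edit e F)].

(* An instance is encoded as [1^n 0], followed by the [n * n] bits of the
   adjacency matrix in row-major order, followed by [k] in binary, least
   significant bit first (the empty word for [k = 0]). *)

Fixpoint bits_of_pos (p : BinNums.positive) : word :=
  match p with
  | BinNums.xH => [:: true]
  | BinNums.xO p' => false :: bits_of_pos p'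
  | BinNums.xI p' => true :: bits_of_pos p'
  end.

Definition bits_of_nat (k : nat) : word :=
  match bin_of_nat k with
  | BinNums.N0 => [::]
  | BinNums.Npos p => bits_of_pos p
  end.

Definition encode (n : nat) (e : rel 'I_n) (k : nat) : word :=
  nseq n true ++ false ::
  [seq e i j | i <- enum 'I_n, j <- enum 'I_n] ++ bits_of_nat k.

Definition cluster_editing (l : nat) : language :=
  fun w => exists (n : nat) (e : rel 'I_n) (k : nat),
    [/\ simple_graph e, w = encode e k & cluster_editable l e k].

(* Main.v *)
(* Hardness is proved directly from the computation of a verifier. Relative to the heads, the
   contents of all tapes form a single row of columns, and a column depends on the column at
   the heads and on the three columns around it one step earlier; hence acceptance of some
   certificate is the satisfiability of a family of Horn clauses, together with clauses that
   leave the certificate cells open.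

   A set of clauses becomes a graph as follows. Every literal gets a huge clique, its anchor.
   A variable is a vertex adjacent to its two anchors, a clause is a vertex adjacent to the
   anchors of its literals, and clauses are adjacent to their variables. Within the budget, an
   anchor can neither be split, nor be merged with another one, nor become multipartite, so
   that each of these vertices joins exactly one of its anchors. A clause shares a cluster with
   at most one of its variables. Additional vertices that may join any anchor make it possible
   to have equally many vertices at every anchor, which by Cauchy-Schwarz minimises the number
   of insertions; so the budget is met only if every clause shares a cluster with a variable,
   which then satisfies it.

   Both the reduction and the verifier output bits that are expressed by sums, differences,
   input look-ups and sums over ranges, and such expressions are evaluated in polynomial time by
   a Turing machine that uses its tapes as counters. *)

Require Import Defs.
From mathcomp Require Import all_boot.
From mathcomp Require Import ssralg ssrint zify.
From Stdlib Require Import FunctionalExtensionality.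

Set Implicit Arguments.
Unset Strict Implicit.
Unset Printing Implicit Defensive.

(** * Tape programs *)

(** The budget works on two scales. A chooser (a vertex for a variable or a clause, or an additional
    vertex) must be cut from all but one of the anchors it may join, and each cut costs a whole
    anchor, whereas the budget for pairs of choosers is less than one anchor. So the coarse scale
    puts each chooser at one anchor, and the rest of the budget measures how many clauses meet a
    variable. The obstacle is that choosers at the same anchor have to be joined to each other, at a
    quadratic cost that depends on how they are spread; equal numbers make it independent of the
    assignment. The integer $l$ enters only the size of the anchors: the intended clusters are
    cliques, while a multipartite cluster on most of an anchor lacks at least about one pair in $l$.
    Range sums cannot express $2^n$, yet a budget is written in binary and may be exponential in the
    input length; hence powers of two are truncated. In the tableau nothing makes the column at a
    place unique: it suffices that a satisfying assignment contains the actual run. *)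

Notation sym := (symbol void).
Definition tape_state := (int * (int -> sym))%type.
Definition store := nat -> tape_state.

Definition scan (s : store) (i : nat) : sym := (s i).2 (s i).1.

Definition act (f : sym -> sym * direction) (t : tape_state) : tape_state :=
  (shift (f (t.2 t.1)).2 t.1,
   fun z => if z == t.1 then (f (t.2 t.1)).1 else t.2 z).

Definition upd (T : Type) (s : nat -> T) (i : nat) (v : T) : nat -> T :=
  fun j => if j == i then v else s j.

Inductive cmd :=
| Op of nat & (sym -> sym * direction)
| Seq of cmd & cmd
| While of nat & pred sym & cmd
| If of nat & pred sym & cmd.

Inductive exec : cmd -> store -> store -> nat -> Prop :=
| ExecOp i f s : exec (Op i f) s (upd s i (act f (s i))) 1
| ExecSeq c1 c2 s1 s2 s3 t1 t2 :
    exec c1 s1 s2 t1 -> exec c2 s2 s3 t2 -> exec (Seq c1 c2) s1 s3 (t1 + t2)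
| ExecWhileF i (P : pred sym) c s : ~~ P (scan s i) -> exec (While i P c) s s 1
| ExecWhileT i (P : pred sym) c s1 s2 s3 t1 t2 :
    P (scan s1 i) -> exec c s1 s2 t1 -> exec (While i P c) s2 s3 t2 ->
    exec (While i P c) s1 s3 (t1 + t2).+2
| ExecIfF i (P : pred sym) c s : ~~ P (scan s i) -> exec (If i P c) s s 1
| ExecIfT i (P : pred sym) c s1 s2 t :
    P (scan s1 i) -> exec c s1 s2 t -> exec (If i P c) s1 s2 t.+1.

Inductive instr :=
| IOp of nat & (sym -> sym * direction)
| IJmp of nat & pred sym & nat.

Fixpoint code (s : nat) (c : cmd) : seq instr :=
  match c with
  | Op i f => [:: IOp i f]
  | Seq c1 c2 => code s c1 ++ code (s + size (code s c1)) c2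
  | While i P c =>
      let b := code s.+1 c in
      IJmp i (predC P) (s + size b).+2 :: rcons b (IJmp i xpredT s)
  | If i P c =>
      let b := code s.+1 c in IJmp i (predC P) (s + size b).+1 :: b
  end.

(** Beyond its end a program jumps to its end, so the address [size p] is a fixed point of [pstep],
    just as halting configurations are fixed by [step]. *)
Definition fetch (p : seq instr) (pc : nat) : instr :=
  nth (IJmp 0 xpredT (size p)) p pc.

Definition pstep (p : seq instr) (c : nat * store) : nat * store :=
  match fetch p c.1 with
  | IOp i f => (c.1.+1, upd c.2 i (act f (c.2 i)))
  | IJmp i P tgt => (if P (scan c.2 i) then tgt else c.1.+1, c.2)
  end.

Lemma fetch_cat (pre : seq instr) x post : fetch (pre ++ x :: post) (size pre) = x.
Proof. by rewrite /fetch nth_cat ltnn subnn. Qed.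

(** Jump targets are absolute, so code depends on its position. The arbitrary prefix and suffix let
    the induction run loop bodies and second halves of sequences in place. The two extra steps of a
    loop pass are the test and the jump back. *)
Lemma exec_code c s s' t : exec c s s' t -> forall pre post,
  let p := pre ++ code (size pre) c ++ post in
  iter t (pstep p) (size pre, s) = (size pre + size (code (size pre) c), s').
Proof.
elim=> {c s s' t}.
- move=> i f s pre post /=; rewrite addn1.
  by rewrite /pstep fetch_cat.
- move=> c1 c2 s1 s2 s3 t1 t2 _ IH1 _ IH2 pre post /=.
  rewrite addnC iterD -catA IH1.
  set b1 := code _ c1; have:= IH2 (pre ++ b1) post.
  by rewrite size_cat -!catA => ->; rewrite size_cat addnA.
- move=> i P c s /= nP pre post.
  by rewrite /pstep fetch_cat /= nP size_rcons !addnS.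
- move=> i P c s1 s2 s3 t1 t2 HP _ IH1 _ IH2 pre post.
  have := IH2 pre post; rewrite [code _ _]/=; set b := code _ c.
  set j1 := IJmp _ _ _; set j2 := IJmp i xpredT _; cbv zeta.
  set p := pre ++ _ => IH2'.
  have st1 : pstep p (size pre, s1) = ((size pre).+1, s1).
    by rewrite /pstep /p fetch_cat /= HP.
  have := IH1 (rcons pre j1) (j2 :: post).
  rewrite size_rcons /= -/b -!cats1 -!catA /= -/j2 => IH1'.
  have Ep : p = pre ++ j1 :: b ++ j2 :: post by rewrite /p /= -cats1 -catA.
  rewrite -?catA -?Ep in IH1'.
  have st2 : pstep p ((size pre).+1 + size b, s2) = (size pre, s2).
    have Ef: fetch p ((size pre).+1 + size b) = j2.
      rewrite Ep -cat_rcons catA -(size_rcons pre j1) -size_cat.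
      by rewrite fetch_cat.
    by rewrite /pstep Ef.
  have E2 : iter t1.+2 (pstep p) (size pre, s1) = (size pre, s2).
    by rewrite iterS iterSr st1 IH1' st2.
  by rewrite -!iterS (_ : (t1 + t2).+2 = t2 + t1.+2) ?iterD ?E2 ?IH2' ?cats1 //; lia.
- move=> i P c s /= nP pre post.
  by rewrite /pstep fetch_cat /= nP !addnS.
- move=> i P c s1 s2 t HP _ IH pre post /=.
  set b := code _ c; set j1 := IJmp _ _ _.
  have := IH (rcons pre j1) post.
  rewrite size_rcons /= -/b -cats1 -catA /= => IH'.
  rewrite -iterS iterSr.
  by rewrite /pstep fetch_cat /= HP IH' /= !addnS.
Qed.

Fixpoint tapes_ok (K : nat) (c : cmd) : bool :=
  match c with
  | Op i _ => i <= K
  | Seq c1 c2 => tapes_ok K c1 && tapes_ok K c2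
  | While i _ c | If i _ c => (i <= K) && tapes_ok K c
  end.

Definition instr_ok (K n : nat) (x : instr) : bool :=
  match x with
  | IOp i _ => i <= K
  | IJmp i _ tgt => (i <= K) && (tgt <= n)
  end.

Lemma instr_okS K n n' x : n <= n' -> instr_ok K n x -> instr_ok K n' x.
Proof. by case: x => //= i P tgt le /andP[-> /leq_trans->]. Qed.

Lemma code_ok K c s :
  tapes_ok K c -> all (instr_ok K (s + size (code s c))) (code s c).
Proof.
elim: c s => [i f|c1 IH1 c2 IH2|i P c IH|i P c IH] s /=.
- by move=> ->.
- case/andP=> ok1 ok2; rewrite all_cat size_cat addnA; apply/andP; split.
    by apply: sub_all (IH1 s ok1) => x; apply: instr_okS; lia.
  by apply: IH2.
- case/andP=> le_i ok1; rewrite all_rcons size_rcons /= le_i /=.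
  apply/and3P; split; [lia | lia |].
  by apply: sub_all (IH s.+1 ok1) => x; apply: instr_okS; lia.
case/andP=> le_i ok1 /=; rewrite le_i addnS leqnn /=.
by apply: sub_all (IH s.+1 ok1) => x; apply: instr_okS; lia.
Qed.

(** * Machines that run programs *)

Definition prog_machine (K : nat) (p : seq instr) : machine :=
  @Machine K void 'I_(size p).+1 ord0 (fun q => q == size p :> nat)
    (fun q g =>
       match fetch p q with
       | IOp i f => (inord q.+1, [ffun t : 'I_K.+1 =>
           if t == i :> nat then f (g t) else (g t, Stay)])
       | IJmp i P tgt => (inord (if P (g (inord i)) then tgt else q.+1),
           [ffun t => (g t, Stay)])
       end).

Definition rep K p (c : config (prog_machine K p)) (s : nat * store) : Prop :=
  [/\ nat_of_ord (cstate c : 'I_(size p).+1) = s.1, s.1 <= size p &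
      forall t : 'I_K.+1, (Defs.head c t, tape c t) = s.2 t].

Lemma rep_step K p c s : all (instr_ok K (size p)) p ->
  @rep K p c s -> rep (step c) (pstep p s).
Proof.
move=> okp [Hq le_s Ht]; rewrite /step /=.
have scanE t : tape c t (Defs.head c t) = scan s.2 t by rewrite /scan -Ht.
(* A machine writes on all tapes in every step; a tape that is left alone gets its scanned symbol
   rewritten. *)
have stay t : (fun z => if z == Defs.head c t then tape c t (Defs.head c t) else tape c t z)
               = tape c t.
  by apply: functional_extensionality => z; case: eqP => // ->.
case: eqP => [Eq|/eqP Nq].
  have Es : s.1 = size p by rewrite -Hq.
  have -> : pstep p s = s.
    by rewrite /pstep /fetch nth_default ?Es //= -Es; case: (s).
  by split.
have lt_s : s.1 < size p by rewrite ltn_neqAle -Hq Nq Hq.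
have := all_nthP (IJmp 0 xpredT (size p)) okp s.1 lt_s.
rewrite -/(fetch p s.1) /pstep Hq; case: (fetch p s.1) => [i f|i P tgt] /=.
  move=> le_i; split => //=; first by rewrite inordK.
  move=> t; rewrite !ffunE /upd -Ht; case: eqP => [<-|Nt].
    by rewrite -Ht /act.
  by rewrite /= stay.
case/andP=> le_i le_tgt; rewrite ffunE scanE inordK //.
split => /=; first by rewrite inordK //; case: ifP.
  by case: ifP.
by move=> t; rewrite !ffunE /= stay Ht.
Qed.

Lemma rep_iter K p c s t : all (instr_ok K (size p)) p ->
  @rep K p c s -> rep (iter t (@step _) c) (iter t (pstep p) s).
Proof. by move=> okp rcs; elim: t => //= t; apply: rep_step. Qed.

Lemma step_halting M (c : config M) t :
  halting (cstate c) -> iter t (@step M) c = c.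
Proof. by move=> h; elim: t => //= t ->; rewrite /step h. Qed.

Definition input_tape (x : word) : int -> sym :=
  fun z => match z with Posz i => nth None [seq Some (inl b) | b <- x] i
                      | Negz _ => None end.

Definition init_store (x : word) : store :=
  fun i => (0%R, if i == 0 then input_tape x else fun=> None).

Lemma exec_machine K c x s t T : tapes_ok K c -> exec c (init_store x) s t ->
  t <= T -> let cf := iter T (@step _) (init (prog_machine K (code 0 c)) x) in
  halting (cstate cf) /\
  forall i : 'I_K.+1, (Defs.head cf i, tape cf i) = s i.
Proof.
move=> okc ex le_tT.
have okp : all (instr_ok K (size (code 0 c))) (code 0 c).
  by rewrite -[size _]add0n; apply: code_ok.
have r0 : rep (init (prog_machine K (code 0 c)) x) (0, init_store x).
  split=> //= i; rewrite /init_store -val_eqE /=; congr (_, _).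
  by apply: functional_extensionality; case=> n; case: eqP.
have := rep_iter t okp r0.
have := exec_code ex [::] [::]; rewrite /= cats0 => -> [Hq _ Ht].
have h : halting (cstate (iter t (@step _) (init (prog_machine K (code 0 c)) x))).
  by apply/eqP.
by rewrite -(subnK le_tT) iterD step_halting.
Qed.

Definition mark : sym := Some (inl true).

(* A register is a tape whose only mark is on cell 0, and its value is the head position:
   incrementing, decrementing and testing for zero take one step each. *)
Definition store_of (K : nat) (x : word) (i : nat) (v : nat -> nat) (w : word) :
    store :=
  fun t => if t == 0 then (Posz i, input_tape x)
           else if t == K then (Posz (size w), input_tape w)
           else (Posz (v t), fun z => if (t < K) && (z == 0%R) then mark else None).

Definition inc (r : nat) := Op r (fun s => (s, Right)).
Definition dec (r : nat) :=
  Op r (fun s => (s, if s == mark then Stay else Left)).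
Definition nonzero : pred sym := fun s => s != mark.
Definition while_nz (r : nat) := While r nonzero.
Definition forward := Op 0 (fun s => (s, Right)).
Definition backward := Op 0 (fun s => (s, Left)).
Definition emit (K : nat) (b : bool) := Op K (fun=> (Some (inl b), Right)).

Definition run (c : cmd) (s s' : store) (T : nat) : Prop :=
  exists2 t, t <= T & exec c s s' t.

Lemma run_seq c1 c2 s1 s2 s3 T1 T2 : run c1 s1 s2 T1 -> run c2 s2 s3 T2 ->
  run (Seq c1 c2) s1 s3 (T1 + T2).
Proof.
case=> t1 le1 ex1 [t2 le2 ex2]; exists (t1 + t2); first lia.
exact: ExecSeq ex1 ex2.
Qed.

Lemma run_le c s s' T T' : run c s s' T -> T <= T' -> run c s s' T'.
Proof. by case=> t le ex le'; exists t => //; apply: leq_trans le'. Qed.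

Lemma run_while r (P : pred sym) c n (S : nat -> store) T :
  (forall j, j < n -> P (scan (S j) r)) -> ~~ P (scan (S n) r) ->
  (forall j, j < n -> run c (S j) (S j.+1) (T j)) ->
  run (While r P c) (S 0) (S n) (\sum_(j < n) (T j + 2)).+1.
Proof.
elim: n S T => [|n IH] S T HP HN Hr.
  by exists 1 => //; apply: ExecWhileF.
have [||t2 le2 ex2] := IH (fun j => S j.+1) (fun j => T j.+1) _ HN.
- by move=> j lt; apply: HP.
- by move=> j lt; apply: Hr.
have [t1 le1 ex1] := Hr 0 isT.
exists (t1 + t2).+2; last exact: ExecWhileT (HP 0 isT) ex1 ex2.
rewrite big_ord_recl (eq_bigr (fun j : 'I_n => T j.+1 + 2)) //=.
by move: (\sum_(i < n) _) le2 => q le2; lia.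
Qed.

Lemma sum_const_le n c : \sum_(j < n) c = n * c.
Proof. by rewrite sum_nat_const card_ord. Qed.

Lemma run_while_const r (P : pred sym) c n (S : nat -> store) T :
  (forall j, j < n -> P (scan (S j) r)) -> ~~ P (scan (S n) r) ->
  (forall j, j < n -> run c (S j) (S j.+1) T) ->
  run (While r P c) (S 0) (S n) (n * (T + 2)).+1.
Proof.
by move=> HP HN Hr; have:= run_while HP HN Hr; rewrite sum_const_le.
Qed.

Lemma upd_id (T : Type) (s : nat -> T) i : upd s i (s i) = s.
Proof. by apply: functional_extensionality => j; rewrite /upd; case: eqP => // ->. Qed.

Section Registers.
Variables (K : nat) (x : word).
Local Notation st := (store_of K x).

Lemma scan_reg i v w r : 0 < r < K -> nonzero (scan (st i v w) r) = (v r != 0).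
Proof.
move=> /andP[r0 rK]; rewrite /scan /store_of.
rewrite !(gtn_eqF r0) (ltn_eqF rK) rK /= /nonzero.
by case: (v r).
Qed.

Lemma run_inc i v w r : 0 < r < K ->
  run (inc r) (st i v w) (st i (upd v r (v r).+1) w) 1.
Proof.
move=> /andP[r0 rK]; exists 1 => //.
set s := st _ _ w; set s' := st _ _ _.
suff -> : s' = upd s r (act (fun s => (s, Right)) (s r)) by apply: ExecOp.
apply: functional_extensionality => t; rewrite /upd /act /s' /s /store_of /=.
case: (t =P r) => [->|/eqP tr]; last by rewrite /upd (negPf tr).
rewrite !(gtn_eqF r0) (ltn_eqF rK) rK /= /upd eqxx.
congr (_, _); first lia.
by apply: functional_extensionality => z; case: (z =P Posz (v r)) => // ->.
Qed.

Lemma run_dec i v w r : 0 < r < K ->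
  run (dec r) (st i v w) (st i (upd v r (v r).-1) w) 1.
Proof.
move=> /andP[r0 rK]; exists 1 => //.
set s := st _ _ w; set s' := st _ _ _.
suff -> : s' = upd s r (act (fun s => (s, if s == mark then Stay else Left)) (s r)).
  by apply: ExecOp.
apply: functional_extensionality => t; rewrite /upd /act /s' /s /store_of /=.
case: (t =P r) => [->|/eqP tr]; last by rewrite /upd (negPf tr).
rewrite !(gtn_eqF r0) (ltn_eqF rK) rK /= /upd eqxx.
congr (_, _); last first.
  by apply: functional_extensionality => z; case: (z =P Posz (v r)) => // ->.
by case: (v r) => //= n; lia.
Qed.

Lemma run_forward i v w : run forward (st i v w) (st i.+1 v w) 1.
Proof.
exists 1 => //; rewrite /forward; set s := st _ _ _; set s' := st _ _ _.
suff -> : s' = upd s 0 (act (fun s => (s, Right)) (s 0)) by apply: ExecOp.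
apply: functional_extensionality => t; rewrite /upd /act /s' /s /store_of /=.
case: (t =P 0) => // _; congr (_, _); first lia.
by apply: functional_extensionality => z; case: (z =P Posz i) => // ->.
Qed.

Lemma run_backward i v w : run backward (st i.+1 v w) (st i v w) 1.
Proof.
exists 1 => //; rewrite /backward; set s := st _ _ _; set s' := st _ _ _.
suff -> : s' = upd s 0 (act (fun s => (s, Left)) (s 0)) by apply: ExecOp.
apply: functional_extensionality => t; rewrite /upd /act /s' /s /store_of /=.
case: (t =P 0) => // _; congr (_, _); first lia.
by apply: functional_extensionality => z; case: (z =P Posz i.+1) => // ->.
Qed.

Lemma run_emit i v w b : 0 < K -> run (emit K b) (st i v w) (st i v (rcons w b)) 1.
Proof.
move=> K0; exists 1 => //; rewrite /emit; set s := st _ _ _; set s' := st _ _ _.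
suff -> : s' = upd s K (act (fun=> (Some (inl b), Right)) (s K)) by apply: ExecOp.
apply: functional_extensionality => t; rewrite /upd /act /s' /s /store_of /=.
case: (t =P K) => // ->; rewrite eqxx !(gtn_eqF K0) size_rcons /=.
congr (_, _); first lia.
apply: functional_extensionality; case=> n //=.
rewrite map_rcons nth_rcons size_map eqz_nat.
by case: ltngtP => // lt; rewrite nth_default // size_map ltnW.
Qed.

Lemma run_if r (P : pred sym) c s s' T : ~~ P (scan s r) -> s = s' ->
  run (If r P c) s s' T.+1.
Proof. by move=> nP <-; exists 1 => //; apply: ExecIfF. Qed.

Lemma run_ifT r (P : pred sym) c s s' T : P (scan s r) -> run c s s' T ->
  run (If r P c) s s' T.+1.
Proof. by move=> HP [t le ex]; exists t.+1 => //; apply: ExecIfT. Qed.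

(* One pass of a loop that decrements [r]; the registers after [j] passes are [f j]. *)
Lemma run_count_down r c i (f : nat -> nat -> nat) w n T (g : nat -> nat) :
  0 < r < K -> (forall j, j <= n -> f j r = n - j) ->
  (forall j, j < n -> run c (st (g j) (f j) w) (st (g j.+1) (f j.+1) w) (T j)) ->
  i = g 0 ->
  run (while_nz r c) (st i (f 0) w) (st (g n) (f n) w) (\sum_(j < n) (T j + 2)).+1.
Proof.
move=> rK fr Hr ->.
apply: (@run_while r nonzero c n (fun j => st (g j) (f j) w) T) => //.
  by move=> j lt; rewrite scan_reg // fr //; lia.
by rewrite scan_reg // fr // subnn.
Qed.

End Registers.

(** * Bounded sums on a Turing machine *)

(* Without recursion, the value of a term and the time needed to compute it are
   polynomially bounded by construction; [Var] is a de Bruijn index bound by [Sum]. *)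
Inductive term :=
| Var of nat
| Const of nat
| Len
| Inp of term
| Add of term & term
| Sub of term & term
| Sum of term & term.

(** The value 2 stands for the blank, so that terms can recognise the end of the input. *)
Definition input_at (x : word) (i : nat) : nat :=
  nth 2 [seq nat_of_bool b | b <- x] i.

Fixpoint ev (t : term) (x : word) (e : seq nat) : nat :=
  match t with
  | Var i => nth 0 e i
  | Const c => c
  | Len => size x
  | Inp t => input_at x (ev t x e)
  | Add t1 t2 => ev t1 x e + ev t2 x e
  | Sub t1 t2 => ev t1 x e - ev t2 x e
  | Sum n b => \sum_(j < ev n x e) ev b x (nat_of_ord j :: e)
  end.

(** Built from values of terms by additions, constant factors and range sums only, so that
    polynomial bounds carry over from [ev]. *)
Fixpoint cost (t : term) (x : word) (e : seq nat) : nat :=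
  match t with
  | Var i => 9 * nth 0 e i + 2
  | Const c => c + 1
  | Len => 9 * size x + 2
  | Inp t => cost t x e + (9 * ev t x e + 10)
  | Add t1 t2 => cost t1 x e + cost t2 x e
  | Sub t1 t2 => cost t1 x e + cost t2 x e + (4 * ev t1 x e + 4 * ev t2 x e + 2)
  | Sum n b => cost n x e + ((\sum_(j < ev n x e) (cost b x (nat_of_ord j :: e) + 4))
                 + 3 * ev n x e + 2)
  end.

(** The two arguments are evaluated one after the other on the same scratch registers, hence the
    maximum. *)
Fixpoint depth (t : term) : nat :=
  match t with
  | Var _ | Const _ | Len => 2
  | Inp t => (depth t).+2
  | Add t1 t2 => maxn (depth t1) (depth t2)
  | Sub t1 t2 | Sum t1 t2 => (maxn (depth t1) (depth t2)).+2
  end.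

Definition is_bit (b : bool) : pred sym := fun s => s == Some (inl b).
Definition is_blank : pred sym := fun s => s == None.

(* Adds the value of [t] to register [r]; the variables are held by the registers [e],
   and the registers from [d] on are free (zero). *)
Fixpoint acc (t : term) (e : seq nat) (r d : nat) : cmd :=
  match t with
  | Var i =>
      let a := nth d e i in
      Seq (while_nz a (Seq (dec a) (Seq (inc r) (inc d.+1))))
          (while_nz d.+1 (Seq (dec d.+1) (inc a)))
  | Const c => iter c (Seq (inc r)) (dec d)
  | Len => Seq (While 0 (predC is_blank) (Seq forward (Seq (inc r) (inc d))))
               (while_nz d (Seq (dec d) backward))
  | Inp t =>
      Seq (acc t e d d.+2)
     (Seq (while_nz d (Seq (dec d) (Seq (inc d.+1) forward)))
     (Seq (If 0 (is_bit true) (inc r))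
     (Seq (If 0 is_blank (Seq (inc r) (inc r)))
          (while_nz d.+1 (Seq (dec d.+1) backward)))))
  | Add t1 t2 => Seq (acc t1 e r d) (acc t2 e r d)
  | Sub t1 t2 =>
      Seq (acc t1 e d d.+2)
     (Seq (acc t2 e d.+1 d.+2)
     (Seq (while_nz d.+1 (Seq (dec d.+1) (dec d)))
          (while_nz d (Seq (dec d) (inc r)))))
  | Sum n b =>
      Seq (acc n e d d.+2)
     (Seq (while_nz d (Seq (acc b (d.+1 :: e) r d.+2) (Seq (inc d.+1) (dec d))))
          (while_nz d.+1 (dec d.+1)))
  end.

Ltac upd_eq :=
  let k := fresh "k" in
  apply: functional_extensionality => k; rewrite /upd;
  repeat (case: eqP => [?|?]; try subst k); try lia; try congruence.

Section Acc.
Variables (K : nat) (x : word).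
Local Notation st := (store_of K x).

Lemma run_st c s i v v' w T T' :
  run c s (st i v w) T -> v = v' -> T <= T' -> run c s (st i v' w) T'.
Proof. by move=> H <-; apply: run_le. Qed.

Lemma run_move a b i v w : 0 < a < K -> 0 < b < K -> a <> b ->
  run (while_nz a (Seq (dec a) (inc b))) (st i v w)
      (st i (upd (upd v a 0) b (v b + v a)) w) (4 * v a + 1).
Proof.
move=> aK bK ab.
pose f j := upd (upd v a (v a - j)) b (v b + j).
have := @run_count_down K x a (Seq (dec a) (inc b)) i f w (v a) (fun=> 2) (fun=> i) aK.
rewrite sum_const_le (_ : f 0 = v); last by rewrite /f subn0 addn0; upd_eq.
rewrite (_ : f (v a) = upd (upd v a 0) b (v b + v a)); last by rewrite /f ?subnn; upd_eq.
move=> H; apply: (run_le (H _ _ _)) => //; last lia.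
- by move=> j le; rewrite /f /upd eqxx; case: eqP.
move=> j lt; apply: run_st (run_seq (run_dec _ _ _ _ _) (run_inc _ _ _ _ _)) _ _ => //.
by rewrite /f; upd_eq.
Qed.

Lemma run_copy a r d i v w : 0 < a < K -> 0 < r < K -> 0 < d < K ->
  a <> r -> a <> d -> r <> d -> v d = 0 ->
  run (Seq (while_nz a (Seq (dec a) (Seq (inc r) (inc d))))
          (while_nz d (Seq (dec d) (inc a)))) (st i v w)
      (st i (upd v r (v r + v a)) w) (9 * v a + 2).
Proof.
move=> aK rK dK ar ad rd d0.
pose f j := upd (upd (upd v a (v a - j)) r (v r + j)) d j.
have H1 := @run_count_down K x a (Seq (dec a) (Seq (inc r) (inc d))) i f w (v a)
  (fun=> 3) (fun=> i) aK.
have f0 : f 0 = v by rewrite /f; upd_eq.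
have E2 : upd (upd (f (v a)) d 0) a (f (v a) a + f (v a) d) = upd v r (v r + v a).
  by rewrite /f; upd_eq.
have H2 := @run_move d a i (f (v a)) w dK aK (nesym ad).
rewrite E2 in H2; rewrite -{1}f0.
apply: run_le (run_seq (H1 _ _ _) H2) _ => //.
- by move=> j le; rewrite /f /upd eqxx; do 2 case: eqP => // _.
- move=> j lt.
  apply: run_st (run_seq (run_dec _ _ _ _ _)
    (run_seq (run_inc _ _ _ _ _) (run_inc _ _ _ _ _))) _ _ => //.
  by rewrite /f; upd_eq.
rewrite sum_const_le {1}/f /upd eqxx; lia.
Qed.

Lemma run_monus a b i v w : 0 < a < K -> 0 < b < K -> a <> b ->
  run (while_nz b (Seq (dec b) (dec a))) (st i v w)
      (st i (upd (upd v b 0) a (v a - v b)) w) (4 * v b + 1).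
Proof.
move=> aK bK ab.
pose f j := upd (upd v b (v b - j)) a (v a - j).
have := @run_count_down K x b (Seq (dec b) (dec a)) i f w (v b) (fun=> 2) (fun=> i) bK.
rewrite sum_const_le (_ : f 0 = v); last by rewrite /f !subn0; upd_eq.
rewrite (_ : f (v b) = upd (upd v b 0) a (v a - v b)); last by rewrite /f ?subnn; upd_eq.
move=> H; apply: (run_le (H _ _ _)) => //; last lia.
- by move=> j le; rewrite /f /upd eqxx; case: eqP => // E; rewrite E in ab.
move=> j lt; apply: run_st (run_seq (run_dec _ _ _ _ _) (run_dec _ _ _ _ _)) _ _ => //.
by rewrite /f; upd_eq.
Qed.

Lemma run_clear a i v w : 0 < a < K ->
  run (while_nz a (dec a)) (st i v w) (st i (upd v a 0) w) (3 * v a + 1).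
Proof.
move=> aK; pose f j := upd v a (v a - j).
have := @run_count_down K x a (dec a) i f w (v a) (fun=> 1) (fun=> i) aK.
rewrite sum_const_le (_ : f 0 = v); last by rewrite /f !subn0; upd_eq.
rewrite (_ : f (v a) = upd v a 0); last by rewrite /f ?subnn; upd_eq.
move=> H; apply: (run_le (H _ _ _)) => //; last lia.
- by move=> j le; rewrite /f /upd eqxx.
move=> j lt; apply: run_st (run_dec _ _ _ _ _) _ _ => //.
by rewrite /f; upd_eq.
Qed.

Lemma run_backwards a n v w : 0 < a < K -> v a = n ->
  run (while_nz a (Seq (dec a) backward)) (st n v w) (st 0 (upd v a 0) w) (4 * n + 1).
Proof.
move=> aK Ev; pose f j := upd v a (n - j).
have := @run_count_down K x a (Seq (dec a) backward) n f w n (fun=> 2) (fun j => n - j) aK.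
rewrite sum_const_le (_ : f 0 = v); last by rewrite /f subn0; upd_eq.
rewrite (_ : f (n) = upd v a 0); last by rewrite /f ?subnn; upd_eq.
rewrite subnn => H; apply: (run_le (H _ _ _)) => //; last lia.
- by move=> j le; rewrite /f /upd eqxx.
- move=> j lt; have -> : n - j = (n - j.+1).+1 by lia.
  apply: run_st (run_seq (run_dec _ _ _ _ _) (run_backward _ _ _ _ _)) _ _ => //.
  by rewrite /f; upd_eq.
by rewrite subn0.
Qed.

Lemma scan_input i v w : scan (st i v w) 0 = nth None [seq Some (inl b) | b <- x] i.
Proof. by []. Qed.

Lemma run_len r d v w : 0 < r < K -> 0 < d < K -> r <> d -> v d = 0 ->
  run (Seq (While 0 (predC is_blank) (Seq forward (Seq (inc r) (inc d))))
           (while_nz d (Seq (dec d) backward)))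
    (st 0 v w) (st 0 (upd v r (v r + size x)) w) (9 * size x + 2).
Proof.
move=> rK dK rd d0; set n := size x.
pose f j := upd (upd v r (v r + j)) d j.
have f0 : f 0 = v by rewrite /f; upd_eq.
have E2 : upd (f n) d 0 = upd v r (v r + n) by rewrite /f; upd_eq.
have H2 : run (while_nz d (Seq (dec d) backward)) (st n (f n) w)
              (st 0 (upd (f n) d 0) w) (4 * n + 1).
  by apply: run_backwards => //; rewrite /f /upd eqxx.
rewrite E2 in H2; rewrite -{1}f0.
pose S j := st j (f j) w.
have H1 := @run_while_const 0 (predC is_blank)
  (Seq forward (Seq (inc r) (inc d))) n S 3.
apply: run_le (run_seq (H1 _ _ _) H2) _ => //; last lia.
- move=> j lt; rewrite /S /= scan_input /is_blank.
  by rewrite (nth_map false).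
- by rewrite /S /= scan_input /is_blank nth_default ?size_map // negbK.
move=> j lt; apply: run_st (run_seq (run_forward _ _ _ _ _)
  (run_seq (run_inc _ _ _ _ _) (run_inc _ _ _ _ _))) _ _ => //.
by rewrite /f; upd_eq.
Qed.

(** The index is moved from register [d] to [d.+1] while the head advances, so that [d.+1] knows the
    way back. A blank contributes 2, in accordance with [input_at]. *)
Lemma run_read r d v w : 0 < r < K -> 0 < d -> d.+1 < K -> r < d -> v d.+1 = 0 ->
  run (Seq (while_nz d (Seq (dec d) (Seq (inc d.+1) forward)))
      (Seq (If 0 (is_bit true) (inc r))
      (Seq (If 0 is_blank (Seq (inc r) (inc r)))
           (while_nz d.+1 (Seq (dec d.+1) backward)))))
    (st 0 v w) (st 0 (upd (upd v d 0) r (v r + input_at x (v d))) w) (9 * v d + 10).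
Proof.
move=> rK d_gt0 dK rd d0; set n := v d.
have dK' : 0 < d < K by lia.
have dK1 : 0 < d.+1 < K by lia.
pose f j := upd (upd v d (v d - j)) d.+1 j.
have f0 : f 0 = v by rewrite /f; upd_eq.
have H1 := @run_count_down K x d (Seq (dec d) (Seq (inc d.+1) forward)) 0 f w n
  (fun=> 3) id dK'.
pose b := nth (None : sym) [seq Some (inl b) | b <- x] n.
set g1 := upd (f n) r (v r + (b == Some (inl true) :> sym)).
have fr : f n r = v r.
  by rewrite /f /upd; do 2 (case: eqP => [?|_]; try lia).
have H2 : run (If 0 (is_bit true) (inc r)) (st n (f n) w) (st n g1 w) 2.
  rewrite /g1; case Eb: (is_bit true b); rewrite /is_bit in Eb; rewrite Eb.
    apply: run_ifT; first by rewrite scan_input -/b /is_bit Eb.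
    by rewrite -fr addn1; apply: run_inc.
  apply: run_if => //; first by rewrite scan_input -/b /is_bit Eb.
  by rewrite addn0 -fr upd_id.
set g2 := upd (f n) r (v r + input_at x n).
have bE : input_at x n = (b == Some (inl true) :> sym) + (b == None :> sym).*2.
  rewrite /b /input_at; case: (ltnP n (size x)) => lt.
    by rewrite !(nth_map false) // ; case: nth.
  by rewrite !nth_default ?size_map.
have H3 : run (If 0 is_blank (Seq (inc r) (inc r))) (st n g1 w) (st n g2 w) 3.
  case Eb: (is_blank b); rewrite /is_blank in Eb.
    apply: run_ifT; first by rewrite scan_input -/b /is_blank Eb.
    apply: run_st (run_seq (run_inc _ _ _ _ _) (run_inc _ _ _ _ _)) _ _ => //.
    by rewrite /g1 /g2 bE Eb; upd_eq.
  apply: run_if => //; first by rewrite scan_input -/b /is_blank Eb.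
  by rewrite /g1 /g2 bE Eb addn0.
have E4 : upd g2 d.+1 0 = upd (upd v d 0) r (v r + input_at x n).
  by rewrite /g2 /f subnn; upd_eq.
have H4 : run (while_nz d.+1 (Seq (dec d.+1) backward)) (st n g2 w)
              (st 0 (upd g2 d.+1 0) w) (4 * n + 1).
  apply: run_backwards => //; rewrite /g2 /f /upd eqxx.
  by case: eqP => // ?; lia.
rewrite E4 in H4; rewrite -{1}f0.
apply: run_le (run_seq (H1 _ _ _) (run_seq H2 (run_seq H3 H4))) _ => //.
- move=> j le; rewrite /f /upd eqxx; case: eqP => [?|//]; lia.
- move=> j lt.
  apply: run_st (run_seq (run_dec _ _ _ _ _)
    (run_seq (run_inc _ _ _ _ _) (run_forward _ _ _ _ _))) _ _ => //.
  by rewrite /f; upd_eq.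
by rewrite sum_const_le; lia.
Qed.

End Acc.

Section AccCorrect.
Variables (K : nat) (x : word).
Local Notation st := (store_of K x).

Lemma map_upd (v : nat -> nat) e r n :
  r \notin e -> [seq upd v r n j | j <- e] = [seq v j | j <- e].
Proof.
move=> re; apply/eq_in_map => j je; rewrite /upd; case: eqP => // E.
by rewrite -E je in re.
Qed.

(** The trailing [dec d] merely ends the iteration: on a register that holds zero it changes
    nothing. *)
Lemma run_consts c r d v w : 0 < r < K -> 0 < d < K -> v d = 0 -> r <> d ->
  run (iter c (Seq (inc r)) (dec d)) (st 0 v w) (st 0 (upd v r (v r + c)) w) (c + 1).
Proof.
move=> rK dK + rd; elim: c v => [|c IH] v d0 /=.
  apply: run_st (run_dec _ _ _ _ _) _ _ => //.
  by rewrite addn0 upd_id d0; upd_eq.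
apply: run_st (run_seq (run_inc _ _ _ _ _) (IH _ _)) _ _ => //.
  rewrite /upd; case: eqP => // E; rewrite E in rd; by case: rd.
by upd_eq.
Qed.

(** Only [r] differs at the end, so all scratch registers are zero again. This allows a sum to run
    its body repeatedly, and an operator to evaluate both arguments in the same scratch space. *)
Lemma run_acc t e r d v w :
  all (fun j => 0 < j < d) e -> 0 < r < d -> r \notin e -> d + depth t <= K ->
  (forall j, d <= j -> v j = 0) ->
  run (acc t e r d) (st 0 v w)
      (st 0 (upd v r (v r + ev t x [seq v j | j <- e])) w)
      (cost t x [seq v j | j <- e]).
Proof.
elim: t e r d v => [i|c||t IH|t1 IH1 t2 IH2|t1 IH1 t2 IH2|t1 IH1 t2 IH2]
  e r d v He Hr re /= dK v0.
- have ne a : a \in e -> 0 < a < d by move/(allP He).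
  (* An unbound variable is read from register [d], which holds zero, in agreement with the default
     value of [nth] in [ev]; this is why the copying uses [d.+1] as scratch. *)
  set a := nth d e i.
  have aP : a <= d /\ a <> r /\ 0 < a.
    case: (ltnP i (size e)) => [lt|ge]; last first.
      by have -> : a = d by [rewrite /a nth_default]; lia.
    have ae : a \in e by apply: mem_nth.
    have la := ne a ae; split; [lia | split; [|lia]].
    by move=> E; rewrite -E ae in re.
  have -> : nth 0 [seq v j | j <- e] i = v a.
    rewrite /a; case: (ltnP i (size e)) => [lt|ge]; first by rewrite (nth_map d).
    by rewrite !nth_default ?size_map // v0.
  by apply: run_copy; try lia; apply: v0; lia.
- by apply: run_consts; try lia; apply: v0; lia.
- by apply: run_len; try lia; apply: v0; lia.
- have de : d \notin e by apply/negP => /(allP He); lia.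
  have He' : all (fun j => 0 < j < d.+2) e.
    by apply: sub_all He => j; lia.
  have H1 := IH e d d.+2 v He' _ de _ _.
  apply: run_st (run_seq (H1 _ _ _) (run_read _ _ _ _ _ _ _)) _ _ => //; try lia.
  + by move=> j le; apply: v0; lia.
  + by rewrite /upd; case: eqP => [|_]; [lia|apply: v0; lia].
  + have d0 := v0 d (leqnn d).
    have rd : (r == d) = false by lia.
    apply: functional_extensionality => k; rewrite /upd eqxx rd d0 add0n.
    by case: (k =P r) => // _; case: (k =P d) => // ->.
  + by rewrite /upd eqxx v0.
- have H1 := IH1 e r d v He Hr re _ v0.
  set v1 := upd v r (v r + ev t1 x [seq v j | j <- e]) in H1.
  have v10 j : d <= j -> v1 j = 0.
    by move=> le; rewrite /v1 /upd; case: eqP => ?; [lia | apply: v0].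
  have H2 := IH2 e r d v1 He Hr re _ v10.
  rewrite map_upd // in H2.
  apply: run_st (run_seq (H1 _) (H2 _)) _ _ => //; try lia.
  by rewrite /v1; upd_eq.
- have de : d \notin e by apply/negP => /(allP He); lia.
  have de1 : d.+1 \notin e by apply/negP => /(allP He); lia.
  have He' : all (fun j => 0 < j < d.+2) e.
    by apply: sub_all He => j; lia.
  have d0 := v0 d (leqnn d). have d10 := v0 d.+1 (leqnSn d).
  have H1 := IH1 e d d.+2 v He' _ de _ _.
  set n1 := ev t1 x _; set n2 := ev t2 x _.
  rewrite d0 add0n -/n1 in H1; set v1 := upd v d n1 in H1.
  have v10 j : d.+1 <= j -> v1 j = 0.
    by move=> le; rewrite /v1 /upd; case: eqP => ?; [lia | apply: v0; lia].
  have H2 := IH2 e d.+1 d.+2 v1 He' _ de1 _ _.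
  rewrite map_upd // v10 // add0n -/n2 in H2.
  apply: run_st (run_seq (H1 _ _ _) (run_seq (H2 _ _ _)
    (run_seq (run_monus _ _ _ _ _ _ _) (run_move _ _ _ _ _ _ _)))) _ _ => //; try lia.
  + by move=> j le; apply: v0; lia.
  + by move=> j le; apply: v10; lia.
  + rewrite /v1; apply: functional_extensionality => k; rewrite /upd.
    have dd : (d == d.+1) = false by lia.
    have d1d : (d.+1 == d) = false by lia.
    have rd : (r == d) = false by lia.
    have rd1 : (r == d.+1) = false by lia.
    rewrite !eqxx ?dd ?d1d ?rd ?rd1.
    case: (k =P r) => // _; case: (k =P d) => [->|_]; first by rewrite d0.
    by case: (k =P d.+1) => [->|_] //; rewrite d10.
  + rewrite /v1 /upd !eqxx.
    have dd : (d == d.+1) = false by lia.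
    have d1d : (d.+1 == d) = false by lia.
    rewrite ?dd ?d1d; lia.
have de : d \notin e by apply/negP => /(allP He); lia.
have de1 : d.+1 \notin e by apply/negP => /(allP He); lia.
have He' : all (fun j => 0 < j < d.+2) e.
  by apply: sub_all He => j; lia.
have d0 := v0 d (leqnn d). have d10 := v0 d.+1 (leqnSn d).
have H1 := IH1 e d d.+2 v He' _ de _ _.
set vs := [seq v j | j <- e]; set n := ev t1 x vs.
rewrite d0 add0n -/vs -/n in H1.
pose S j := \sum_(i < j) ev t2 x (nat_of_ord i :: vs).
(* After [j] rounds, [d] holds the rounds left, [d.+1] the summation index and [r] the partial
   sum. *)
pose f j := upd (upd (upd v d (n - j)) d.+1 j) r (v r + S j).
have f0 : f 0 = upd v d n.
  rewrite /f /S big_ord0 addn0 subn0; upd_eq.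
have H2 := @run_count_down K x d (Seq (acc t2 (d.+1 :: e) r d.+2)
  (Seq (inc d.+1) (dec d))) 0 f w n (fun j => cost t2 x (j :: vs) + 2) (fun=> 0).
rewrite f0 in H2.
have rd : (r == d) = false by lia.
have dr : (d == r) = false by lia.
have rd1 : (r == d.+1) = false by lia.
have d1r : (d.+1 == r) = false by lia.
have dd : (d == d.+1) = false by lia.
have d1d : (d.+1 == d) = false by lia.
apply: run_st (run_seq (H1 _ _ _) (run_seq (H2 _ _ _ _) (run_clear _ _ _ _ _))) _ _
  => //; try lia.
- by move=> j le; apply: v0; lia.
- by move=> j le; rewrite /f /upd eqxx dr dd.
- move=> j lt.
  have Hv : forall k, d.+2 <= k -> f j k = 0.
    move=> k le; rewrite /f /upd; do 3 (case: eqP => ?; first lia).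
    by apply: v0; lia.
  have fe : [seq f j k | k <- d.+1 :: e] = j :: vs.
    by rewrite /= !map_upd // /f /upd eqxx d1r.
  have H3 := IH2 (d.+1 :: e) r d.+2 (f j) _ _ _ _ Hv.
  rewrite fe in H3.
  apply: run_st (run_seq (H3 _ _ _ _)
    (run_seq (run_inc _ _ _ _ _) (run_dec _ _ _ _ _))) _ _ => //=; try lia.
  + by rewrite inE rd1.
  + have SS : S j.+1 = S j + ev t2 x (j :: vs) by rewrite /S big_ord_recr.
    apply: functional_extensionality => k; rewrite /f /upd !eqxx SS.
    rewrite ?dd ?d1d ?d1r ?dr.
    case: (k =P r) => [->|_]; first by rewrite rd rd1; lia.
    by case: (k =P d) => [->|_]; rewrite ?dd; [lia|]; case: (k =P d.+1).
- rewrite /f; apply: functional_extensionality => k; rewrite /upd.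
  rewrite ?eqxx subnn ?d1r; case: (k =P d.+1) => [->|_]; first by rewrite d1r d10.
  by case: (k =P r) => [_|_] //; case: (k =P d) => [->|_] //; rewrite d0.
rewrite /f /upd eqxx d1r.
have -> : \sum_(j < n) (cost t2 x (nat_of_ord j :: vs) + 2 + 2)
       = \sum_(j < n) (cost t2 x (nat_of_ord j :: vs) + 4).
  by apply: eq_bigr => j _; lia.
move: (\sum_(j < n) _) => q; lia.
Qed.

End AccCorrect.

Lemma tapes_acc K t e r d :
  all (fun j => j < d) e -> r < d -> d + depth t <= K -> tapes_ok K (acc t e r d).
Proof.
elim: t e r d => [i|c||t IH|t1 IH1 t2 IH2|t1 IH1 t2 IH2|t1 IH1 t2 IH2] e r d He Hr /= dK;
  have He2 : all (fun j => j < d.+2) e by apply: sub_all He => j; lia.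
- have la : nth d e i <= d.
    case: (ltnP i (size e)) => [lt|ge]; last by rewrite nth_default.
    by have /(allP He) := mem_nth d lt; apply: ltnW.
  lia.
- by elim: c => /= [|c ->]; lia.
- lia.
- by rewrite IH //=; lia.
- by rewrite IH1 ?IH2 //; lia.
- by rewrite IH1 ?IH2 //=; lia.
by rewrite IH1 ?IH2 //=; lia.
Qed.

(** The environment is counted along with the input because a summation index enters the environment
    of the body. The summand 2 keeps the base above 1, so that constants and sums are absorbed by
    the exponent. *)
Definition poly_bounded (f : word -> seq nat -> nat) : Prop :=
  exists d, forall x e, f x e <= (size x + sumn e + 2) ^ d.

Lemma leq_add_pow N a b i j : 1 < N -> a <= N ^ i -> b <= N ^ j -> a + b <= N ^ (i + j).+1.
Proof.
move=> N1 ai bj; rewrite expnS expnD.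
have := expn_gt0 N i; have := expn_gt0 N j; rewrite (ltnW N1) /= => *.
by apply: (@leq_trans (2 * (N ^ i * N ^ j))); [nia | rewrite leq_mul2r N1 orbT].
Qed.

Lemma poly_boundedD f g : poly_bounded f -> poly_bounded g ->
  poly_bounded (fun x e => f x e + g x e).
Proof.
case=> i fi [j gj]; exists (i + j).+1 => x e; apply: leq_add_pow => //.
by rewrite addn2.
Qed.

Lemma poly_boundedM f g : poly_bounded f -> poly_bounded g ->
  poly_bounded (fun x e => f x e * g x e).
Proof. by case=> i fi [j gj]; exists (i + j) => x e; rewrite expnD leq_mul. Qed.

Lemma poly_bounded_const c : poly_bounded (fun _ _ => c).
Proof.
exists c => x e; apply: leq_trans (ltnW (ltn_expl c (isT : 1 < 2))) _.
by case: c => // c; rewrite leq_exp2r // addn2.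
Qed.

Lemma poly_bounded_le f g : (forall x e, f x e <= g x e) -> poly_bounded g -> poly_bounded f.
Proof. by move=> fg [d gd]; exists d => x e; apply: leq_trans (fg x e) _. Qed.

Lemma poly_bounded_size : poly_bounded (fun x _ => size x).
Proof. by exists 1 => x e; rewrite expn1; lia. Qed.

Lemma poly_bounded_nth i : poly_bounded (fun _ e => nth 0 e i).
Proof.
exists 1 => x e; rewrite expn1.
suff : nth 0 e i <= sumn e by lia.
by elim: e i => [|a e IH] [|i] //=; [lia | have := IH i; lia].
Qed.

(** If $N$ is the base outside and $N^i$ bounds the range, the base seen by the body is at most $N +
    N^i \le N^{i+2}$. *)
Lemma poly_bounded_sum n f : poly_bounded n -> poly_bounded f ->
  poly_bounded (fun x e => \sum_(j < n x e) f x (nat_of_ord j :: e)).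
Proof.
case=> i ni [j fj]; exists (i + (1 + i).+1 * j) => x e.
set N := size x + sumn e + 2.
have N1 : 1 < N by rewrite /N addn2.
apply: (@leq_trans (\sum_(k < n x e) N ^ ((1 + i).+1 * j))).
  apply: leq_sum => k _; apply: leq_trans (fj _ _) _; rewrite expnM.
  case: (j) => // j'; rewrite leq_exp2r //=.
  have := @leq_add_pow N N (N ^ i) 1 i N1; rewrite expn1 => /(_ (leqnn _) (leqnn _)).
  apply: leq_trans; rewrite /N.
  have := ni x e; have := ltn_ord k; rewrite -/N; lia.
by rewrite sum_const_le expnD leq_mul2r ni orbT.
Qed.

Lemma input_at_le x i : input_at x i <= 2.
Proof.
rewrite /input_at; case: (ltnP i (size x)) => lt; last by rewrite nth_default ?size_map.
by rewrite (nth_map false) //; case: nth.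
Qed.

Lemma poly_bounded_ev t : poly_bounded (ev t).
Proof.
elim: t => [i|c||t _|t1 IH1 t2 IH2|t1 IH1 t2 _|n IHn b IHb] /=.
- exact: poly_bounded_nth.
- exact: poly_bounded_const.
- exact: poly_bounded_size.
- by apply: poly_bounded_le (poly_bounded_const 2) => x e; apply: input_at_le.
- exact: poly_boundedD.
- by apply: poly_bounded_le IH1 => x e; apply: leq_subr.
exact: poly_bounded_sum.
Qed.

Lemma poly_bounded_cost t : poly_bounded (cost t).
Proof.
have M c f : poly_bounded f -> poly_bounded (fun x e => c * f x e).
  by apply: poly_boundedM; apply: poly_bounded_const.
have C := poly_bounded_const; have D := poly_boundedD; have E := poly_bounded_ev.
elim: t => [i|c||t IH|t1 IH1 t2 IH2|t1 IH1 t2 IH2|n IHn b IHb] /=.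
- by apply: D (M 9 _ (poly_bounded_nth i)) (C 2).
- exact: C.
- by apply: D (M 9 _ poly_bounded_size) (C 2).
- by apply: (D _ _ IH (D _ _ (M 9 _ (E t)) (C 10))).
- exact: D.
- by apply: (D _ _ (D _ _ IH1 IH2) (D _ _ (D _ _ (M 4 _ (E t1)) (M 4 _ (E t2))) (C 2))).
have S := poly_bounded_sum (E n) (D _ _ IHb (C 4)).
by apply: (D _ _ IHn (D _ _ (D _ _ S (M 3 _ (E n))) (C 2))).
Qed.

(** * Writing a word bit by bit *)

Fixpoint marks (m : nat) : cmd :=
  if m is m'.+1 then Seq (marks m') (Op m (fun=> (mark, Stay)))
  else Op 0 (fun s => (s, Stay)).

Lemma run_marks K x : 0 < K ->
  run (marks K.-1) (init_store x) (store_of K x 0 (fun=> 0) [::]) K.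
Proof.
move=> K0.
pose S m : store := fun t => (Posz 0, if t == 0 then input_tape x else
  if t <= m then (fun z => if z == 0%R then mark else None) else fun=> None).
have -> : store_of K x 0 (fun=> 0) [::] = S K.-1.
  apply: functional_extensionality => t; rewrite /store_of /S.
  case: (t =P 0) => // t0; case: (t =P K) => [->|tK]; congr (_, _).
    rewrite ifF; last lia.
    by apply: functional_extensionality; case=> //= n; rewrite nth_nil.
  rewrite (_ : t <= K.-1 = (t < K)); last lia.
  by case: (t < K) => //=.
suff H m : run (marks m) (init_store x) (S m) m.+1 by have := H K.-1; rewrite prednK.
elim: m => [|m IH] /=.
  exists 1 => //; set s := init_store x.
  suff -> : S 0 = upd s 0 (act (fun s => (s, Stay)) (s 0)) by apply: ExecOp.
  apply: functional_extensionality => t; rewrite /upd /act /s /S /init_store /=.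
  case: (t =P 0) => [_|t0]; last by rewrite ifF //; lia.
  by congr (_, _); apply: functional_extensionality => z; case: eqP => // ->.
suff H : run (Op m.+1 (fun=> (mark, Stay))) (S m) (S m.+1) 1.
  by have := run_seq IH H; rewrite addn1.
exists 1 => //.
suff -> : S m.+1 = upd (S m) m.+1 (act (fun=> (mark, Stay)) (S m m.+1)) by apply: ExecOp.
apply: functional_extensionality => t; rewrite /upd /act /S /=.
case: (t =P 0) => [->//|t0]; case: (t =P m.+1) => [->|tm]; congr (_, _).
  by rewrite leqnn ltnn.
by congr (if _ then _ else _); lia.
Qed.

Section Emit.
Variables (L B : term).

Definition room := (4 + (depth L + depth B)).

(** Register 1 counts the bits still to be written, register 2 holds the position to which variable
    0 of [B] refers, and register 3 receives the value of [B]. Two complementary tests on register 3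
    replace a two-way branch. *)
Definition emit_loop : cmd :=
  while_nz 1 (Seq (acc B [:: 2] 3 4)
    (Seq (If 3 nonzero (emit room true))
    (Seq (If 3 (predC nonzero) (emit room false))
    (Seq (while_nz 3 (dec 3)) (Seq (inc 2) (dec 1)))))).

Definition emit_cmd : cmd :=
  Seq (marks room.-1) (Seq (acc L [::] 1 4) emit_loop).

Lemma tapes_emit_cmd : tapes_ok room emit_cmd.
Proof.
have le : 4 <= room by rewrite /room; lia.
rewrite /emit_cmd /emit_loop /= leqnn !tapes_acc //=; try by rewrite /room; lia.
suff H m : m <= room -> tapes_ok room (marks m) by rewrite H /room; lia.
by elim: m => //= m IH le'; rewrite IH ?le' // ltnW.
Qed.

Definition emit_word (x : word) : word :=
  mkseq (fun i => ev B x [:: i] != 0) (ev L x [::]).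

Definition emit_cost (x : word) (e : seq nat) : nat :=
  (room + (cost L x e + ((\sum_(j < ev L x e) ((cost B x (nat_of_ord j :: e)
      + 3 * ev B x (nat_of_ord j :: e)) + 10)) + 1))).

Lemma depth_gt1 t : 1 < depth t.
Proof. by elim: t => //= *; lia. Qed.

Lemma run_emit_cmd x : exists v,
  run emit_cmd (init_store x) (store_of room x 0 v (emit_word x)) (emit_cost x [::]).
Proof.
have dL := depth_gt1 L; have dB := depth_gt1 B.
have K4 : 4 < room by rewrite /room; lia.
set n := ev L x [::].
pose f j : nat -> nat := upd (upd (fun=> 0) 1 (n - j)) 2 j.
have f0 : f 0 = upd (fun=> 0) 1 (0 + n).
  by rewrite /f subn0 add0n; upd_eq.
exists (f n); rewrite /emit_cmd /emit_cost.
apply: run_seq; first by apply: run_marks; lia.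
have H1 := @run_acc room x L [::] 1 4 (fun=> 0) [::] isT isT isT _ _.
apply: run_seq; first by apply: H1 => //; rewrite /room; lia.
rewrite /= -/n -f0.
pose w j := mkseq (fun i => ev B x [:: i] != 0) j.
rewrite -[[::]]/(w 0) -[emit_word x]/(w n).
pose S j := store_of room x 0 (f j) (w j).
rewrite -/(S 0) -/(S n).
rewrite -[emit_loop]/(While 1 nonzero _).
set body := Seq _ _.
have f1 j : f j 1 = n - j by [].
have f2 j : f j 2 = j by [].
have f3 j k : 3 <= k -> f j k = 0.
  by move=> le; rewrite /f /upd !ifF //; lia.
have H := @run_while 1 nonzero body n S
  (fun j => cost B x [:: j] + 3 * ev B x [:: j] + 8).
have S1 j : nonzero (scan (S j) 1) = (n - j != 0).
  by rewrite /S scan_reg ?f1 //; lia.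
apply: (run_le (H _ _ _)).
- by move=> j lt; rewrite S1; lia.
- by rewrite S1 subnn.
- move=> j lt; set b := ev B x [:: j].
  have HB := @run_acc room x B [:: 2] 3 4 (f j) (w j) isT isT isT _ _.
  rewrite /= f2 f3 // add0n -/b in HB.
  have Ew : w j.+1 = rcons (w j) (b != 0) by rewrite /w /mkseq -addn1 iotaD map_cat cats1.
  set v := upd (f j) 3 b in HB.
  have nz u : nonzero (scan (store_of room x 0 v u) 3) = (b != 0).
    by rewrite scan_reg // ; lia.
  pose w1 := if b != 0 then w j.+1 else w j.
  have H2 : run (If 3 nonzero (emit room true)) (store_of room x 0 v (w j))
                (store_of room x 0 v w1) 2.
    rewrite /w1; case: ifP => b0.
      by rewrite Ew b0; apply: run_ifT; [rewrite nz | apply: run_emit; lia].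
    by apply: run_if => //; rewrite nz b0.
  have H3 : run (If 3 (predC nonzero) (emit room false)) (store_of room x 0 v w1)
                (store_of room x 0 v (w j.+1)) 2.
    rewrite /w1; case: ifP => b0.
      by apply: run_if => //; rewrite /= nz b0.
    by rewrite Ew b0; apply: run_ifT; [rewrite /= nz b0 | apply: run_emit; lia].
  apply: run_st (run_seq (HB _ _) (run_seq H2 (run_seq H3 (run_seq (run_clear _ _ _ _ _)
    (run_seq (run_inc _ _ _ _ _) (run_dec _ _ _ _ _)))))) _ _ => //; try lia.
  + by rewrite /room; lia.
  + by move=> k le; apply: f3; lia.
  + apply: functional_extensionality => k; rewrite /v /f /upd.
    by case: k => [|[|[|[|k]]]] //=; lia.
  rewrite /v {1}/upd eqxx; lia.
have -> : \sum_(j < n) (cost B x [:: nat_of_ord j] + 3 * ev B x [:: nat_of_ord j] + 8 + 2)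
       = \sum_(j < n) (cost B x [:: nat_of_ord j] + 3 * ev B x [:: nat_of_ord j] + 10).
  by apply: eq_bigr => j _; lia.
by rewrite addn1.
Qed.

Lemma poly_bounded_emit_cost : poly_bounded emit_cost.
Proof.
have C := poly_bounded_const; have D := poly_boundedD.
have H := D _ _ (D _ _ (poly_bounded_cost B) (poly_boundedM (C 3) (poly_bounded_ev B))) (C 10).
exact: (D _ _ (C _) (D _ _ (poly_bounded_cost L)
  (D _ _ (poly_bounded_sum (poly_bounded_ev L) H) (C 1)))).
Qed.

Lemma polytime_emit : polytime emit_word.
Proof.
have [d Hd] := poly_bounded_emit_cost.
have okc := tapes_emit_cmd.
(* The factor $3^d$ comes from $n + 2 \le 3n$ for $n > 0$; the additive constant covers the empty
   input. *)
exists (prog_machine room (code 0 emit_cmd)), (3 ^ d), d => x c.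
have [v [t le ex]] := run_emit_cmd x.
have [|h Ht] := @exec_machine room emit_cmd x _ t (3 ^ d * size x ^ d + 3 ^ d) okc ex.
  apply: leq_trans le _; apply: leq_trans (Hd _ _) _; rewrite addn0.
  case: (size x) => [|n].
    rewrite add0n; apply: leq_trans (leq_addl _ _).
    by case: (d) => // d'; rewrite leq_exp2r.
  rewrite -expnMn; apply: leq_trans (leq_addr _ _).
  by case: (d) => // d'; rewrite leq_exp2r //; lia.
split; first exact: h.
move=> i le_i.
have Es w : store_of room x 0 v w room = (Posz (size w), input_tape w).
  by rewrite /store_of eqxx.
by have [_ ->] := etrans (Ht ord_max) (Es _).
Qed.

End Emit.

(** * Computable functions *)

Definition comput (f : word -> seq nat -> nat) : Prop :=
  exists t, forall x e, ev t x e = f x e.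

Definition bsum (n : nat) (f : nat -> nat) : nat := \sum_(j < n) f j.
Definition ball (n : nat) (p : pred nat) : bool := all p (iota 0 n).
Definition bex (n : nat) (p : pred nat) : bool := has p (iota 0 n).

Lemma ballP n (p : pred nat) : reflect (forall i, i < n -> p i) (ball n p).
Proof.
apply: (iffP allP) => H i; first by move=> lt; apply: H; rewrite mem_iota.
by rewrite mem_iota; apply: H.
Qed.

Lemma bexP n (p : pred nat) : reflect (exists2 i, i < n & p i) (bex n p).
Proof.
apply: (iffP hasP) => -[i]; first by rewrite mem_iota; exists i.
by move=> lt pi; exists i => //; rewrite mem_iota.
Qed.

Lemma bsumS n f : bsum n.+1 f = bsum n f + f n.
Proof. by rewrite /bsum big_ord_recr. Qed.

Lemma eq_bsum n f g : (forall i, i < n -> f i = g i) -> bsum n f = bsum n g.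
Proof. by move=> H; apply: eq_bigr => i _; apply: H. Qed.

Lemma bsum_pos n (p : pred nat) : (0 < bsum n p) = bex n p.
Proof.
elim: n => [|n IH]; first by rewrite /bsum big_ord0.
by rewrite bsumS addn_gt0 IH /bex -[n.+1]addn1 iotaD has_cat /= orbF lt0b.
Qed.

Lemma eq_comput f g : (forall x e, f x e = g x e) -> comput g -> comput f.
Proof. by move=> fg [t Ht]; exists t => x e; rewrite Ht fg. Qed.

Fixpoint rename (r : nat -> nat) (t : term) : term :=
  match t with
  | Var i => Var (r i)
  | Const c => Const c
  | Len => Len
  | Inp t => Inp (rename r t)
  | Add t1 t2 => Add (rename r t1) (rename r t2)
  | Sub t1 t2 => Sub (rename r t1) (rename r t2)
  | Sum n b => Sum (rename r n) (rename (fun i => if i is i'.+1 then (r i').+1 else 0) b)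
  end.

Lemma ev_rename r t x e e' :
  (forall i, nth 0 e' i = nth 0 e (r i)) -> ev (rename r t) x e = ev t x e'.
Proof.
elim: t r e e' => //= [t IH|t1 IH1 t2 IH2|t1 IH1 t2 IH2|n IHn b IHb] r e e' H.
- by rewrite (IH _ _ e').
- by rewrite (IH1 _ _ e') // (IH2 _ _ e').
- by rewrite (IH1 _ _ e') // (IH2 _ _ e').
rewrite (IHn _ _ e') //; apply: eq_bigr => j _.
by apply: IHb => -[].
Qed.

(** Below a range sum the environment has grown by the summation index; terms that come from outside
    have their variables shifted past it. *)
Lemma comput_env k f : comput f -> comput (fun x e => f x (iter k behead e)).
Proof.
case=> t Ht; exists (rename (addn k) t) => x e; rewrite -Ht; apply: ev_rename => i.
by rewrite -drop_behead nth_drop.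
Qed.

Lemma comput_var k i : comput (fun _ e => nth 0 (iter k behead e) i).
Proof.
by apply: (@comput_env k (fun _ e => nth 0 e i)); exists (Var i).
Qed.

Lemma comput_const c : comput (fun _ _ => c).
Proof. by exists (Const c). Qed.

Lemma comput_size : comput (fun x _ => size x).
Proof. by exists Len. Qed.

Section Closure.
Variables f g h : word -> seq nat -> nat.
Hypotheses (cf : comput f) (cg : comput g) (ch : comput h).
Variables p q : word -> seq nat -> bool.
Hypotheses (cp : comput (fun x e => nat_of_bool (p x e)))
           (cq : comput (fun x e => nat_of_bool (q x e))).

Lemma comput_input : comput (fun x e => input_at x (f x e)).
Proof. by case: cf => t Ht; exists (Inp t) => x e /=; rewrite Ht. Qed.

Lemma comput_add : comput (fun x e => f x e + g x e).
Proof. by case: cf => t Ht; case: cg => u Hu; exists (Add t u) => x e /=; rewrite Ht Hu. Qed.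

Lemma comput_sub : comput (fun x e => f x e - g x e).
Proof. by case: cf => t Ht; case: cg => u Hu; exists (Sub t u) => x e /=; rewrite Ht Hu. Qed.

Lemma comput_succ : comput (fun x e => (f x e).+1).
Proof.
by case: cf => t Ht; exists (Add t (Const 1)) => x e /=; rewrite Ht addn1.
Qed.

Lemma comput_pred : comput (fun x e => (f x e).-1).
Proof.
by case: cf => t Ht; exists (Sub t (Const 1)) => x e /=; rewrite Ht subn1.
Qed.

Lemma comput_mul : comput (fun x e => f x e * g x e).
Proof.
case: cf => t Ht; case: (comput_env 1 cg) => u Hu; exists (Sum t u) => x e /=.
by rewrite Ht; under eq_bigr do rewrite Hu /=; rewrite sum_nat_const card_ord.
Qed.

Lemma comput_le : comput (fun x e => nat_of_bool (f x e <= g x e)).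
Proof.
case: cf => t Ht; case: cg => u Hu; exists (Sub (Const 1) (Sub t u)) => x e /=.
by rewrite Ht Hu; case: leqP; lia.
Qed.

Lemma comput_and : comput (fun x e => nat_of_bool (p x e && q x e)).
Proof.
case: cp => t Ht; case: cq => u Hu.
exists (Sub (Add t u) (Const 1)) => x e /=.
by rewrite Ht Hu; case: (p x e); case: (q x e).
Qed.

Lemma comput_or : comput (fun x e => nat_of_bool (p x e || q x e)).
Proof.
case: cp => t Ht; case: cq => u Hu.
exists (Sub (Const 1) (Sub (Const 1) (Add t u))) => x e /=.
by rewrite Ht Hu; case: (p x e); case: (q x e).
Qed.

Lemma comput_neg : comput (fun x e => nat_of_bool (~~ p x e)).
Proof.
case: cp => t Ht; exists (Sub (Const 1) t) => x e /=.
by rewrite Ht; case: (p x e).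
Qed.

Lemma comput_imp : comput (fun x e => nat_of_bool (p x e ==> q x e)).
Proof.
case: cp => t Ht; case: cq => u Hu.
exists (Sub (Const 1) (Sub t u)) => x e /=.
by rewrite Ht Hu; case: (p x e); case: (q x e).
Qed.

Lemma comput_eqb : comput (fun x e => nat_of_bool (p x e == q x e)).
Proof.
case: cp => t Ht; case: cq => u Hu.
exists (Sub (Const 1) (Add (Sub t u) (Sub u t))) => x e /=.
by rewrite Ht Hu; case: (p x e); case: (q x e).
Qed.

Lemma comput_eq : comput (fun x e => nat_of_bool (f x e == g x e)).
Proof.
case: cf => t Ht; case: cg => u Hu.
exists (Sub (Const 1) (Add (Sub t u) (Sub u t))) => x e /=.
by rewrite Ht Hu; case: eqP; lia.
Qed.

Lemma comput_pos : comput (fun x e => nat_of_bool (0 < f x e)).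
Proof.
case: cf => t Ht; exists (Sub (Const 1) (Sub (Const 1) t)) => x e /=.
by rewrite Ht; case: (f x e).
Qed.

End Closure.

Lemma comput_if p f g : comput (fun x e => nat_of_bool (p x e)) -> comput f -> comput g ->
  comput (fun x e => if p x e then f x e else g x e).
Proof.
move=> cp cf cg.
apply: (@eq_comput _ (fun x e => p x e * f x e + ~~ p x e * g x e)).
  by move=> x e; case: (p x e); lia.
by apply: comput_add; apply: comput_mul => //; apply: comput_neg.
Qed.

Lemma comput_ifb p f g : comput (fun x e => nat_of_bool (p x e)) ->
  comput (fun x e => nat_of_bool (f x e)) -> comput (fun x e => nat_of_bool (g x e)) ->
  comput (fun x e => nat_of_bool (if p x e then f x e else g x e)).
Proof.
move=> cp cf cg.
apply: (@eq_comput _ (fun x e => if p x e then nat_of_bool (f x e) else nat_of_bool (g x e))).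
  by move=> x e; case: ifP.
exact: comput_if.
Qed.

Lemma comput_bsum n b : comput n ->
  comput (fun x e => b x (behead e) (nth 0 e 0)) ->
  comput (fun x e => bsum (n x e) (fun j => b x e j)).
Proof.
case=> t Ht [u Hu]; exists (Sum t u) => x e /=.
by rewrite Ht; apply: eq_bigr => j _; rewrite Hu.
Qed.

Lemma comput_bex n b : comput n ->
  comput (fun x e => nat_of_bool (b x (behead e) (nth 0 e 0))) ->
  comput (fun x e => nat_of_bool (bex (n x e) (fun j => b x e j))).
Proof.
move=> cn cb.
apply: (@eq_comput _ (fun x e => nat_of_bool (0 < bsum (n x e) (fun j => b x e j)))).
  by move=> x e; rewrite bsum_pos.
by apply: comput_pos; apply: comput_bsum.
Qed.

Lemma comput_ball n b : comput n ->
  comput (fun x e => nat_of_bool (b x (behead e) (nth 0 e 0))) ->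
  comput (fun x e => nat_of_bool (ball (n x e) (fun j => b x e j))).
Proof.
move=> cn cb.
apply: (@eq_comput _ (fun x e => nat_of_bool (~~ bex (n x e) (fun j => ~~ b x e j)))).
  by move=> x e; rewrite /ball /bex -all_predC; congr nat_of_bool; apply: eq_all => i /=; rewrite negbK.
by apply: comput_neg; apply: comput_bex => //; apply: comput_neg.
Qed.

Ltac comput_hyp H :=
  first [ exact: H | exact: (comput_env 1 H) | exact: (comput_env 2 H)
        | exact: (comput_env 3 H) | exact: (comput_env 4 H)
        | exact: (comput_env 5 H) | exact: (comput_env 6 H) ].

Ltac comput_var :=
  first [ exact: (comput_var 0) | exact: (comput_var 1) | exact: (comput_var 2)
        | exact: (comput_var 3) | exact: (comput_var 4) | exact: (comput_var 5)
        | exact: (comput_var 6) ].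

Ltac comp_extra := fail.

Ltac comp_step :=
  lazymatch goal with
  | |- comput (fun x e => nth 0 (@?A1 x e) (@?A2 x e)) => comput_var
  | |- comput (fun x e => size x) => exact: comput_size
  | |- comput (fun x e => input_at x (@?A1 x e)) => apply: comput_input
  | |- comput (fun x e => (@?A1 x e) + (@?A2 x e)) => apply: comput_add
  | |- comput (fun x e => (@?A1 x e) - (@?A2 x e)) => apply: comput_sub
  | |- comput (fun x e => (@?A1 x e) * (@?A2 x e)) => apply: comput_mul
  | |- comput (fun x e => (@?A1 x e).+1) => apply: comput_succ
  | |- comput (fun x e => (@?A1 x e).-1) => apply: comput_pred
  | |- comput (fun x e => bsum (@?A1 x e) (@?A2 x e)) => apply: comput_bsum
  | |- comput (fun x e => nat_of_bool ((@?A1 x e) <= (@?A2 x e))) => apply: comput_le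
  | |- comput (fun x e => nat_of_bool ((@?A1 x e) && (@?A2 x e))) => apply: comput_and
  | |- comput (fun x e => nat_of_bool ((@?A1 x e) || (@?A2 x e))) => apply: comput_or
  | |- comput (fun x e => nat_of_bool ((@?A1 x e) ==> (@?A2 x e))) => apply: comput_imp
  | |- comput (fun x e => nat_of_bool (~~ (@?A1 x e))) => apply: comput_neg
  | |- comput (fun x e => nat_of_bool (@eq_op _ (@?A1 x e) (@?A2 x e))) =>
      first [apply: comput_eq | apply: comput_eqb]
  | |- comput (fun x e => nat_of_bool (bex (@?A1 x e) (@?A2 x e))) => apply: comput_bex
  | |- comput (fun x e => nat_of_bool (ball (@?A1 x e) (@?A2 x e))) => apply: comput_ball
  | _ => first [exact: comput_const | apply: comput_ifb | apply: comput_if]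
  end.

Ltac comp :=
  repeat first
    [ progress cbv beta
    | comp_extra
    | match goal with H : comput _ |- _ => comput_hyp H end
    | comp_step ].

(** The numbers [q] that are counted are those below the quotient. For [b = 0] all of them would
    count, hence the factor. *)
Lemma divn_bsum a b : a %/ b = (0 < b) * bsum a (fun q => q.+1 * b <= a).
Proof.
case: b => [|b]; first by rewrite divn0.
rewrite mul1n.
have -> : bsum a (fun q => q.+1 * b.+1 <= a) = bsum a (fun q => q < a %/ b.+1).
  by apply: eq_bsum => q _; rewrite leq_divRL.
have : a %/ b.+1 <= a by apply: leq_div.
move: (a %/ b.+1) => c; elim: a => [|a IH] le; first by rewrite /bsum big_ord0; lia.
rewrite bsumS; case: (ltngtP c a.+1) le => // [lt|->] _.
  by rewrite -IH //; lia.
have -> : bsum a (fun q => q < a.+1) = a.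
  rewrite /bsum (eq_bigr (fun=> 1)); last by move=> i _; rewrite ltnS ltnW.
  by rewrite sum_nat_const card_ord muln1.
lia.
Qed.

Lemma comput_div f g : comput f -> comput g -> comput (fun x e => f x e %/ g x e).
Proof.
move=> cf cg.
apply: (@eq_comput _ (fun x e => (0 < g x e) * bsum (f x e) (fun q => q.+1 * g x e <= f x e))).
  by move=> x e; rewrite divn_bsum.
comp.
Qed.

Lemma comput_mod f g : comput f -> comput g -> comput (fun x e => f x e %% g x e).
Proof.
move=> cf cg; apply: (@eq_comput _ (fun x e => f x e - f x e %/ g x e * g x e)).
  by move=> x e; rewrite {2}(divn_eq (f x e) (g x e)); lia.
have cd := comput_div cf cg; comp.
Qed.

Lemma comput_odd f : comput f -> comput (fun x e => nat_of_bool (odd (f x e))).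
Proof.
move=> cf; apply: (@eq_comput _ (fun x e => f x e %% 2)).
  by move=> x e; rewrite modn2.
exact: comput_mod cf (comput_const 2).
Qed.

Lemma comput_half f : comput f -> comput (fun x e => (f x e)./2).
Proof.
move=> cf; apply: (@eq_comput _ (fun x e => f x e %/ 2)).
  by move=> x e; rewrite divn2.
exact: comput_div cf (comput_const 2).
Qed.

Lemma comput_double f : comput f -> comput (fun x e => (f x e).*2).
Proof.
move=> cf; apply: (@eq_comput _ (fun x e => f x e + f x e)).
  by move=> x e; rewrite addnn.
exact: comput_add.
Qed.

Lemma comput_dvdn f g : comput f -> comput g ->
  comput (fun x e => nat_of_bool (f x e %| g x e)).
Proof. by move=> cf cg; apply: comput_eq (comput_mod cg cf) (comput_const 0). Qed.

Lemma comput_exp f d : comput f -> comput (fun x e => f x e ^ d).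
Proof.
move=> cf; elim: d => [|d IH]; first by exists (Const 1).
apply: (@eq_comput _ (fun x e => f x e * f x e ^ d)); first by move=> x e; rewrite expnS.
exact: comput_mul.
Qed.

(** * Powers of two and binary numerals *)

Definition is_pow2 (p : nat) : bool :=
  (0 < p) && ball p.+1 (fun d => (d %| p) ==> (d == 1) || ~~ odd d).

(** A prime divisor other than 2 would be an odd divisor other than 1. The test needs divisibility
    alone and so stays within bounded sums. *)
Lemma is_pow2P p : reflect (exists i, p = 2 ^ i) (is_pow2 p).
Proof.
apply: (iffP andP) => [[p0 /ballP H]|[i ->]].
  suff /p_natP[i ->] : 2.-nat p by exists i.
  apply/pnatP => // q qp qd; have := H q; rewrite ltnS dvdn_leq // qd => /(_ isT) /=.
  case/orP=> [/eqP Eq|oq]; first by rewrite Eq in qp.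
  by apply/eqP; apply/(prime_oddPn qp).
split; first by rewrite expn_gt0.
apply/ballP => d _; apply/implyP => /(dvdn_pfactor _ _ (isT : prime 2))[[|j] _ ->] //.
by rewrite oddX orbT.
Qed.

Definition log_count (m : nat) : nat := bsum m is_pow2.

(** The powers of 2 below $2^j$ are $2^0, \dots, 2^{j-1}$, and the count is monotone; for positive
    [m] it is the binary logarithm rounded up. *)
Lemma leq_log_count m i : (log_count m <= i) = (m <= 2 ^ i).
Proof.
have mono : {homo log_count : a b / a <= b}.
  apply: homo_leq => // [y x z|a]; first exact: leq_trans.
  by rewrite /log_count bsumS leq_addr.
have pw j : log_count (2 ^ j) = j.
  elim: j => [|j IH]; first by rewrite /log_count bsumS /bsum big_ord0.
  have H k : 0 < k -> k <= 2 ^ j -> log_count (2 ^ j + k) = j.+1.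
    elim: k => // k IHk _ le; rewrite addnS /log_count bsumS -/(log_count _).
    case: k IHk le => [|k] IHk le.
      rewrite addn0 IH; case: is_pow2P => [_|[]]; last by exists j.
      by rewrite addn1.
    rewrite IHk ?(ltnW le) //; case: is_pow2P => [[i' E]|_]; last by rewrite addn0.
    have lt1 : 2 ^ j < 2 ^ i' by rewrite -E addnS ltnS leq_addr.
    have lt2 : 2 ^ i' < 2 ^ j.+1 by rewrite -E expnS; lia.
    by rewrite !ltn_exp2l // in lt1 lt2; lia.
  by rewrite expnS mul2n -addnn H // expn_gt0.
apply/idP/idP => le; last by rewrite -(pw i) mono.
rewrite leqNgt; apply/negP => lt; have := mono _ _ lt.
rewrite /log_count bsumS -/(log_count _) pw; case: is_pow2P => [_|[]]; last by exists i.
rewrite -/(log_count _); lia.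
Qed.

(* [2 ^ i] truncated at [k], which keeps the value polynomial *)
Definition cap2 (k i : nat) : nat := bsum k (fun q => log_count q.+1 <= i).

Lemma cap2E k i : cap2 k i = minn k (2 ^ i).
Proof.
rewrite /cap2; under eq_bsum do rewrite leq_log_count.
elim: k => [|k IH]; first by rewrite /bsum big_ord0 min0n.
by rewrite bsumS IH; case: (ltnP k (2 ^ i)) => h; lia.
Qed.

Lemma comput_log_count f : comput f -> comput (fun x e => log_count (f x e)).
Proof.
move=> cf; rewrite /log_count /is_pow2.
have c1 := comput_dvdn (comput_var 0 0) (comput_var 1 0).
have c2 := comput_odd (comput_var 0 0).
comp.
Qed.

Lemma comput_cap2 f g : comput f -> comput g -> comput (fun x e => cap2 (f x e) (g x e)).
Proof.
move=> cf cg; rewrite /cap2; apply: comput_bsum => //.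
apply: comput_le; last by comp.
by apply: comput_log_count; comp.
Qed.

Ltac comp_extra ::=
  lazymatch goal with
  | |- comput (fun x e => (@?A1 x e) %/ (@?A2 x e)) => apply: comput_div
  | |- comput (fun x e => (@?A1 x e) %% (@?A2 x e)) => apply: comput_mod
  | |- comput (fun x e => nat_of_bool (odd (@?A1 x e))) => apply: comput_odd
  | |- comput (fun x e => (@?A1 x e)./2) => apply: comput_half
  | |- comput (fun x e => nat_of_bool ((@?A1 x e) %| (@?A2 x e))) => apply: comput_dvdn
  | |- comput (fun x e => (@?A1 x e) ^ ?d) => apply: comput_exp
  | |- comput (fun x e => cap2 (@?A1 x e) (@?A2 x e)) => apply: comput_cap2
  | |- comput (fun x e => log_count (@?A1 x e)) => apply: comput_log_count
  | |- comput (fun x e => (@?A1 x e).*2) => apply: comput_double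
  end.

Fixpoint val_bits (z : word) : nat :=
  if z is b :: z' then b + (val_bits z').*2 else 0.

Lemma val_bits_of_nat k : val_bits (bits_of_nat k) = k.
Proof.
rewrite -[RHS]bin_of_natK /bits_of_nat; case: bin_of_nat => //= p.
elim: p => //= p ->; rewrite ?natTrecE //.
Qed.

Definition canonical_bits (z : word) : bool := (z == [::]) || last false z.

Lemma canonical_bits_of_nat k : canonical_bits (bits_of_nat k).
Proof.
rewrite /canonical_bits /bits_of_nat; case: bin_of_nat => //= p.
have ne q : bits_of_pos q != [::] by case: q.
apply/orP; right; elim: p => //= p IH; by case: (bits_of_pos p) (ne p) IH.
Qed.

Lemma val_bits_inj z z' : canonical_bits z -> canonical_bits z' ->
  val_bits z = val_bits z' -> z = z'.
Proof.
have pos y : canonical_bits y -> y != [::] -> 0 < val_bits y.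
  elim: y => //= b y IH; rewrite /canonical_bits /=.
  case: y IH => [|c y] IH /= cy _; first by rewrite cy.
  have : 0 < val_bits (c :: y) by apply: IH => //; rewrite /canonical_bits /= cy.
  by rewrite /=; lia.
have tl b y : canonical_bits (b :: y) -> canonical_bits y.
  by rewrite /canonical_bits; case: y => //= c y ->; rewrite orbT.
elim: z z' => [|b z IH] [|b' z'] cz cz' //=.
- by have := pos _ cz' isT => /= *; lia.
- by have := pos _ cz isT => /= *; lia.
move=> E; have Eb : b = b'.
  have: odd (b + (val_bits z).*2) = odd (b' + (val_bits z').*2) by rewrite E.
  by rewrite !oddD !odd_double !addbF !oddb.
by rewrite Eb; congr (_ :: _); apply: IH (tl _ _ cz) (tl _ _ cz') _; move: E; rewrite Eb; lia.
Qed.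

Lemma bits_of_val z : canonical_bits z -> bits_of_nat (val_bits z) = z.
Proof.
move=> cz; apply: val_bits_inj => //; first exact: canonical_bits_of_nat.
exact: val_bits_of_nat.
Qed.

Lemma val_bits_mkseq K n : K < 2 ^ n ->
  val_bits (mkseq (fun j => odd (K %/ 2 ^ j)) n) = K.
Proof.
elim: n K => [|n IH] K lt; first by case: K lt.
rewrite /mkseq /= -[1%N]addn0 iotaDl -map_comp /= divn1.
have -> : [seq ((fun j => odd (K %/ 2 ^ j)) \o addn 1) i | i <- iota 0 n]
   = mkseq (fun j => odd (K./2 %/ 2 ^ j)) n.
  by apply: eq_map => j /=; rewrite add1n expnS divnMA divn2.
rewrite IH; first by rewrite odd_double_half.
by move: lt; rewrite expnS; lia.
Qed.

(** Turns the recursive encoding into a formula for each bit. The truncation at [K.+1] is harmless,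
    as every power that occurs is at most [K]. *)
Lemma bits_of_natE K :
  bits_of_nat K = mkseq (fun j => odd (K %/ cap2 K.+1 j)) (log_count K.+1).
Proof.
have Kc : K < 2 ^ log_count K.+1 by rewrite -leq_log_count.
have -> : mkseq (fun j => odd (K %/ cap2 K.+1 j)) (log_count K.+1)
    = mkseq (fun j => odd (K %/ 2 ^ j)) (log_count K.+1).
  apply/eq_in_map => j; rewrite mem_iota => /andP[_ lt].
  by move: lt; rewrite add0n ltnNge leq_log_count -ltnNge cap2E => lt; rewrite (minn_idPr _) // ltnW.
rewrite -{1}(val_bits_mkseq Kc) bits_of_val // /canonical_bits.
case E: (log_count K.+1) Kc => [|n] Kc //.
rewrite /mkseq -[n.+1]addn1 iotaD map_cat cats1 last_rcons add0n; apply/orP; right.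
have le : 2 ^ n <= K by rewrite -ltnS ltnNge -leq_log_count E ltnn.
suff -> : K %/ 2 ^ n = 1 by [].
by apply/eqP; rewrite eqn_leq -ltnS ltn_divLR ?leq_divRL ?expn_gt0 // -expnS Kc mul1n.
Qed.

Lemma polytime_mkseq (f : word -> word) L B :
  comput (fun x _ => L x) -> comput (fun x e => nat_of_bool (B x (nth 0 e 0))) ->
  (forall x, f x = mkseq (B x) (L x)) -> polytime f.
Proof.
move=> [l Hl] [b Hb] Hf; have [M [a [d HM]]] := polytime_emit l b.
exists M, a, d => x; have [h out] := HM x; split => //.
suff -> : f x = emit_word l b x by [].
by rewrite Hf /emit_word Hl; apply: eq_mkseq => i; rewrite Hb /=; case: (B x i).
Qed.

(** * Editing into labelled graphs *)

(* Cluster graphs described by labels: vertices with the same label [c] form a clique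
   when [c] is odd, and a complete multipartite graph with parts [p] when [c] is even. *)
Definition labelled (T : eqType) (c p : T -> nat) : rel T :=
  fun x y => [&& x != y, c x == c y & odd (c x) || (p x != p y)].

Section Labels.
Variables (T : finType) (l : nat).
Implicit Types (c p : T -> nat) (h : rel T).

Lemma labelled_connect c p x y : connect (labelled c p) x y -> c x = c y.
Proof.
case/connectP => s; elim: s x => [|z s IH] x /=; first by move=> _ ->.
by case/andP=> /and3P[_ /eqP -> _] pz /(IH _ pz).
Qed.

Lemma labelled_sym c p : symmetric (labelled c p).
Proof.
move=> x y; rewrite /labelled eq_sym [c y == _]eq_sym [p y == _]eq_sym.
by case: eqP => //= _; case: eqP => //= ->.
Qed.

(** A label need not be one component: if an even label is confined to a single part, its vertices
    are isolated and form one-vertex cliques. *)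
Lemma labelled_cluster c p : 0 < l -> (forall x, p x < l) ->
  cluster_graph l (labelled c p).
Proof.
move=> l0 pl x; set h := labelled c p.
have cc y : y \in component h x -> c y = c x.
  by rewrite inE => /labelled_connect ->.
case ox: (odd (c x)).
  left=> -[y Hy] [z Hz]; rewrite /induced /= /h /labelled -val_eqE /=.
  by rewrite (cc _ Hy) (cc _ Hz) eqxx ox andbT.
case: (pickP (h x)) => [w hxw|no]; last first.
  left=> -[y Hy] [z Hz]; rewrite /induced /=.
  have x1 u : u \in component h x -> u = x.
    rewrite inE => /connectP[[|a s] /=]; first by move=> _ ->.
    by rewrite no.
  rewrite -val_eqE /= /h /labelled.
  by rewrite (x1 _ Hy) (x1 _ Hz) eqxx.
have adj y z : y \in component h x -> z \in component h x -> h y z = (p y != p z).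
  move=> Hy Hz; rewrite /h /labelled (cc _ Hy) (cc _ Hz) eqxx ox /=.
  by case: (y =P z) => [->|]; rewrite ?eqxx.
have xC : x \in component h x by rewrite inE.
have wC : w \in component h x by rewrite inE connect1.
have pxw : p x != p w by rewrite -adj.
right; split; last first.
  exists (fun y => Ordinal (pl (val y))) => -[y Hy] [z Hz].
  by rewrite /induced /= adj.
move=> [y Hy] [z Hz].
have edge a b (Ha : a \in component h x) (Hb : b \in component h x) : p a != p b ->
    connect (induced h (C := component h x)) (exist _ a Ha) (exist _ b Hb).
  by move=> ab; apply: connect1; rewrite /induced /= adj.
(* Two vertices of the same part are connected through [x] or through [w], which lie in different
   parts. *)
case: (eqVneq (p y) (p z)) => [E|]; last exact: edge.
case: (eqVneq (p y) (p x)) => [Ex|nx].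
  by apply: connect_trans (edge _ _ Hy wC _) (edge _ _ wC Hz _); rewrite -?E ?Ex // eq_sym.
by apply: connect_trans (edge _ _ Hy xC _) (edge _ _ xC Hz _); rewrite -?E // eq_sym.
Qed.

(** The label is twice the rank of the root of the component, plus one bit for the type. As labels
    stay below twice the number of vertices, a certificate can list them in unary. *)
Lemma cluster_labelled h : 0 < l -> symmetric h -> irreflexive h -> cluster_graph l h ->
  exists c p : T -> nat, [/\ forall x, p x < l, forall x, c x < (#|T|).*2 &
    forall x y, h x y = labelled c p x y].
Proof.
move=> l0 sh ih cl.
have comp x : exists q : bool * (T -> 'I_l),
    forall y z, connect h x y -> connect h x z ->
      h y z = (y != z) && (q.1 || (q.2 y != q.2 z)).
  case: (cl x) => [clq|[_ [part Hp]]].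
    exists (true, fun=> Ordinal l0) => y z hy hz /=; rewrite andbT.
    have Cy : y \in component h x by rewrite inE.
    have Cz : z \in component h x by rewrite inE.
    exact: (clq (exist _ y Cy) (exist _ z Cz)).
  exists (false, fun y => if insub y is Some u then part u else Ordinal l0).
  move=> y z hy hz /=.
  have Cy : y \in component h x by rewrite inE.
  have Cz : z \in component h x by rewrite inE.
  have hyz : y = z -> h y z = false by move=> ->.
  rewrite !insubT; case: (y =P z) => [/hyz -> //|_].
  exact: (Hp (exist _ y Cy) (exist _ z Cz)).
have [q Hq] := fin_all_exists comp.
have symc : connect_sym h by apply: sym_connect_sym.
pose r x := fingraph.root h x.
have rc x : connect h (r x) x by rewrite symc connect_root.
exists (fun x => (q (r x)).1 + (enum_rank (r x)).*2), (fun x => (q (r x)).2 x).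
split=> [x|x|x y]; first exact: ltn_ord.
  have lt : enum_rank (r x) < #|T| := ltn_ord _.
  by move: #|T| (nat_of_ord _) lt => n a; case: (q (r x)).1; lia.
have parity (b b' : bool) m n : (b + m.*2 == b' + n.*2) = (b == b') && (m == n).
  by case: b; case: b' => /=; lia.
rewrite /labelled parity oddD odd_double addbF oddb.
case E: (r x == r y); last first.
  have -> : (nat_of_ord (enum_rank (r x)) == enum_rank (r y)) = false.
    by rewrite val_eqE (inj_eq enum_rank_inj).
  rewrite andbF /= andbF; apply/negP => hxy.
  by move/eqP: E; case; apply/eqP; rewrite (root_connect symc) connect1.
move/eqP: E => E; rewrite -E !eqxx /=.
by rewrite (Hq (r x)) // E.
Qed.

End Labels.

(** * Editions as disagreements between relations *)

Section Editing.
Variable T : finType.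
Implicit Types e h : rel T.

(** Ordered pairs: every edition is counted twice, and budgets are compared after doubling. *)
Definition disagree e h : {set T * T} := [set z | e z.1 z.2 != h z.1 z.2].
Definition disagree_lt e h : {set T * T} :=
  [set z in disagree e h | enum_rank z.1 < enum_rank z.2].

Lemma card_disagree e h : simple_graph e -> simple_graph h ->
  #|disagree e h| = (#|disagree_lt e h|).*2.
Proof.
move=> [se ie] [sh ih].
pose sw (z : T * T) := (z.2, z.1).
have swK : involutive sw by case.
have -> : disagree e h = disagree_lt e h :|: sw @: disagree_lt e h.
  apply/setP => -[x y]; rewrite !inE /=.
  have -> : ((x, y) \in sw @: disagree_lt e h) = ((y, x) \in disagree_lt e h).
    by rewrite -{1}[(x, y)]/(sw (y, x)) mem_imset //; apply: inv_inj.
  rewrite !inE /= [e y x]se [h y x]sh.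
  case: (ltngtP (enum_rank x) (enum_rank y)); rewrite ?andbT ?andbF ?orbF //.
  by move/ord_inj/enum_rank_inj => ->; rewrite ie ih.
rewrite cardsU card_imset; last exact: inv_inj.
rewrite (_ : _ :&: _ = set0) ?cards0 ?subn0 ?addnn //.
apply/setP => -[x y]; rewrite !inE.
have -> : ((x, y) \in sw @: disagree_lt e h) = ((y, x) \in disagree_lt e h).
  by rewrite -{1}[(x, y)]/(sw (y, x)) mem_imset //; apply: inv_inj.
by rewrite !inE /=; case: ltngtP; rewrite ?andbF.
Qed.

Definition edition_of e (z : T * T) : {set T} * bool := ([set z.1; z.2], ~~ e z.1 z.2).

Lemma set2_eq (x y u v : T) : [set x; y] = [set u; v] -> x != y ->
  (x = u /\ y = v) \/ (x = v /\ y = u).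
Proof.
move=> E xy; have : x \in [set u; v] by rewrite -E set21.
have : y \in [set u; v] by rewrite -E set22.
rewrite !inE => /orP[]/eqP Ey /orP[]/eqP Ex; rewrite Ex Ey ?eqxx // in xy *; auto.
Qed.

Lemma edition_of_inj e h : {in disagree_lt e h &, injective (fun z => [set z.1; z.2])}.
Proof.
move=> [x y] [u v]; rewrite !inE /= => /andP[_ lt1] /andP[_ lt2] E.
have xy : x != y by apply: contraTneq lt1 => ->; rewrite ltnn.
by case: (set2_eq E xy) => -[E1 E2]; subst => //; have := ltn_trans lt1 lt2; rewrite ltnn.
Qed.

Lemma editions_exist e h : simple_graph e -> simple_graph h ->
  exists F, [/\ edition_set e F, (#|F|).*2 = #|disagree e h| & edit e F = h].
Proof.
move=> ge gh; have [[se ie] [sh ih]] := (ge, gh).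
exists (edition_of e @: disagree_lt e h).
have injd : {in disagree_lt e h &, injective (edition_of e)}.
  by move=> z z' Hz Hz' /(congr1 fst) E; apply: (edition_of_inj Hz Hz' E).
have memF x y m : x != y ->
    (([set x; y], m) \in edition_of e @: disagree_lt e h) = (e x y != h x y) && (m == ~~ e x y).
  move=> xy; apply/imsetP/andP => [[[u v]]|[d /eqP ->]].
    rewrite !inE /= => /andP[d _] [E ->].
    by case: (set2_eq E xy) => -[-> ->]; rewrite ?[e v u]se ?[h v u]sh; split.
  case: (ltngtP (enum_rank x) (enum_rank y)) => lt.
  - by exists (x, y); rewrite // !inE d lt.
  - exists (y, x); first by rewrite !inE /= [e y x]se [h y x]sh d lt.
    by rewrite /edition_of /= [e y x]se setUC.
  by move/ord_inj/enum_rank_inj: lt xy => ->; rewrite eqxx.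
split.
- split=> [p m|[p m] [p' m']].
    case/imsetP => -[x y]; rewrite !inE /= => /andP[_ lt] [-> ->].
    exists x, y; split => //; last by rewrite negbK.
    by apply: contraTneq lt => ->; rewrite ltnn.
  case/imsetP => z Hz Ez /imsetP[z' Hz' Ez']; rewrite Ez Ez' /= => E.
  by rewrite (edition_of_inj Hz Hz' E).
- by rewrite card_in_imset // card_disagree.
apply: functional_extensionality => x; apply: functional_extensionality => y.
rewrite /edit; case: (eqVneq x y) => [->|xy].
  rewrite ie ih /=; apply/negP => /imsetP[[u v]].
  rewrite !inE /= => /andP[_ lt] [E _].
  have uv : u != v by apply: contraTneq lt => ->; rewrite ltnn.
  by case: (set2_eq (esym E) uv) => -[E1 E2]; rewrite E1 E2 eqxx in uv.
by rewrite !memF //; case: (e x y); case: (h x y).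
Qed.

Lemma edit_simple e F : simple_graph e -> edition_set e F -> simple_graph (edit e F).
Proof.
move=> [se ie] [HF _]; split=> [x y|x]; rewrite /edit; first by rewrite se setUC.
rewrite ie /=; apply/negP => /HF[u [v [uv E _]]].
by case: (set2_eq (esym E) uv) => -[E1 E2]; rewrite E1 E2 eqxx in uv.
Qed.

Lemma card_disagree_edit e F : simple_graph e -> edition_set e F ->
  #|disagree e (edit e F)| <= (#|F|).*2.
Proof.
move=> ge HF; rewrite (card_disagree ge (edit_simple ge HF)) leq_double.
have injd : {in disagree_lt e (edit e F) &, injective (edition_of e)}.
  by move=> z z' Hz Hz' /(congr1 fst) E; apply: (edition_of_inj Hz Hz' E).
rewrite -(card_in_imset injd); apply: subset_leq_card.
apply/subsetP => _ /imsetP[[x y] Hz ->]; move: Hz; rewrite !inE /edit /edition_of /=.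
case/andP; case: (e x y) => //=.
  by case: (_ \notin F) / boolP => //=; rewrite negbK.
by case: (_ \in F) / boolP.
Qed.

Lemma sum_disagree e h : \sum_x \sum_y (e x y != h x y) = #|disagree e h|.
Proof.
rewrite pair_bigA /disagree -sum1dep_card [RHS]big_mkcond /=.
by apply: eq_bigr => z _; case: ifP.
Qed.

(** With [labels_editable] as its converse, this removes edition sets from the rest: the verifier
    guesses [c] and [p], and the reduction is analysed by counting disagreements. *)
Lemma editable_labels l e k : 0 < l -> simple_graph e -> cluster_editable l e k ->
  exists c p : T -> nat,
    [/\ forall x, p x < l, forall x, c x < (#|T|).*2 &
        \sum_x \sum_y (e x y != labelled c p x y) <= k.*2].
Proof.
move=> l0 ge [F [HF leF cl]]; have [sh ih] := edit_simple ge HF.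
have [c [p [Hp Hc Ec]]] := cluster_labelled l0 sh ih cl.
exists c, p; split => //.
have -> : labelled c p = edit e F.
  by do 2 apply: functional_extensionality => ?; rewrite Ec.
by rewrite sum_disagree; apply: leq_trans (card_disagree_edit ge HF) _; rewrite leq_double.
Qed.

Lemma labels_editable l e k (c p : T -> nat) : 0 < l -> simple_graph e ->
  (forall x, p x < l) -> \sum_x \sum_y (e x y != labelled c p x y) <= k.*2 ->
  cluster_editable l e k.
Proof.
move=> l0 ge Hp le; have gh : simple_graph (labelled c p).
  by split=> [x y|x]; [apply: labelled_sym | rewrite /labelled eqxx].
have [F [HF cF Eh]] := editions_exist ge gh.
exists F; split => //; last by rewrite Eh; apply: labelled_cluster.
by rewrite -leq_double cF -sum_disagree.
Qed.

End Editing.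

(** * Anchored graphs *)

(** Cauchy-Schwarz, obtained from $2ab \le a^2 + b^2$ summed over all pairs. *)
Lemma sqr_sum_le (J : finType) (f : J -> nat) :
  (\sum_j f j) ^ 2 <= #|J| * \sum_j f j ^ 2.
Proof.
have H : 2 * (\sum_i \sum_j f i * f j) <= \sum_(i : J) \sum_(j : J) (f i ^ 2 + f j ^ 2).
  rewrite big_distrr /=; apply: leq_sum => i _; rewrite big_distrr /=.
  by apply: leq_sum => j _; rewrite nat_Cauchy.
have E1 : \sum_(i : J) \sum_(j : J) (f i ^ 2 + f j ^ 2) = 2 * (#|J| * \sum_j f j ^ 2).
  under eq_bigr do rewrite big_split /= sum_nat_const.
  by rewrite big_split /= -big_distrr sum_nat_const /= mul2n addnn.
have E2 : \sum_i \sum_j f i * f j = (\sum_j f j) ^ 2.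
  by rewrite -mulnn big_distrl /=; apply: eq_bigr => i _; rewrite big_distrr.
lia.
Qed.

(** Cauchy-Schwarz for the class sizes of [f]. It serves twice: for the parts within an anchor, and
    for the distribution of the choosers over the anchors. *)
Lemma card_sqr_le (V J : finType) (f : V -> J) (P : pred V) :
  #|P| ^ 2 <= #|J| * \sum_(v | P v) \sum_(w | P w) (f v == f w).
Proof.
pose n j := \sum_(v | P v) (f v == j).
have -> : #|P| = \sum_j n j.
  rewrite exchange_big /= -sum1_card; apply: eq_bigr => v _.
  by rewrite (bigD1 (f v)) //= eqxx big1 // => j /negPf; rewrite eq_sym => ->.
have -> : \sum_(v | P v) \sum_(w | P w) (f v == f w) = \sum_j n j ^ 2.
  have -> : \sum_j n j ^ 2 = \sum_j \sum_(v | P v) \sum_(w | P w) (f v == j) * (f w == j).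
    apply: eq_bigr => j _; rewrite -mulnn big_distrl /=.
    by apply: eq_bigr => v _; rewrite big_distrr.
  rewrite [RHS]exchange_big /=; apply: eq_bigr => v _.
  rewrite exchange_big /=; apply: eq_bigr => w _.
  rewrite (bigD1 (f v)) //= eqxx mul1n big1 ?addn0 1?eq_sym // => j /negPf.
  by rewrite eq_sym => ->.
exact: sqr_sum_le.
Qed.

Section Anchors.
Variables (I Anc V : finType) (S : V -> pred Anc) (eC : rel V).
Let X : finType := ((I * Anc) + V)%type.

Definition anchored : rel X := fun x y =>
  match x, y with
  | inl (i, a), inl (j, b) => (a == b) && (i != j)
  | inl (_, a), inr v | inr v, inl (_, a) => S v a
  | inr v, inr w => eC v w
  end.

Hypotheses (symC : symmetric eC) (irrC : irreflexive eC).
Hypothesis S_nonempty : forall v, exists a, S v a.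
Variables (M k2 R : nat).

Definition excess : nat := \sum_v (\sum_a S v a).-1.
Definition uncut (al : V -> Anc) : nat := \sum_v \sum_w (eC v w && (al v == al w)).

Hypothesis cardV : #|V| = M * #|Anc|.
(** [k2] is twice the budget for pairs of choosers: the value that [sum_chooser_pairs] yields when
    each anchor receives [M] choosers and [R] ordered adjacent pairs stay uncut, written without
    subtraction. *)
Hypothesis k2E : k2 + 2 * R + #|V| = #|Anc| * M ^ 2 + \sum_v \sum_w eC v w.

Lemma anchored_simple : simple_graph anchored.
Proof.
split=> [[[i a]|v] [[j b]|w]|[[i a]|v]] //=; rewrite ?eqxx ?andbF //.
by rewrite eq_sym [j == i]eq_sym.
Qed.

Lemma sum_anchored (F : X -> X -> nat) : (forall x y, F x y = F y x) ->
  \sum_x \sum_y F x y =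
    \sum_i \sum_a \sum_j \sum_b F (inl (i, a)) (inl (j, b))
    + 2 * (\sum_v \sum_i \sum_a F (inr v) (inl (i, a)))
    + \sum_v \sum_w F (inr v) (inr w).
Proof.
move=> symF; rewrite big_sumType /=.
have E1 : \sum_(x : I * Anc) \sum_y F (inl x) y
   = \sum_i \sum_a (\sum_j \sum_b F (inl (i, a)) (inl (j, b)) + \sum_v F (inl (i, a)) (inr v)).
  rewrite [RHS]pair_bigA /=; apply: eq_bigr => -[i a] _.
  by rewrite big_sumType /=; congr (_ + _); rewrite pair_bigA; apply: eq_bigr => -[].
have E2 : \sum_(v : V) \sum_y F (inr v) y
   = \sum_v (\sum_i \sum_a F (inr v) (inl (i, a)) + \sum_w F (inr v) (inr w)).
  apply: eq_bigr => v _.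
  by rewrite big_sumType /=; congr (_ + _); rewrite pair_bigA; apply: eq_bigr => -[].
rewrite E1 E2; under eq_bigr do rewrite big_split /=.
rewrite !big_split /=.
have -> : \sum_i \sum_a \sum_v F (inl (i, a)) (inr v)
        = \sum_v \sum_i \sum_a F (inr v) (inl (i, a)).
  under eq_bigr do rewrite exchange_big /=.
  rewrite exchange_big /=; apply: eq_bigr => v _.
  by apply: eq_bigr => i _; apply: eq_bigr => a _.
by rewrite mul2n -addnn !addnA.
Qed.

(** With $e$ for adjacency and $s$ for a common cluster, a pair contributes $e + s - 2es$
    disagreements; the diagonal accounts for [#|V|]. *)
Lemma sum_chooser_pairs (al : V -> Anc) :
  \sum_v \sum_w (eC v w != (v != w) && (al v == al w)) + 2 * uncut al + #|V|
  = \sum_v \sum_w (al v == al w) + \sum_v \sum_w eC v w.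
Proof.
have -> : #|V| = \sum_(v : V) \sum_(w : V) (v == w).
  rewrite -sum1_card; apply: eq_bigr => v _.
  by rewrite (bigD1 v) //= eqxx big1 // => w /negPf; rewrite eq_sym => ->.
rewrite /uncut big_distrr /= -!big_split /=; apply: eq_bigr => v _.
rewrite big_distrr /= -!big_split /=; apply: eq_bigr => w _.
case: (v =P w) => [->|_]; first by rewrite irrC !eqxx.
by case: (eC v w); case: (al v == al w).
Qed.

(** Each anchor with its choosers becomes a clique, whence the odd labels. Cutting the choosers from
    their other anchors costs [#|I| * excess]. *)
Lemma anchored_yes (al : V -> Anc) : (forall v, S v (al v)) ->
  (forall a, #|[pred v | al v == a]| = M) -> R <= uncut al ->
  exists c : X -> nat,
    \sum_x \sum_y (anchored x y != labelled c (fun=> 0) x y) <= 2 * (#|I| * excess) + k2.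
Proof.
move=> Sal bal leR.
pose c (x : X) : nat := match x with inl (_, a) => (enum_rank a).*2.+1
                              | inr v => (enum_rank (al v)).*2.+1 end.
exists c; have [sa ia] := anchored_simple.
rewrite sum_anchored; last by move=> x y; rewrite sa labelled_sym.
have ceq a b : ((enum_rank a).*2.+1 == (enum_rank b).*2.+1 :> nat) = (a == b :> Anc).
  by rewrite eqSS (inj_eq double_inj) val_eqE (inj_eq enum_rank_inj).
rewrite big1 ?add0n; last first.
  move=> i _; rewrite big1 // => a _; rewrite big1 // => j _; rewrite big1 // => b _.
  rewrite /labelled /= ceq odd_double andbT.
  rewrite (inj_eq (@inl_inj _ _)) xpair_eqE.
  by case: (a =P b) => [_|]; rewrite ?andbT ?andbF /= ?eqxx.
have -> : \sum_v \sum_i \sum_a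
          (anchored (inr v) (inl (i, a)) != labelled c (fun=> 0) (inr v) (inl (i, a)))
        = #|I| * excess.
  rewrite exchange_big /=.
  transitivity (\sum_(i : I) excess); last by rewrite sum_nat_const.
  apply: eq_bigr => i _; apply: eq_bigr => v _.
  rewrite (bigD1 (al v)) //= [X in _ = X.-1](bigD1 (al v)) //= Sal /=.
  rewrite /labelled /= eqxx odd_double /= add0n.
  apply: eq_bigr => a /negPf na; rewrite ceq [al v == a]eq_sym na /=.
  by case: (S v a).
have -> : \sum_v \sum_w (anchored (inr v) (inr w) != labelled c (fun=> 0) (inr v) (inr w))
        = \sum_v \sum_w (eC v w != (v != w) && (al v == al w)).
  apply: eq_bigr => v _; apply: eq_bigr => w _.
  rewrite /labelled /= ceq odd_double andbT.
  by rewrite (inj_eq (@inr_inj _ _)).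
rewrite leq_add2l; have := sum_chooser_pairs al.
have -> : \sum_v \sum_w (al v == al w) = #|Anc| * M ^ 2.
  transitivity (\sum_(v : V) M); last by rewrite sum_nat_const cardV -mulnn; lia.
  apply: eq_bigr => v _; rewrite -(bal (al v)) -sum1_card [RHS]big_mkcond /=.
  by apply: eq_bigr => w _; rewrite inE [al w == _]eq_sym; case: eqP.
lia.
Qed.

Lemma anchored_no (l : nat) (c p : X -> nat) : 0 < l -> (forall x, p x < l) ->
  4 * l * (2 * excess + k2).+1 + #|V| < #|I| ->
  \sum_x \sum_y (anchored x y != labelled c p x y) <= 2 * (#|I| * excess) + k2 ->
  exists2 al : V -> Anc, forall v, S v (al v) & R <= uncut al.
Proof.
move=> l0 pl; set Q := 2 * excess + k2; set W := #|I| => hW.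
have [sa ia] := anchored_simple.
pose D x y : nat := anchored x y != labelled c p x y.
rewrite (@sum_anchored D); last by move=> x y; rewrite /D sa labelled_sym.
set AA := \sum_i \sum_a _; set VA := \sum_v \sum_i _; set VV := \sum_v _ => HT.
have W0 : 0 < W by lia.
have l1 : Q.+1 <= l * Q.+1 by rewrite leq_pmull.
have WQ : 4 * Q.+1 + #|V| <= W by lia.
(* The whole doubled budget is at most [Q] per vertex of an anchor. *)
have AAQ : AA <= W * Q by rewrite /Q; nia.
have AAab a b : \sum_i \sum_j D (inl (i, a)) (inl (j, b)) <= AA.
  apply: leq_sum => i _; rewrite (bigD1 a) //=; apply: leq_trans (leq_addr _ _).
  by apply: leq_sum => j _; rewrite (bigD1 b) //= leq_addr.
have dE a i j : D (inl (i, a)) (inl (j, a)) = (i != j) &&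
    ~~ ((c (inl (i, a)) == c (inl (j, a))) &&
        (odd (c (inl (i, a))) || (p (inl (i, a)) != p (inl (j, a))))).
  rewrite /D /labelled /= eqxx (inj_eq (@inl_inj _ _)) xpair_eqE eqxx andbT.
  by case: (i == j) => //=; case: (_ && _).
(* All but [Q] vertices of an anchor share a label. *)
have exi a : exists i, \sum_j (c (inl (i, a)) != c (inl (j, a))) <= Q.
  case: (pickP (fun i => \sum_j (c (inl (i, a)) != c (inl (j, a))) <= Q)) => [i Hi|no].
    by exists i.
  have : W * Q.+1 <= W * Q.
    apply: leq_trans AAQ; apply: leq_trans (AAab a a).
    rewrite /W -sum_nat_const; apply: leq_sum => i _.
    have := no i; rewrite leqNgt => /negbFE lt; apply: leq_trans lt _.
    apply: leq_sum => j _; rewrite dE; case: (i =P j) => [->|_]; first by rewrite eqxx.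
    by case: eqP.
  by rewrite leq_pmul2l // ltnn.
have [i0 Hi0] := fin_all_exists exi.
pose lam a := c (inl (i0 a, a)).
pose P a := [pred i | c (inl (i, a)) == lam a].
pose x a := \sum_i ~~ P a i.
have xP a : x a + #|P a| = W.
  rewrite -sum1_card /x [X in _ + X]big_mkcond -big_split /= /W -sum1_card.
  by apply: eq_bigr => i _; rewrite inE; case: eqP.
have xQ a : x a <= Q.
  apply: leq_trans (Hi0 a); apply: leq_sum => i _.
  by rewrite /P inE /= eq_sym.
have big a : W <= 2 * #|P a| by have := xP a; have := xQ a; lia.
(* Otherwise some part would contain a positive fraction of the anchor. *)
have lam_odd a : odd (lam a).
  apply/negPn/negP => even.
  have := @card_sqr_le I 'I_l (fun i => Ordinal (pl (inl (i, a)))) (P a).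
  rewrite card_ord leqNgt => /negP; apply.
  have : \sum_(i | P a i) \sum_(j | P a j)
      (Ordinal (pl (inl (i, a))) == Ordinal (pl (inl (j, a))))
      <= \sum_i \sum_j (D (inl (i, a)) (inl (j, a)) + (i == j)).
    rewrite big_mkcond; apply: leq_sum => i _; case: ifP => // Pi.
    rewrite big_mkcond; apply: leq_sum => j _; case: ifP => // Pj.
    rewrite dE -val_eqE /=; move: Pi Pj => /= /eqP -> /eqP ->; rewrite eqxx (negPf even) /=.
    by case: (i == j) => //=; [rewrite leq_b1|rewrite negbK addn0].
  have -> : \sum_i \sum_j (D (inl (i, a)) (inl (j, a)) + (i == j))
       = \sum_i \sum_j D (inl (i, a)) (inl (j, a)) + W.
    under eq_bigr do rewrite big_split /=.
    rewrite big_split /=; congr (_ + _); rewrite /W -sum1_card; apply: eq_bigr => i _.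
    by rewrite (bigD1 i) //= eqxx big1 // => j /negPf; rewrite eq_sym => ->.
  have := AAab a a; have := big a; move: (\sum_i \sum_j D _ _) => q1.
  move: (\sum_(i | _) _) => q2 b1 b2 b3.
  have b4 : l * q2 <= l * (W * Q.+1) by rewrite leq_mul2l; apply/orP; right; lia.
  apply: leq_ltn_trans b4 _; rewrite -(ltn_pmul2l (isT : 0 < 4)).
  have -> : 4 * (l * (W * Q.+1)) = 4 * l * Q.+1 * W by lia.
  have -> : 4 * #|P a| ^ 2 = (2 * #|P a|) * (2 * #|P a|) by lia.
  by apply: (@leq_trans (W * W)); [rewrite ltn_mul2r; lia | apply: leq_mul].
(* A common label of two anchors would require $|P_a| |P_b| \ge W^2/4$ insertions. *)
have lam_inj a b : lam a = lam b -> a = b.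
  move=> Eab; apply/eqP/negPn/negP => nab.
  have : #|P a| * #|P b| <= \sum_i \sum_j D (inl (i, a)) (inl (j, b)).
    rewrite -sum_nat_const big_mkcond /=; apply: leq_sum => i _.
    case: ifP => // Pi; rewrite -sum1_card big_mkcond /=; apply: leq_sum => j _.
    case: ifP => // Pj; rewrite /D /labelled /= (negPf nab) /=.
    rewrite (inj_eq (@inl_inj _ _)) xpair_eqE (negPf nab) andbF /=.
    by move: Pi Pj; rewrite !inE /= => /eqP -> /eqP ->; rewrite Eab eqxx lam_odd.
  have := AAab a b; have := big a; have := big b; nia.
(* A chooser misplaced with respect to anchor [a] pays for every vertex of [P a], and an
   exile from [P a] costs more than it can save the choosers. *)
pose mis v a : nat := S v a != (c (inr v) == lam a).
pose m a := \sum_v mis v a.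
have AAx : \sum_a 2 * (x a * #|P a|) <= AA.
  apply: (@leq_trans (\sum_a \sum_i \sum_j D (inl (i, a)) (inl (j, a)))); last first.
    rewrite /AA exchange_big /=; apply: leq_sum => i _; apply: leq_sum => a _.
    by apply: leq_sum => j _; rewrite (bigD1 a) //= leq_addr.
  apply: leq_sum => a _.
  have -> : 2 * (x a * #|P a|) = \sum_i \sum_j (~~ P a i * P a j + P a i * ~~ P a j).
    have E : #|P a| = \sum_i P a i.
      rewrite -sum1_card [LHS]big_mkcond; apply: eq_bigr => i _.
      by rewrite -topredE /=; case: (_ == _).
    rewrite mul2n -addnn; under [RHS]eq_bigr do rewrite big_split /=.
    rewrite big_split /= E; congr (_ + _); last rewrite mulnC.
      by rewrite big_distrl /=; apply: eq_bigr => i _; rewrite big_distrr.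
    by rewrite big_distrl /=; apply: eq_bigr => i _; rewrite big_distrr.
  apply: leq_sum => i _; apply: leq_sum => j _; rewrite dE.
  rewrite /P /=; case: (i =P j) => [->|_]; first by case: eqP.
  by case: eqP => Ei; case: eqP => Ej //=; case: eqP => // E; case: Ej; rewrite -?E // Ei.
have VAm : \sum_a m a * #|P a| <= VA.
  rewrite (eq_bigr (fun a => \sum_v mis v a * #|P a|)); last by move=> a _; rewrite big_distrl.
  rewrite exchange_big /=; apply: leq_sum => v _.
  rewrite [X in _ <= X]exchange_big /=; apply: leq_sum => a _.
  rewrite mulnC -sum_nat_const big_mkcond /=; apply: leq_sum => i _.
  case: ifP => //; rewrite inE /= => /eqP Pi.
  by rewrite /mis /D /labelled /= Pi; case: (c (inr v) =P lam a) => [->|_]; rewrite ?lam_odd.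
(* Split [W] into [x a + #|P a|]: the part $2 m_a x_a$ is paid by the exiles, since $m_a \le |V| \le
   |P_a|$. *)
have key : 2 * (W * \sum_a m a) <= AA + 2 * VA.
  apply: leq_trans (leq_add AAx (leq_mul (leqnn 2) VAm)).
  rewrite !big_distrr /= -big_split /=; apply: leq_sum => a _.
  have mV : m a <= #|V|.
    by rewrite -[#|V|]muln1 -sum_nat_const; apply: leq_sum => v _; apply: leq_b1.
  have mP : m a <= #|P a| by have := xP a; have := xQ a; lia.
  by rewrite -(xP a); have := leq_mul (leqnn (x a)) mP; lia.
(* Distinct anchors have distinct labels, so a chooser shares the label of at most one of its
   anchors and is misplaced with respect to all its others. *)
have mis_ge v : (\sum_a S v a).-1 + ~~ [exists a, S v a && (c (inr v) == lam a)]
    <= \sum_a mis v a.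
  case: existsP => [[a /andP[Sa /eqP Ea]]|no].
    rewrite (bigD1 a) //= Sa /= addn0 (bigD1 a (F := mis v)) //=.
    apply: leq_trans (leq_addl _ _); apply: leq_sum => b nb; rewrite /mis.
    case: (c (inr v) =P lam b) => [Eb|_]; last by case: (S v b).
    by move: nb; rewrite (lam_inj b a) ?eqxx // -Ea -Eb.
  have -> : (\sum_a S v a).-1 + ~~ false = \sum_a S v a.
    have [a Sa] := S_nonempty v; rewrite addn1 prednK // (bigD1 a) //= Sa.
    by rewrite addn_gt0.
  apply: leq_sum => a _; rewrite /mis; case E: (S v a) => //.
  by case: (c (inr v) =P lam a) => // Ea; case: no; exists a; rewrite E Ea eqxx.
have sum_mis : \sum_a m a = \sum_v \sum_a mis v a by rewrite exchange_big.
(* One misplacement beyond [excess] would cost [2 * W], which exceeds [k2]. *)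
have all_ok v : exists a, S v a && (c (inr v) == lam a).
  apply/existsP; apply: contraT => no; suff: False by [].
  have : excess < \sum_a m a.
    rewrite sum_mis /excess (bigD1 v) //= (bigD1 v (F := fun v => \sum_a mis v a)) //=.
    rewrite -addSn; apply: leq_add.
      by apply: leq_trans (mis_ge v); rewrite no addn1.
    by apply: leq_sum => w _; apply: leq_trans (mis_ge w); apply: leq_addr.
  move: key HT hW; rewrite /Q; move: (\sum_a m a) => mm *; nia.
have [al Hal] := fin_all_exists all_ok.
exists al => [v|]; first by have /andP[] := Hal v.
have le_ex : excess <= \sum_a m a.
  by rewrite sum_mis; apply: leq_sum => w _; apply: leq_trans (mis_ge w); apply: leq_addr.
(* The anchors consume at least [2 * (W * excess)], which leaves [k2] for the pairs of choosers. *)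
have VVk : VV <= k2 by move: key HT; move: (\sum_a m a) le_ex => mm *; nia.
have VVE : VV = \sum_v \sum_w (eC v w != (v != w) && (al v == al w)).
  apply: eq_bigr => v _; apply: eq_bigr => w _; rewrite /D /labelled /=.
  have /andP[_ /eqP ->] := Hal v; have /andP[_ /eqP ->] := Hal w.
  rewrite lam_odd andbT (inj_eq (@inr_inj _ _)).
  by congr (nat_of_bool (_ != _ && _)); apply/eqP/eqP => [/lam_inj|->].
(* At least [#|Anc| * M ^ 2] ordered pairs of choosers share a cluster, whatever the distribution;
   staying within [k2] then requires [R] uncut pairs. *)
have := sum_chooser_pairs al; rewrite -VVE.
have := @card_sqr_le V Anc al predT; rewrite cardV.
move: (\sum_v \sum_w (al v == al w)) => same H1 H2.
have H3 : #|Anc| * M ^ 2 <= same.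
  case: (posnP #|Anc|) => [->|A0]; first by rewrite mul0n.
  by rewrite -(leq_pmul2l A0); apply: leq_trans H1; rewrite -!mulnn; lia.
lia.
Qed.

End Anchors.

(** * From clauses to anchored graphs *)

Lemma sum_pairE (I J : finType) (f : I * J -> nat) :
  \sum_v f v = \sum_i \sum_j f (i, j).
Proof. by rewrite pair_bigA; apply: eq_bigr => -[]. Qed.

Section Formula.
Variables (NV NC : nat) (occ : nat -> nat -> bool -> bool).

(* [occ c v b]: clause [c] contains the literal "variable [v] has value [b]". *)
Definition satisfiable : Prop :=
  exists s : nat -> bool, forall c, c < NC -> exists2 v, v < NV & occ c v (s v).

Definition occurs (c v : nat) : bool := occ c v true || occ c v false.

(* Anchor [2 v + b] stands for the literal "variable [v] has value [b]". The copies [j > 0]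
   of a chooser may join any anchor; they serve to spread the choosers evenly over the
   anchors. *)
Definition may_choose (w j a : nat) : bool :=
  (j != 0) || (if w < NV then a./2 == w else occ (w - NV) a./2 (odd a)).

(** Indices below [NV] are variables, the others clauses. Only the copies 0 carry edges, so that the
    other copies contribute no uncut pairs. *)
Definition chooser_adj (w j w' j' : nat) : bool :=
  [&& j == 0, j' == 0 &
    [&& w < NV, NV <= w' & occurs (w' - NV) w] || [&& w' < NV, NV <= w & occurs (w - NV) w']].

Local Notation A := NV.*2.
Local Notation M := (NV + NC).
Local Notation V := ('I_M * 'I_A)%type.

Definition choose_rel (v : V) : pred 'I_A := fun a => may_choose v.1 v.2 a.
Definition chooser_rel : rel V := fun v w => chooser_adj v.1 v.2 w.1 w.2.

Definition num_occurs : nat := \sum_(c < NC) \sum_(v < NV) occurs c v.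

Lemma chooser_sym : symmetric chooser_rel.
Proof.
move=> v w; rewrite /chooser_rel /chooser_adj orbC.
by case: (_ == 0); case: (_ == 0).
Qed.

Lemma chooser_irr : irreflexive chooser_rel.
Proof.
move=> v; rewrite /chooser_rel /chooser_adj.
by case: ltnP => //=; rewrite !andbF.
Qed.

Hypothesis NV0 : 0 < NV.

Lemma A_gt0 : 0 < A. Proof. by rewrite double_gt0. Qed.
Definition copy0 : 'I_A := Ordinal A_gt0.

Lemma sum_chooser (F : rel V) : symmetric F ->
  \sum_v \sum_w (chooser_rel v w && F v w) =
  2 * \sum_(c < NC) \sum_(x < NV) (occurs c x && F (rshift NV c, copy0) (lshift NC x, copy0)).
Proof.
move=> symF; pose G v w : nat := chooser_rel v w && F v w.
have Gz1 w j v : j != copy0 -> G (w, j) v = 0.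
  rewrite -val_eqE /= => /negPf j0.
  by rewrite /G /chooser_rel /chooser_adj /= j0.
have symG v w : G v w = G w v by rewrite /G chooser_sym symF.
have Gz2 w j v : j != copy0 -> G v (w, j) = 0 by rewrite symG; apply: Gz1.
have -> : \sum_v \sum_w (chooser_rel v w && F v w)
        = \sum_(w < M) \sum_(w' < M) G (w, copy0) (w', copy0).
  rewrite sum_pairE; apply: eq_bigr => w _.
  rewrite (bigD1 copy0) //= [X in _ + X]big1 ?addn0; last first.
    by move=> j nj; rewrite big1 // => v _; apply: Gz1.
  rewrite sum_pairE; apply: eq_bigr => w' _.
  by rewrite (bigD1 copy0) //= big1 ?addn0 // => j nj; apply: Gz2.
rewrite big_split_ord /=; under eq_bigr do rewrite big_split_ord /=.
under [X in _ + X]eq_bigr do rewrite big_split_ord /=.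
rewrite !big_split /= big1 ?add0n; last first.
  move=> x _; rewrite big1 // => y _.
  by rewrite /G /chooser_rel /chooser_adj /= !(leqNgt NV) !ltn_ord /= ?andbF.
rewrite [X in _ + (_ + X)]big1 ?addn0; last first.
  move=> x _; rewrite big1 // => y _.
  by rewrite /G /chooser_rel /chooser_adj /= !(ltnNge _ NV) !leq_addr.
rewrite mul2n -[RHS]addnn; congr (_ + _).
  rewrite exchange_big /=; apply: eq_bigr => c _; apply: eq_bigr => x _.
  rewrite symG /G /chooser_rel /chooser_adj /= leq_addr !(ltnNge _ NV) leq_addr /=.
  by rewrite -ltnNge ltn_ord addKn.
apply: eq_bigr => c _; apply: eq_bigr => x _.
rewrite /G /chooser_rel /chooser_adj /= leq_addr !(ltnNge _ NV) leq_addr /=.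
by rewrite -ltnNge ltn_ord addKn.
Qed.

Hypothesis nonempty : forall c, c < NC -> exists v b, v < NV /\ occ c v b.

Lemma choose_nonempty v : exists a, choose_rel v a.
Proof.
case: v => w j; rewrite /choose_rel /may_choose /=.
have half x (b : bool) : x < NV -> b + x.*2 < A by case: b; lia.
case: (ltnP w NV) => lt.
  by exists (Ordinal (half w false lt)); rewrite /= add0n doubleK eqxx orbT.
have [|v [b [ltv oc]]] := nonempty (c := w - NV); first by have := ltn_ord w; lia.
by exists (Ordinal (half v b ltv)); rewrite /= half_bit_double oddD odd_double addbF oddb oc orbT.
Qed.

(* Insertions inside [2 NV] clusters of [M] choosers each, plus the deletion of all edges
   between choosers, minus the gain of 2 for every clause that shares a cluster with one of
   its variables. *)
Definition half_budget : nat := NV * (M * M.-1) + num_occurs - NC.*2.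

Lemma num_occurs_ge : NC <= num_occurs.
Proof.
rewrite /num_occurs -{1}[NC]muln1 -[X in X * 1]card_ord -sum_nat_const.
apply: leq_sum => c _; have [v [b [ltv oc]]] := nonempty (ltn_ord c).
by rewrite (bigD1 (Ordinal ltv)) //= /occurs; case: b oc => ->; rewrite ?orbT.
Qed.

(** The subtraction in [half_budget] is not truncated: [num_occurs] covers one [NC], and the term
    for the insertions covers the other. *)
Lemma budget_eq : half_budget.*2 + 2 * NC.*2 + #|{: V}|
  = #|'I_A| * M ^ 2 + \sum_v \sum_w chooser_rel v w.
Proof.
have -> : \sum_v \sum_w chooser_rel v w = 2 * num_occurs.
  have := @sum_chooser (fun _ _ => true) (fun _ _ => erefl).
  under eq_bigr => v _ do under eq_bigr => w _ do rewrite andbT.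
  move=> ->; congr (2 * _); apply: eq_bigr => c _; apply: eq_bigr => x _.
  by rewrite andbT.
rewrite card_prod !card_ord /half_budget.
have := num_occurs_ge; have -> : M * M.-1 = M ^ 2 - M by rewrite -mulnn; nia.
have : M <= M ^ 2 by rewrite -mulnn; nia.
have : NC <= M ^ 2 - M by rewrite -mulnn; nia.
move: (M ^ 2) => q h1 h2 h3.
have : NC <= NV * (q - M) by nia.
have -> : NV.*2 * q = 2 * (NV * (q - M)) + 2 * (NV * M) by nia.
by lia.
Qed.

Lemma satisfiable_choice : satisfiable ->
  exists al : V -> 'I_A, [/\ forall v, choose_rel v (al v),
    forall a, #|[pred v | al v == a]| = M & NC.*2 <= uncut chooser_rel al].
Proof.
case=> s Hs.
have half x (b : bool) : x < NV -> b + x.*2 < A by case: b; lia.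
(* A variable takes its true literal and a clause one of its true literals, so that a clause meets a
   variable that satisfies it. *)
have pick (w : 'I_M) : exists a : 'I_A, choose_rel (w, copy0) a /\ odd a = s a./2.
  rewrite /choose_rel /may_choose /=; case: (ltnP w NV) => lt.
    by exists (Ordinal (half w (s w) lt)); rewrite /= half_bit_double eqxx oddD odd_double addbF oddb.
  have [|v ltv oc] := Hs (w - NV); first by have := ltn_ord w; lia.
  by exists (Ordinal (half v (s v) ltv)); rewrite /= half_bit_double oddD odd_double addbF oddb.
have [al0 Hal0] := fin_all_exists pick.
(* Copy [j] goes [j] anchors further, cyclically. The [A] copies of a chooser then meet every anchor
   once, so each anchor receives one copy of each of the [M] choosers. *)
pose sh (b j : nat) := if b + j < A then b + j else b + j - A.
have sh_lt (b j : 'I_A) : sh b j < A.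
  by rewrite /sh; have := ltn_ord b; have := ltn_ord j; case: ifP; lia.
pose al (v : V) : 'I_A := Ordinal (sh_lt (al0 v.1) v.2).
have al00 w : al (w, copy0) = al0 w.
  by apply: val_inj; rewrite /= /sh addn0 ltn_ord.
exists al; split.
- case=> w j; case: (eqVneq j copy0) => [->|nj]; first by rewrite al00; case: (Hal0 w).
  by rewrite /choose_rel /may_choose /= -val_eqE /= in nj *; rewrite nj.
- move=> a; rewrite -sum1_card big_mkcond /=.
  rewrite sum_pairE.
  rewrite -[RHS]muln1 -[X in X * 1]card_ord -sum_nat_const; apply: eq_bigr => w _.
  pose b := al0 w; pose un := if b <= a then a - b else a + A - b.
  have un_lt : un < A.
    by rewrite /un; case: (leqP b a) => h; have := ltn_ord b; have := ltn_ord a; lia.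
  rewrite (bigD1 (Ordinal un_lt)) //= big1 ?addn0 => [|j nj].
    rewrite inE -val_eqE /= /sh -/b /un.
    case: (leqP b a) => h; have h1 := ltn_ord b; have h2 := ltn_ord a.
      by rewrite subnKC // h2 eqxx.
    have -> : (b + (a + A - b) < A) = false by lia.
    by rewrite (_ : b + (a + A - b) - A = a) ?eqxx //; lia.
  rewrite inE -val_eqE /= /sh -/b; case: eqP => // E; case/eqP: nj.
  apply: val_inj => /=; rewrite /un; move: E.
  by case: ifP; case: (leqP b a) => h1 h2; have := ltn_ord b; have := ltn_ord j; lia.
rewrite /uncut (@sum_chooser (fun v w => al v == al w)); last by move=> v w; rewrite eq_sym.
rewrite -mul2n leq_mul2l /= -{1}[NC]muln1 -[X in X * 1]card_ord -sum_nat_const.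
apply: leq_sum => c _; rewrite !al00.
have [] := Hal0 (rshift NV c); rewrite /choose_rel /may_choose /= ltnNge leq_addr addKn /=.
set a := al0 _ => oc oa.
have lta : a./2 < NV by have := ltn_ord a; lia.
rewrite (bigD1 (Ordinal lta)) //= al00.
have [] := Hal0 (lshift NC (Ordinal lta)); rewrite /choose_rel /may_choose /= lta /= => /eqP E1 E2.
have -> : al0 (lshift NC (Ordinal lta)) = a.
  move: E1 E2; set b := al0 (lshift _ _) => E1 E2.
  have E : odd b = odd a by rewrite E2 E1 oa.
  by apply: val_inj => /=; rewrite -[LHS]odd_double_half E E1 odd_double_half.
have -> : occurs c a./2 by rewrite /occurs; case: (odd a) oc => ->; rewrite ?orbT.
by rewrite eqxx.
Qed.

(** Halving an anchor gives back its variable, hence at most one uncut incidence per clause; a total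
    of [NC] leaves no clause without one. The parity of the anchor of a variable is its value. *)
Lemma choice_satisfiable (al : V -> 'I_A) : (forall v, choose_rel v (al v)) ->
  NC.*2 <= uncut chooser_rel al -> satisfiable.
Proof.
move=> Sal; rewrite /uncut (@sum_chooser (fun v w => al v == al w)); last first.
  by move=> v w; rewrite eq_sym.
rewrite -mul2n leq_mul2l /= => le.
pose g (c : 'I_NC) (x : 'I_NV) := occurs c x && (al (rshift NV c, copy0) == al (lshift NC x, copy0)).
have alx (x : 'I_NV) : (al (lshift NC x, copy0))./2 = x.
  have := Sal (lshift NC x, copy0).
  by rewrite /choose_rel /may_choose /= ltn_ord => /eqP.
have g1 c : \sum_(x < NV) g c x <= 1.
  case: (pickP (g c)) => [x gx|no]; last by rewrite big1 // => x _; rewrite no.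
  rewrite (bigD1 x) //= big1 ?addn0 ?leq_b1 // => y ny; case gy: (g c y) => //.
  case/andP: gx gy => _ /eqP E /andP[_ /eqP E'].
  case/eqP: ny; apply: val_inj; rewrite /= -(alx x) -(alx y).
  by rewrite -E -E'.
have gc c : exists x, g c x.
  case: (pickP (g c)) => [x gx|no]; first by exists x.
  move: le; rewrite leqNgt; case/negP.
  rewrite (bigD1 c) //= big1 ?add0n => [|x _]; last by have := no x; rewrite /g => ->.
  apply: (@leq_ltn_trans (\sum_(i < NC | i != c) 1)); first by apply: leq_sum => i _; apply: g1.
  rewrite sum1_card.
  have := cardC1 c; rewrite card_ord => E.
  rewrite (eq_card (B := predC1 c)) ?E; last by [].
  by have := ltn_ord c; lia.
exists (fun x => if insub x is Some x' then odd (al (lshift NC x', copy0)) else false).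
move=> c ltc; have [x /andP[_ /eqP E]] := gc (Ordinal ltc).
exists x => //; rewrite valK -E.
have := Sal (rshift NV (Ordinal ltc), copy0).
rewrite /choose_rel /may_choose /= ltnNge leq_addr addKn /=.
by rewrite {1}E alx.
Qed.

End Formula.

(** * The reduction on numbered vertices *)

Section Transport.
Variables (X Y : finType) (f : X -> Y) (g : Y -> X).
Hypotheses (fK : cancel f g) (gK : cancel g f).
Variables (eX : rel X) (eY : rel Y).
Hypothesis eXY : forall x y, eY (f x) (f y) = eX x y.

Lemma transport_simple : simple_graph eX -> simple_graph eY.
Proof.
by case=> sX iX; split=> [x y|x]; [rewrite -(gK x) -(gK y) !eXY sX | rewrite -(gK x) eXY iX].
Qed.

Lemma transport_sum (c p : Y -> nat) :
  \sum_x \sum_y (eY x y != labelled c p x y)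
  = \sum_x \sum_y (eX x y != labelled (c \o f) (p \o f) x y).
Proof.
have bf : bijective f by exists g.
rewrite (reindex f) /=; last exact: onW_bij.
apply: eq_bigr => x _; rewrite (reindex f) /=; last exact: onW_bij.
by apply: eq_bigr => y _; rewrite eXY /labelled /= (inj_eq (bij_inj bf)).
Qed.

End Transport.

Section Reduction.
Variables (l NV NC : nat) (occ : nat -> nat -> bool -> bool).
Local Notation A := NV.*2.
Local Notation M := (NV + NC).

Definition num_excess : nat :=
  \sum_(w < M) \sum_(j < A) (\sum_(a < A) may_choose NV occ w j a).-1.

Definition width : nat :=
  (4 * l * (2 * num_excess + (half_budget NV NC occ).*2).+1 + M * A).+1.

Definition num_vertices : nat := (width + M) * A.
Definition budget : nat := width * num_excess + half_budget NV NC occ.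

(* Vertex [z * A + a] is the [z]-th copy of anchor [a] if [z < width], and otherwise the
   chooser [(z - width, a)]. *)
Definition adj (u v : nat) : bool :=
  let z := u %/ A in let a := u %% A in let z' := v %/ A in let a' := v %% A in
  if z < width then
    if z' < width then (a == a') && (z != z') else may_choose NV occ (z' - width) a' a
  else if z' < width then may_choose NV occ (z - width) a a'
  else chooser_adj NV occ (z - width) a (z' - width) a'.

Definition reduction_graph : rel 'I_num_vertices := fun u v => adj u v.

Hypotheses (l0 : 0 < l) (NV0 : 0 < NV).
Hypothesis nonempty : forall c, c < NC -> exists v b, v < NV /\ occ c v b.

Local Notation V := ('I_M * 'I_A)%type.
Let X : finType := (('I_width * 'I_A) + V)%type.

Definition index_of (x : X) : nat :=
  match x with inl (i, a) => i * A + a | inr (w, j) => (width + w) * A + j end.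

Lemma index_of_lt x : index_of x < num_vertices.
Proof.
have H z a b : z < b -> a < A -> z * A + a < b * A by nia.
by case: x => [[i a]|[w j]] /=; apply: H => //; rewrite ?ltn_add2l //; apply: ltn_addr.
Qed.

Lemma index_of_divmod (x : X) :
  index_of x %/ A = match x with inl (i, _) => val i | inr (w, _) => width + w end
  /\ index_of x %% A = match x with inl (_, a) => val a | inr (_, j) => val j end.
Proof.
have A0 : 0 < A by rewrite double_gt0.
by case: x => [[i a]|[w j]] /=; rewrite divnMDl // modnMDl divn_small // modn_small ?addn0.
Qed.

Definition vertex_of (x : X) : 'I_num_vertices := Ordinal (index_of_lt x).

Lemma vertex_of_inj : injective vertex_of.
Proof.
move=> x y /(congr1 val) /= E.
have [d m] := index_of_divmod x; have [d' m'] := index_of_divmod y.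
move: d m d' m'; rewrite E => -> ->.
case: x E => [[i a]|[w j]] _; case: y => [[i' a']|[w' j']].
- by move=> /val_inj -> /val_inj ->.
- by move=> E; have := ltn_ord i; rewrite -[nat_of_ord i]/(val i) E ltnNge leq_addr.
- by move=> E; have := ltn_ord i'; rewrite -[nat_of_ord i']/(val i') -E ltnNge leq_addr.
by move=> /addnI/val_inj -> /val_inj ->.
Qed.

Lemma vertex_of_bij : bijective vertex_of.
Proof.
apply: inj_card_bij vertex_of_inj _.
by rewrite card_sum !card_prod !card_ord /num_vertices mulnDl.
Qed.

Lemma vertex_of_adj x y : reduction_graph (vertex_of x) (vertex_of y)
  = anchored (@choose_rel NV NC occ) (@chooser_rel NV NC occ) x y.
Proof.
rewrite /reduction_graph /adj /=.
have [-> ->] := index_of_divmod x; have [-> ->] := index_of_divmod y.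
have ge (w : nat) : (width + w < width) = false by rewrite ltnNge leq_addr.
by case: x y => [[i a]|[w j]] [[i' a']|[w' j']]; rewrite ?ltn_ord ?ge ?addKn.
Qed.

Lemma excessE : excess (@choose_rel NV NC occ) = num_excess.
Proof. by rewrite /excess sum_pairE. Qed.

Lemma reduction_simple : simple_graph reduction_graph.
Proof.
have [g fK gK] := vertex_of_bij.
apply: (transport_simple gK vertex_of_adj).
apply: anchored_simple; [exact: chooser_sym | exact: chooser_irr].
Qed.

Lemma reduction_correct :
  satisfiable NV NC occ <-> cluster_editable l reduction_graph budget.
Proof.
have [g fK gK] := vertex_of_bij.
have cardV : #|{: V}| = M * #|'I_A| by rewrite card_prod !card_ord.
have k2E := budget_eq NV0 nonempty.
have symC := @chooser_sym NV NC occ; have irrC := @chooser_irr NV NC occ.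
have bE : budget.*2 = 2 * (#|'I_width| * excess (@choose_rel NV NC occ)) + (half_budget NV NC occ).*2.
  by rewrite card_ord excessE /budget doubleD mul2n.
split=> [sat|ed].
  have [al [Sal bal leR]] := satisfiable_choice NV0 sat.
  have [c Hc] := anchored_yes 'I_width symC irrC cardV k2E Sal bal leR.
  apply: (labels_editable (c := c \o g) (p := fun=> 0) l0 reduction_simple (fun=> l0)).
  rewrite (transport_sum fK gK vertex_of_adj) bE.
  apply: leq_trans Hc; rewrite leq_eqVlt; apply/orP; left; apply/eqP.
  apply: eq_bigr => x _; apply: eq_bigr => y _.
  by rewrite /labelled /= !fK.
have [c [p [Hp _]]] := editable_labels l0 reduction_simple ed.
rewrite (transport_sum fK gK vertex_of_adj) bE => le.
have [|al Sal leR] := anchored_no symC irrC (choose_nonempty NV0 nonempty) cardV k2E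
  l0 (fun x => Hp (vertex_of x)) _ le.
  by rewrite excessE !card_ord card_prod !card_ord /width ltnS.
exact: choice_satisfiable Sal leR.
Qed.

End Reduction.

(** * Computable words and the reduction map *)

Definition wcomput (f : word -> word) : Prop :=
  exists L B, [/\ comput (fun x _ => L x),
    (forall g, comput g -> comput (fun x e => nat_of_bool (B x (g x e)))) &
    forall x, f x = mkseq (B x) (L x)].

Lemma wcomput_polytime f : wcomput f -> polytime f.
Proof.
case=> L [B [cL cB fE]]; apply: polytime_mkseq cL _ fE.
by apply: cB; comp.
Qed.

Lemma mkseq_cat (T : Type) (f g : nat -> T) m n :
  mkseq f m ++ mkseq g n = mkseq (fun i => if i < m then f i else g (i - m)) (m + n).
Proof.
rewrite [RHS]/mkseq iotaD map_cat add0n; congr (_ ++ _).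
  by apply/eq_in_map => i; rewrite mem_iota => /andP[_ ->].
rewrite /mkseq -[in RHS](addn0 m) iotaDl -map_comp; apply: eq_map => i /=.
by rewrite ltnNge addn0 leq_addr addKn.
Qed.

(** The second word is read at a position shifted by [L x]; this is why [wcomput] asks for bits at
    every computable position. *)
Lemma wcomput_cat f g : wcomput f -> wcomput g -> wcomput (fun x => f x ++ g x).
Proof.
case=> L [B [cL cB fE]] [L' [B' [cL' cB' gE]]].
exists (fun x => L x + L' x), (fun x i => if i < L x then B x i else B' x (i - L x)).
split; [by comp| |by move=> x; rewrite fE gE mkseq_cat].
move=> h ch; have c1 := cB _ ch; have c2 := cB' _ (comput_sub ch cL); comp.
Qed.

Lemma wcomput_nseq n (b : bool) : comput (fun x _ => n x) -> wcomput (fun x => nseq (n x) b).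
Proof.
move=> cn; exists n, (fun _ _ => b); split => // [g cg|x]; first by comp.
apply: (@eq_from_nth _ b); rewrite size_nseq ?size_mkseq // => i lt.
by rewrite nth_nseq nth_mkseq // lt.
Qed.

Lemma wcomput_bits n : comput (fun x _ => n x) -> wcomput (fun x => bits_of_nat (n x)).
Proof.
move=> cn; exists (fun x => log_count (n x).+1), (fun x i => odd (n x %/ cap2 (n x).+1 i)).
by split => [|g cg|x]; [comp | comp | apply: bits_of_natE].
Qed.

Lemma allpairs_mkseq (T : Type) n (f : nat -> nat -> T) :
  [seq f (i : 'I_n) (j : 'I_n) | i <- enum 'I_n, j <- enum 'I_n] =
  mkseq (fun u => f (u %/ n) (u %% n)) (n * n).
Proof.
have -> : [seq f (i : 'I_n) (j : 'I_n) | i <- enum 'I_n, j <- enum 'I_n]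
        = [seq f i j | i <- iota 0 n, j <- iota 0 n].
  by rewrite -val_enum_ord allpairs_mapl allpairs_mapr.
suff H m : [seq f i j | i <- iota 0 m, j <- iota 0 n]
         = mkseq (fun u => f (u %/ n) (u %% n)) (m * n) by exact: H.
elim: m => [//|m IH].
rewrite -addn1 iotaD allpairs_cat IH add0n mulnDl mul1n /= cats0.
rewrite /mkseq iotaD map_cat add0n; congr (_ ++ _).
rewrite -[in RHS](addn0 (m * n)) iotaDl -map_comp; apply/eq_in_map => j.
rewrite mem_iota add0n => /andP[_ lt] /=.
have n0 : 0 < n by lia.
by rewrite divnMDl // modnMDl divn_small // modn_small // addn0.
Qed.

Lemma wcomput_matrix n (f : word -> nat -> nat -> bool) : comput (fun x _ => n x) ->
  (forall g h, comput g -> comput h -> comput (fun x e => nat_of_bool (f x (g x e) (h x e)))) ->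
  wcomput (fun x => [seq f x (i : 'I_(n x)) (j : 'I_(n x)) | i <- enum 'I_(n x), j <- enum 'I_(n x)]).
Proof.
move=> cn cf; exists (fun x => n x * n x), (fun x u => f x (u %/ n x) (u %% n x)).
split=> [|g cg|x]; [by comp | | by rewrite allpairs_mkseq].
by apply: cf; comp.
Qed.

Section ReductionComputable.
Variables (l : nat) (NV NC : word -> nat) (occ : word -> nat -> nat -> bool -> bool).
Hypotheses (cNV : comput (fun x _ => NV x)) (cNC : comput (fun x _ => NC x)).
Hypothesis cocc : forall f g p, comput f -> comput g -> comput (fun x e => nat_of_bool (p x e)) ->
  comput (fun x e => nat_of_bool (occ x (f x e) (g x e) (p x e))).

Lemma comput_may_choose f g h : comput f -> comput g -> comput h ->
  comput (fun x e => nat_of_bool (may_choose (NV x) (occ x) (f x e) (g x e) (h x e))).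
Proof.
move=> cf cg ch; rewrite /may_choose.
have c1 : comput (fun x e => nat_of_bool (occ x (f x e - NV x) (h x e)./2 (odd (h x e)))).
  by apply: cocc; comp.
comp.
Qed.

Lemma comput_occurs f g : comput f -> comput g ->
  comput (fun x e => nat_of_bool (occurs (occ x) (f x e) (g x e))).
Proof.
move=> cf cg; rewrite /occurs; apply: comput_or; apply: cocc => //; comp.
Qed.

Lemma comput_chooser_adj f g f' g' : comput f -> comput g -> comput f' -> comput g' ->
  comput (fun x e => nat_of_bool (chooser_adj (NV x) (occ x) (f x e) (g x e) (f' x e) (g' x e))).
Proof.
move=> cf cg cf' cg'; rewrite /chooser_adj.
have c1 := comput_occurs (comput_sub cf' cNV) cf.
have c2 := comput_occurs (comput_sub cf cNV) cf'.
comp.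
Qed.

Lemma comput_num_excess : comput (fun x _ => num_excess (NV x) (NC x) (occ x)).
Proof.
apply: (@eq_comput _ (fun x _ => bsum (NV x + NC x) (fun w => bsum (NV x).*2 (fun j =>
  (bsum (NV x).*2 (fun a => may_choose (NV x) (occ x) w j a)).-1)))) => //.
have c := comput_may_choose (comput_var 2 0) (comput_var 1 0) (comput_var 0 0).
comp.
Qed.

Lemma comput_half_budget : comput (fun x _ => half_budget (NV x) (NC x) (occ x)).
Proof.
apply: (@eq_comput _ (fun x _ => NV x * ((NV x + NC x) * (NV x + NC x).-1)
  + bsum (NC x) (fun c => bsum (NV x) (fun v => occurs (occ x) c v)) - (NC x).*2)) => //.
have c := comput_occurs (comput_var 1 0) (comput_var 0 0).
comp.
Qed.

Lemma comput_width : comput (fun x _ => width l (NV x) (NC x) (occ x)).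
Proof.
rewrite /width; have c1 := comput_num_excess; have c2 := comput_half_budget.
comp.
Qed.

Lemma comput_num_vertices : comput (fun x _ => num_vertices l (NV x) (NC x) (occ x)).
Proof. by rewrite /num_vertices; have c := comput_width; comp. Qed.

Lemma comput_budget : comput (fun x _ => budget l (NV x) (NC x) (occ x)).
Proof.
rewrite /budget; have c1 := comput_width; have c2 := comput_num_excess.
by have c3 := comput_half_budget; comp.
Qed.

Lemma comput_adj f g : comput f -> comput g ->
  comput (fun x e => nat_of_bool (adj l (NV x) (NC x) (occ x) (f x e) (g x e))).
Proof.
move=> cf cg; rewrite /adj /=; have cw := comput_width.
have cA : comput (fun x _ => (NV x).*2) by comp.
have c1 := comput_div cf cA; have c2 := comput_mod cf cA.
have c3 := comput_div cg cA; have c4 := comput_mod cg cA.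
have c5 := comput_may_choose (comput_sub c3 cw) c4 c2.
have c6 := comput_may_choose (comput_sub c1 cw) c2 c4.
have c7 := comput_chooser_adj (comput_sub c1 cw) c2 (comput_sub c3 cw) c4.
comp.
Qed.

Lemma polytime_reduction : polytime (fun x =>
  encode (@reduction_graph l (NV x) (NC x) (occ x)) (budget l (NV x) (NC x) (occ x))).
Proof.
apply: wcomput_polytime; apply: wcomput_cat.
  exact: wcomput_nseq comput_num_vertices.
apply: (@wcomput_cat (fun x => nseq 1 false)).
  by apply: wcomput_nseq; comp.
apply: wcomput_cat; last exact: wcomput_bits comput_budget.
exact: (wcomput_matrix (f := fun x => adj l (NV x) (NC x) (occ x)) comput_num_vertices comput_adj).
Qed.

End ReductionComputable.

(** * Tableaux *)

Section Columns.
Variable M : machine.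

(* What all tapes show at a given offset from their heads, together with the state and,
   for every tape, whether this is its cell 0. *)
Definition column : finType :=
  (state M * {ffun 'I_(ntapes M).+1 -> symbol (extra M) * bool})%type.

Definition column_at (c : config M) (z : int) : column :=
  (cstate c, [ffun t => (tape c t (Defs.head c t + z)%R, (Defs.head c t + z == 0)%R)]).

Definition by_dir (T : Type) (d : direction) (l s r : T) : T :=
  match d with Left => l | Stay => s | Right => r end.

(** Heads move independently, so each tape takes its new symbol from the left, the middle or the
    right column according to its own move. The three flags tell which of these columns stands at
    the heads, where the written symbol appears. *)
Definition next_column (zl z zr : bool) (g0 gl g gr : column) : column :=
  if halting g0.1 then g else
  let: (q, a) := delta g0.1 [ffun t => (g0.2 t).1] in
  (q, [ffun t => let old := (by_dir (a t).2 gl g gr).2 t in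
         (if by_dir (a t).2 zl z zr then (a t).1 else old.1, old.2)]).

Lemma column_at_step c z :
  column_at (step c) z = next_column (z - 1 == 0)%R (z == 0)%R (z + 1 == 0)%R
    (column_at c 0) (column_at c (z - 1)%R) (column_at c z) (column_at c (z + 1)%R).
Proof.
rewrite /next_column /= /step; case: ifP => // _.
have -> : [ffun t => ([ffun t0 => (tape c t0 (Defs.head c t0 + 0)%R,
      (Defs.head c t0 + 0 == 0)%R)] t).1] = [ffun t => tape c t (Defs.head c t)].
  by apply/ffunP => t; rewrite !ffunE /= GRing.addr0.
case: (delta _ _) => q a; rewrite /column_at /=; congr (_, _).
apply/ffunP => t; rewrite !ffunE.
case: (a t) => s [] /=; rewrite ffunE /=; congr (_, _); try lia.
- have -> : (Defs.head c t - 1 + z = Defs.head c t + (z - 1))%R by lia.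
  by congr (if _ then _ else _); lia.
- by congr (if _ then _ else _); lia.
have -> : (Defs.head c t + 1 + z = Defs.head c t + (z + 1))%R by lia.
by congr (if _ then _ else _); lia.
Qed.

Lemma head_bound x n t : (`|Defs.head (iter n (@step M) (init M x)) t| <= n)%N.
Proof.
elim: n => //= n; rewrite {2}/step; case: ifP => _; first by lia.
case: (delta _ _) => q a /=; case: (a t) => s [] /=; lia.
Qed.

Definition bit_symbol (k : nat) : symbol (extra M) :=
  match k with 0 => Some (inl false) | 1 => Some (inl true) | _ => None end.

Definition start_column (k : nat) (z : bool) : column :=
  (start M, [ffun t => (if t == ord0 then bit_symbol k else None, z)]).

Lemma word_symbolE w i : word_symbol M w i = bit_symbol (input_at w i).
Proof.
rewrite /word_symbol /input_at; case: (ltnP i (size w)) => lt.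
  by rewrite !(nth_map false) //; case: nth.
by rewrite !nth_default ?size_map.
Qed.

Lemma column_at_init w (z : int) :
  column_at (init M w) z = start_column (if z is Posz i then input_at w i else 2) (z == 0)%R.
Proof.
rewrite /column_at /start_column /=; congr (_, _).
apply/ffunP => t; rewrite !ffunE /= GRing.add0r; congr (_, _).
by case: z => i; case: eqP => //; rewrite word_symbolE.
Qed.

(* The origin of the last tape, holding the output bit [false]. *)
Definition rejecting (g : column) : bool :=
  (g.2 ord_max).2 && ((g.2 ord_max).1 == Some (inl false)).

End Columns.

Lemma input_at_pair x y z : input_at (pair_word x y) z =
  if z < (size x).*2 then (if odd z then input_at x z./2 else 1)
  else if z == (size x).*2 then 0 else input_at y (z - (size x).*2.+1).
Proof.
elim: x z => [|b x IH] z; first by case: z => [|z] //=; rewrite subSS subn0.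
have E : pair_word (b :: x) y = [:: true, b & pair_word x y] by [].
rewrite E; case: z => [|[|z]] //.
rewrite -[LHS]/(input_at (pair_word x y) z) IH /= doubleS !ltnS !eqSS !subSS.
by rewrite negbK.
Qed.

Definition look (s : seq nat) (i : nat) : nat := nth 0 s i.

(** The machine is fixed, so its finite tables are constants, and nested conditionals look them
    up. *)
Lemma comput_look s f : comput f -> comput (fun x e => look s (f x e)).
Proof.
move=> cf; elim: s f cf => [|a s IH] f cf.
  by apply: (@eq_comput _ (fun _ _ => 0)); [move=> x e; rewrite /look nth_nil | exact: comput_const].
apply: (@eq_comput _ (fun x e => if f x e == 0 then a else look s (f x e).-1)).
  by move=> x e; rewrite /look; case: (f x e).
have c := IH _ (comput_pred cf); comp.
Qed.

Definition tabulate (X : finType) (h : X -> nat) : seq nat := [seq h x | x <- enum X].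

Lemma look_tabulate (X : finType) (h : X -> nat) x : look (tabulate h) (enum_rank x) = h x.
Proof.
rewrite /look /tabulate (nth_map x) ?nth_enum_rank //.
by rewrite -cardE; apply: ltn_ord.
Qed.

Lemma decode3 (b g t p u : nat) : p < b -> u < g ->
  [/\ ((t * b + p) * g + u) %% g = u, ((t * b + p) * g + u) %/ g %% b = p
    & ((t * b + p) * g + u) %/ g %/ b = t].
Proof.
move=> pb ug; have b0 : 0 < b by lia. have g0 : 0 < g by lia.
by rewrite modnMDl divnMDl // (divn_small ug) (modn_small ug) addn0 modnMDl divnMDl //
  (divn_small pb) (modn_small pb) addn0.
Qed.

Lemma encode3 (b g v : nat) : ((v %/ g %/ b * b + v %/ g %% b) * g + v %% g) = v.
Proof. by rewrite -!divn_eq. Qed.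

(** * Clauses that describe a run *)

Section Tableau.
Variable M : machine.

(** A step clause is indexed by the columns it assumes, the one at the heads and three consecutive
    ones; how many there are depends on the machine only. *)
Definition quad : finType := (column M * column M * column M * column M)%type.

Definition rk (g : column M) : nat := enum_rank g.
Definition col_count : nat := #|column M|.
Definition quad_count : nat := #|quad|.

Definition tab1 := tabulate (fun u : quad => rk u.1.1.1).
Definition tab2 := tabulate (fun u : quad => rk u.1.1.2).
Definition tab3 := tabulate (fun u : quad => rk u.1.2).
Definition tab4 := tabulate (fun u : quad => rk u.2).
Definition tab_next zl z zr :=
  tabulate (fun u : quad => rk (next_column zl z zr u.1.1.1 u.1.1.2 u.1.2 u.2)).
Definition tab_reject := tabulate (fun u : quad => nat_of_bool (rejecting u.1.1.1)).
Definition tab_start := [:: rk (start_column M 0 false); rk (start_column M 1 false);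
  rk (start_column M 2 false); rk (start_column M 0 true); rk (start_column M 1 true);
  rk (start_column M 2 true)].

Section Clauses.
Variables (x : word) (T q : nat).

(** The known part of a row shrinks by one position per step at either end. A margin of $2T$ still
    leaves all offsets from $-T$ to $T$ at time $T$, and these include cell 0 of every tape. *)
Definition origin : nat := 2 * T.
Definition breadth : nat := 4 * T + (size x).*2 + q + 3.

Definition next_code (p u : nat) : nat :=
  if p == origin.+1 then look (tab_next true false false) u
  else if p == origin then look (tab_next false true false) u
  else if p.+1 == origin then look (tab_next false false true) u
  else look (tab_next false false false) u.

(** What cell [z] may hold when the input is paired with an unknown certificate of length at most
    [q]; only the certificate cells are left open. *)
Definition symbol_ok (z k : nat) : bool :=
  if z < (size x).*2 then (if odd z then k == input_at x z./2 else k == 1)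
  else if z == (size x).*2 then k == 0
  else if z <= (size x).*2 + q then true else k == 2.

Definition start_ok (p g : nat) : bool :=
  bex 3 (fun k => (g == look tab_start (3 * (p == origin) + k)) &&
                  (if p < origin then k == 2 else symbol_ok (p - origin) k)).

(* Variable [(t * breadth + p) * col_count + g] says that at time [t] the column at offset
   [p - origin] from the heads has number [g]. *)
Definition tableau_occ (c v : nat) (b : bool) : bool :=
  let u := c %% quad_count in let p := c %/ quad_count %% breadth in
  let t := c %/ quad_count %/ breadth %% T.+1 in
  let kind := c %/ quad_count %/ breadth %/ T.+1 in
  let g := v %% col_count in let pv := v %/ col_count %% breadth in
  let tv := v %/ col_count %/ breadth in
  if kind == 0 then
    if [&& t < T, 0 < p & p.+1 < breadth] then
      [&& b, tv == t.+1, pv == p & g == next_code p u] ||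
      [&& ~~ b, tv == t & [|| (pv == origin) && (g == look tab1 u),
        (pv == p.-1) && (g == look tab2 u), (pv == p) && (g == look tab3 u)
        | (pv == p.+1) && (g == look tab4 u)]]
    else v == 0
  else if kind == 1 then [&& b, tv == 0, pv == p & start_ok p g]
  else if kind == 2 then
    if (origin + (size x).*2 < p) && (p.+1 < breadth) then
      [&& tv == 0, g == look tab_start 2 & if b then pv == p.+1 else pv == p]
    else v == 0
  else if look tab_reject u != 0 then [&& ~~ b, tv == T, pv == p & g == look tab1 u]
  else v == 0.

Definition tableau_vars : nat := T.+1 * breadth * col_count.
Definition tableau_clauses : nat := 4 * T.+1 * breadth * quad_count.

Definition var_code (t p : nat) (g : column M) : nat := (t * breadth + p) * col_count + rk g.
Definition clause_code (k t p : nat) (u : quad) : nat :=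
  ((k * T.+1 + t) * breadth + p) * quad_count + enum_rank u.

Lemma rk_lt g : rk g < col_count. Proof. exact: ltn_ord. Qed.
Lemma rk_inj : injective rk. Proof. by move=> g h /val_inj/enum_rank_inj. Qed.

Lemma var_code_lt t p g : t <= T -> p < breadth -> var_code t p g < tableau_vars.
Proof.
move=> tT pB; have := rk_lt g; rewrite /var_code /tableau_vars.
have : t * breadth + p < T.+1 * breadth by nia.
by move: (t * breadth + p) (T.+1 * breadth) (rk g) => a b r *; nia.
Qed.

Lemma clause_code_lt k t p u : k < 4 -> t <= T -> p < breadth ->
  clause_code k t p u < tableau_clauses.
Proof.
move=> k4 tT pB; have := ltn_ord (enum_rank u); rewrite /clause_code /tableau_clauses.
have h1 : k * T.+1 + t < 4 * T.+1 by nia.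
have h2 : (k * T.+1 + t) * breadth + p < 4 * T.+1 * breadth.
  by move: (k * T.+1 + t) (4 * T.+1) h1 => a b h; nia.
move: ((k * T.+1 + t) * breadth + p) (4 * T.+1 * breadth) (nat_of_ord (enum_rank u)) h2.
by rewrite -/quad_count => a b r h2 h3; nia.
Qed.

(** Kind 0 makes a step, kind 1 fixes the start, kind 2 propagates blanks through the certificate
    cells, and kind 3 forbids a rejecting column at time [T], at all positions, as the origin of the
    output tape may be anywhere. *)
Lemma occ_clause k t p u v b : t <= T -> p < breadth ->
  tableau_occ (clause_code k t p u) v b =
  let g := v %% col_count in let pv := v %/ col_count %% breadth in
  let tv := v %/ col_count %/ breadth in
  if k == 0 then
    if [&& t < T, 0 < p & p.+1 < breadth] then
      [&& b, tv == t.+1, pv == p & g == next_code p (enum_rank u)] ||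
      [&& ~~ b, tv == t & [|| (pv == origin) && (g == rk u.1.1.1),
        (pv == p.-1) && (g == rk u.1.1.2), (pv == p) && (g == rk u.1.2)
        | (pv == p.+1) && (g == rk u.2)]]
    else v == 0
  else if k == 1 then [&& b, tv == 0, pv == p & start_ok p g]
  else if k == 2 then
    if (origin + (size x).*2 < p) && (p.+1 < breadth) then
      [&& tv == 0, g == rk (start_column M 2 false) & if b then pv == p.+1 else pv == p]
    else v == 0
  else if rejecting u.1.1.1 then [&& ~~ b, tv == T, pv == p & g == rk u.1.1.1]
  else v == 0.
Proof.
move=> tT pB; rewrite /tableau_occ /clause_code /=.
have ur : enum_rank u < quad_count by apply: ltn_ord.
have [-> -> ->] := decode3 (k * T.+1 + t) pB ur.
rewrite modnMDl modn_small // divnMDl // divn_small // addn0.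
rewrite /tab1 /tab2 /tab3 /tab4 /tab_reject !look_tabulate.
by case: (rejecting _).
Qed.

Lemma clause_surj c : c < tableau_clauses -> exists k t p u,
  [/\ k < 4, t <= T, p < breadth & c = clause_code k t p u].
Proof.
move=> ltc; have B0 : 0 < breadth by rewrite /breadth addn3.
have q0 : 0 < quad_count.
  by rewrite lt0n; apply/negP => /eqP E; rewrite /tableau_clauses E muln0 in ltc.
pose u : 'I_#|quad| := Ordinal (ltn_pmod c q0).
exists (c %/ quad_count %/ breadth %/ T.+1), (c %/ quad_count %/ breadth %% T.+1),
  (c %/ quad_count %% breadth), (enum_val u); split.
- rewrite ltn_divLR // ltn_divLR // ltn_divLR //.
- by rewrite -ltnS ltn_pmod.
- by rewrite ltn_pmod.
by rewrite /clause_code enum_valK /= -!divn_eq.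
Qed.

Lemma next_codeE p u : next_code p (enum_rank (u : quad)) =
  rk (next_column (p == origin.+1) (p == origin) (p.+1 == origin) u.1.1.1 u.1.1.2 u.1.2 u.2).
Proof.
rewrite /next_code /tab_next; case: (p =P origin.+1) => [->|_].
  by rewrite look_tabulate !gtn_eqF.
case: (p =P origin) => [->|_]; first by rewrite look_tabulate gtn_eqF.
by case: ifP => _; rewrite look_tabulate.
Qed.

Lemma start_codeE (z : bool) k : k < 3 -> look tab_start (3 * z + k) = rk (start_column M k z).
Proof. by case: z; case: k => [|[|[|k]]]. Qed.

End Clauses.
End Tableau.

Section TableauCorrect.
Variables (M : machine) (x : word) (T q : nat) (chi : word -> bool).
Hypothesis chiP : forall y, size y <= q ->
  outputs (iter T (@step M) (init M (pair_word x y))) [:: chi (pair_word x y)].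

Local Notation o := (origin T).
Local Notation B := (breadth x T q).
Local Notation occ := (tableau_occ M x T q).
Local Notation var := (@var_code M x T q).
Local Notation clause := (@clause_code M x T q).

Definition fact (y : word) (t p : nat) : column M :=
  column_at (iter t (@step M) (init M (pair_word x y))) (Posz p - Posz o)%R.

Lemma origin_lt : o < B.
Proof. by rewrite /origin /breadth; lia. Qed.

Lemma fact_step y t p : 0 < p ->
  fact y t.+1 p = next_column (p == o.+1) (p == o) (p.+1 == o)
    (fact y t o) (fact y t p.-1) (fact y t p) (fact y t p.+1).
Proof.
case: p => // p _; rewrite {1}/fact /= column_at_step /fact /=.
have -> : (Posz p.+1 - Posz o - 1 = Posz p - Posz o)%R by lia.
have -> : (Posz p.+1 - Posz o + 1 = Posz p.+2 - Posz o)%R by lia.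
rewrite GRing.subrr; congr (next_column _ _ _); lia.
Qed.

Lemma fact_start y p :
  fact y 0 p = start_column M (if p < o then 2 else input_at (pair_word x y) (p - o)) (p == o).
Proof.
rewrite /fact column_at_init; congr (start_column M _ _); last by lia.
case: (ltnP p o) => lt.
  by have -> : (Posz p - Posz o = Negz (o - p).-1)%R by lia.
by have -> : (Posz p - Posz o = Posz (p - o))%R by lia.
Qed.

Lemma symbol_ok_pair y z : size y <= q -> symbol_ok x q z (input_at (pair_word x y) z).
Proof.
move=> le; rewrite /symbol_ok input_at_pair; case: (ltnP z (size x).*2) => lt; first by case: (odd z); rewrite ?eqxx.
case: eqP => // ne; case: leqP => // lt2.
by rewrite /input_at nth_default // size_map; lia.
Qed.

Lemma occ_var k t p u t' p' g b : t <= T -> p < B -> p' < B ->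
  occ (clause k t p u) (var t' p' g) b =
  if k == 0 then
    if [&& t < T, 0 < p & p.+1 < B] then
      [&& b, t' == t.+1, p' == p &
        g == next_column (p == o.+1) (p == o) (p.+1 == o) u.1.1.1 u.1.1.2 u.1.2 u.2] ||
      [&& ~~ b, t' == t & [|| (p' == o) && (g == u.1.1.1),
        (p' == p.-1) && (g == u.1.1.2), (p' == p) && (g == u.1.2)
        | (p' == p.+1) && (g == u.2)]]
    else var t' p' g == 0
  else if k == 1 then [&& b, t' == 0, p' == p & start_ok M x T q p (rk g)]
  else if k == 2 then
    if (o + (size x).*2 < p) && (p.+1 < B) then
      [&& t' == 0, g == start_column M 2 false & if b then p' == p.+1 else p' == p]
    else var t' p' g == 0
  else if rejecting u.1.1.1 then [&& ~~ b, t' == T, p' == p & g == u.1.1.1]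
  else var t' p' g == 0.
Proof.
move=> tT pB pB'; rewrite occ_clause //=.
have [-> -> ->] := decode3 t' pB' (rk_lt g).
by rewrite next_codeE !(inj_eq (@rk_inj M)).
Qed.

Lemma accept_satisfiable y : size y <= q -> chi (pair_word x y) ->
  satisfiable (tableau_vars M x T q) (tableau_clauses M x T q) occ.
Proof.
move=> ley acc.
pose s v := v %% col_count M == rk (fact y (v %/ col_count M %/ B) (v %/ col_count M %% B)).
have sE t p g : p < B -> s (var t p g) = (g == fact y t p).
  by move=> pB; rewrite /s; have [-> -> ->] := decode3 t pB (rk_lt g); rewrite (inj_eq (@rk_inj M)).
have pick k t p u t' p' g b : t <= T -> p < B -> t' <= T -> p' < B ->
    (g == fact y t' p') = b -> occ (clause k t p u) (var t' p' g) b ->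
    exists2 v, v < tableau_vars M x T q & occ (clause k t p u) v (s v).
  move=> tT pB tT' pB' gE oc; exists (var t' p' g); first exact: var_code_lt.
  by rewrite sE // gE.
(* Clause numbers that describe nothing are filled with the tautology on variable 0. *)
have taut k t p u : (forall b, occ (clause k t p u) 0 b) ->
    exists2 v, v < tableau_vars M x T q & occ (clause k t p u) v (s v).
  move=> H; exists 0 => //.
  by have := @var_code_lt M x T q 0 0 (fact y 0 0) isT (leq_ltn_trans (leq0n _) origin_lt); lia.
exists s => c /clause_surj[k [t [p [u [k4 tT pB ->]]]]].
have oB := origin_lt.
case k0: (k == 0).
  case cond: [&& t < T, 0 < p & p.+1 < B]; last first.
    by apply: taut => b; rewrite occ_clause //= k0 cond.
  have /and3P[ltT p0 pB1] := cond.
  case E1: (u.1.1.1 == fact y t o); last first.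
    by apply: (pick _ _ _ _ t o u.1.1.1 false) => //; rewrite occ_var // k0 cond /= !eqxx /=.
  case E2: (u.1.1.2 == fact y t p.-1); last first.
    have pB' : p.-1 < B by lia.
    by apply: (pick _ _ _ _ t p.-1 u.1.1.2 false) => //; rewrite occ_var // k0 cond /= !eqxx /= ?orbT.
  case E3: (u.1.2 == fact y t p); last first.
    by apply: (pick _ _ _ _ t p u.1.2 false) => //; rewrite occ_var // k0 cond /= !eqxx /= ?orbT.
  case E4: (u.2 == fact y t p.+1); last first.
    by apply: (pick _ _ _ _ t p.+1 u.2 false) => //; rewrite occ_var // k0 cond /= !eqxx /= ?orbT.
  apply: (pick _ _ _ _ t.+1 p (fact y t.+1 p) true) => //; first exact: eqxx.
  rewrite occ_var // k0 cond /= !eqxx /= fact_step //.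
  by rewrite (eqP E1) (eqP E2) (eqP E3) (eqP E4) eqxx.
case k1: (k == 1).
  apply: (pick _ _ _ _ 0 p (fact y 0 p) true) => //; first exact: eqxx.
  rewrite occ_var // k0 k1 /= eqxx /=.
  rewrite fact_start; set z := if _ then _ else _; apply/bexP.
  have z3 : z < 3 by rewrite /z; case: ifP => // _; rewrite ltnS; apply: input_at_le.
  exists z => //; rewrite start_codeE // eqxx /= /z.
  by case: ltnP => // _; apply: symbol_ok_pair.
case k2: (k == 2).
  case cond: ((o + (size x).*2 < p) && (p.+1 < B)); last first.
    by apply: taut => b; rewrite occ_clause //= k0 k1 k2 cond.
  have /andP[lop pB1] := cond.
  have po : (p == o) = false by lia.
  have po1 : (p.+1 == o) = false by lia.
  case E: (start_column M 2 false == fact y 0 p); last first.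
    by apply: (pick _ _ _ _ 0 p (start_column M 2 false) false) => //; rewrite occ_var // k0 k1 k2 cond /= !eqxx /=.
  (* A blank beyond the separator means that the certificate has ended, so the next cell is blank as
     well. *)
  apply: (pick _ _ _ _ 0 p.+1 (start_column M 2 false) true) => //; last first.
    by rewrite occ_var // k0 k1 k2 cond /= !eqxx /=.
  move/eqP: E; rewrite !fact_start po po1 => E; apply/eqP; congr (start_column _ _ _).
  have lt1 : (p < o) = false by lia.
  have lt2 : (p.+1 < o) = false by lia.
  move/(congr1 snd)/ffunP/(_ ord0): E; rewrite !ffunE eqxx lt1 lt2.
  rewrite !input_at_pair; have -> : (p - o < (size x).*2) = false by lia.
  have -> : (p.+1 - o < (size x).*2) = false by lia.
  have -> : (p - o == (size x).*2) = false by lia.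
  have -> : (p.+1 - o == (size x).*2) = false by lia.
  move=> [E]; rewrite /input_at; rewrite nth_default // size_map.
  suff : size y <= p - o - (size x).*2.+1 by lia.
  rewrite leqNgt; apply/negP => lt; move: E; rewrite /input_at (nth_map false) //.
  by case: nth.
case rej: (rejecting u.1.1.1); last first.
  by apply: taut => b; rewrite occ_clause //= k0 k1 k2 rej.
apply: (pick _ _ _ _ T p u.1.1.1 false) => //; last first.
  by rewrite occ_var // k0 k1 k2 rej /= !eqxx /=.
apply/negP => /eqP E; move: rej; rewrite E /rejecting /fact /column_at !ffunE /=.
case/andP=> /eqP ->.
by have := chiP ley (leq0n 1); rewrite acc => ->.
Qed.

(** The columns of the actual run are all asserted, possibly along with others, and that is enough:
    a rejecting run would violate a clause of kind 3. *)
Lemma satisfiable_accept :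
  satisfiable (tableau_vars M x T q) (tableau_clauses M x T q) occ ->
  exists y, size y <= q /\ chi (pair_word x y).
Proof.
case=> s Hs.
pose S t p g := s (var t p g).
have oB := origin_lt.
have clauseP k t p u : k < 4 -> t <= T -> p < B -> exists t' p' g,
    p' < B /\ occ (clause k t p u) (var t' p' g) (S t' p' g).
  move=> k4 tT pB; have [v ltv oc] := Hs _ (clause_code_lt u k4 tT pB).
  have G0 : 0 < col_count M.
    by rewrite lt0n; apply/negP => /eqP E; rewrite /tableau_vars E muln0 in ltv.
  have B0 : 0 < B by lia.
  pose g : 'I_#|column M| := Ordinal (ltn_pmod v G0).
  exists (v %/ col_count M %/ B), (v %/ col_count M %% B), (enum_val g).
  split; first by rewrite ltn_pmod.
  have vE : var (v %/ col_count M %/ B) (v %/ col_count M %% B) (enum_val g) = v.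
    by rewrite /var_code /rk enum_valK /= encode3.
  by rewrite /S vE.
pose gs k := start_column M k false.
pose first j := o + (size x).*2 + 1 + j.
have firstB j : j <= q -> first j < B by rewrite /first /breadth /origin; lia.
pose blank j := S 0 (first j) (gs 2).
(* The certificate ends at the first cell where a blank is asserted, or after [q] cells if there is
   none. *)
pose len := find blank (iota 0 q).
pose y := mkseq (fun j => S 0 (first j) (gs 1)) len.
have leny : size y <= q.
  by rewrite size_mkseq /len -[X in _ <= X](size_iota 0 q) find_size.
exists y; split => //.
have u0 : quad M := (gs 0, gs 0, gs 0, gs 0).
have start_exists p : p < B -> exists k, [/\ k < 3, S 0 p (start_column M k (p == o)) &
    if p < o then k == 2 else symbol_ok x q (p - o) k].
  move=> pB; have [t' [p' [g [pB' ]]]] := clauseP 1 0 p u0 isT (leq0n T) pB.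
  rewrite occ_var //= => /and4P[Sg /eqP t0 /eqP pp /bexP[k k3 /andP[]]].
  rewrite start_codeE // => /eqP/(@rk_inj M) gE ok.
  by exists k; split => //; move: Sg; rewrite t0 pp gE.
have blankS p : o + (size x).*2 < p -> p.+1 < B -> S 0 p (gs 2) -> S 0 p.+1 (gs 2).
  move=> lop pB1 Sp; have pB : p < B by apply: ltnW.
  have [t' [p' [g [pB' ]]]] := clauseP 2 0 p u0 isT (leq0n T) pB.
  rewrite occ_var //= lop pB1 /= => /and3P[/eqP -> /eqP ->].
  case E: (S 0 p' _) => /eqP pp; first by rewrite -pp.
  by rewrite pp Sp in E.
have fact0 p : p < B -> S 0 p (fact y 0 p).
  move=> pB; have [k [k3 Sk ok]] := start_exists p pB; rewrite fact_start.
  case: (ltnP p o) ok => lt ok; first by move: Sk; rewrite (eqP ok).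
  move: ok; rewrite /symbol_ok input_at_pair.
  case: (ltnP (p - o) (size x).*2) => h1; first by case: (odd _) => /eqP E; move: Sk; rewrite E.
  case: (p - o =P (size x).*2) => h2; first by move=> /eqP E; move: Sk; rewrite E.
  have po : (p == o) = false by lia.
  rewrite po in Sk *; pose j := p - o - (size x).*2.+1.
  have pE : p = first j by rewrite /first /j; lia.
  rewrite -/j; case: ifP => h3; last first.
    move/eqP => E; move: Sk; rewrite E /input_at nth_default // size_map.
    by apply: leq_trans leny _; rewrite /j; lia.
  move=> _; have jq : j < q by rewrite /j; lia.
  (* Before [len] no blank is asserted, so some bit is; where both bits are, [y] takes [true]. *)
  case: (ltnP j len) => jl.
    have nb : S 0 p (gs 2) = false.
      have := before_find 0 jl; rewrite nth_iota ?add0n // => <-.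
      by rewrite /blank -pE.
    rewrite /input_at (nth_map false) ?size_mkseq // nth_mkseq // -pE.
    case E1: (S 0 p (gs 1)) => //=.
    case: k k3 Sk => [|[|[|k]]] // _.
      by rewrite -/(gs 1) E1.
    by rewrite -/(gs 2) nb.
  rewrite /input_at nth_default; last by rewrite size_map size_mkseq.
  have lenq : len < q by apply: leq_ltn_trans jl jq.
  have bl : blank len.
    have := nth_find 0 (_ : has blank (iota 0 q)); rewrite has_find size_iota -/len.
    by move/(_ lenq); rewrite nth_iota // add0n.
  have all_blank i : len + i <= q -> S 0 (first (len + i)) (gs 2).
    elim: i => [|i IH] le; first by rewrite addn0.
    have E : first (len + i.+1) = (first (len + i)).+1 by rewrite /first; lia.
    have ltB := firstB _ le; rewrite E in ltB *; apply: blankS => //; last by apply: IH; lia.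
    by rewrite /first; lia.
  by rewrite pE -(subnKC jl); apply: all_blank; rewrite subnKC // ltnW.
(* The neighbours of a position known at time [t.+1] are known at time [t], and so is the column at
   the heads. *)
have factS t p : t <= T -> t <= p -> p + t < B -> S t p (fact y t p).
  elim: t p => [|t IH] p tT tp ptB; first by apply: fact0; lia.
  have pB : p < B by lia.
  have cond : [&& t < T, 0 < p & p.+1 < B] by apply/and3P; split; lia.
  have [t' [p' [g [pB' ]]]] := clauseP 0 t p
    (fact y t o, fact y t p.-1, fact y t p, fact y t p.+1) isT (ltnW tT) pB.
  rewrite occ_var ?(ltnW tT) //= cond -fact_step; last lia.
  case/orP => [/and4P[Sg /eqP t1 /eqP pp /eqP gg]|]; first by move: Sg; rewrite t1 pp gg.
  case/and3P=> nS /eqP t1 H; case/negP: nS; rewrite t1.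
  by case/or4P: H => /andP[/eqP -> /eqP ->]; apply: IH; rewrite /origin /breadth in ptB *; lia.
apply/negPn/negP => nacc.
set c := iter T (@step M) (init M (pair_word x y)).
have hb := @head_bound M (pair_word x y) T ord_max; rewrite -/c in hb.
(* The position of cell 0 of the output tape at time [T]. *)
have [p pE] : exists p : nat, Posz p = (Posz o - Defs.head c ord_max)%R.
  move: (Defs.head c ord_max) hb => h hb; exists `|(Posz o - h)%R|%N.
  by rewrite /origin; lia.
have [Tp pTB] : T <= p /\ p + T < B.
  move: (Defs.head c ord_max) hb pE => h hb; rewrite /breadth /origin.
  by move=> pE; split; lia.
have ST : S T p (fact y T p).
  exact: factS.
have rej : rejecting (fact y T p).
  rewrite /rejecting /fact /column_at !ffunE /= -/c.
  have -> : (Defs.head c ord_max + (Posz p - Posz o) = 0)%R by rewrite pE; lia.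
  by rewrite (chiP leny (leq0n 1)) (negPf nacc).
have pB : p < B by lia.
have [t' [p' [g [pB' ]]]] := clauseP 3 T p
  (fact y T p, fact y T p, fact y T p, fact y T p) isT (leqnn T) pB.
rewrite occ_var //= rej => /and4P[nS /eqP t1 /eqP pp /eqP gg].
by case/negP: nS; rewrite t1 pp gg.
Qed.

End TableauCorrect.

Lemma tableau_vars_gt0 M x T q : 0 < tableau_vars M x T q.
Proof.
have := @var_code_lt M x T q 0 0 (start_column M 0 false) isT (leq_ltn_trans (leq0n _) (origin_lt x T q)).
by apply: leq_ltn_trans.
Qed.

(** Guarantees that every clause vertex has an anchor to join. *)
Lemma tableau_nonempty M x T q c : c < tableau_clauses M x T q ->
  exists v b, v < tableau_vars M x T q /\ tableau_occ M x T q c v b.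
Proof.
move=> /clause_surj[k [t [p [u [k4 tT pB ->]]]]].
have v0 := tableau_vars_gt0 M x T q.
have taut : tableau_occ M x T q (clause_code x T q k t p u) 0 true ->
    exists v b, v < tableau_vars M x T q /\ tableau_occ M x T q (clause_code x T q k t p u) v b.
  by exists 0, true.
have pick t' p' (g : column M) b : t' <= T -> p' < breadth x T q ->
    tableau_occ M x T q (clause_code x T q k t p u) (var_code x T q t' p' g) b ->
    exists v b, v < tableau_vars M x T q /\ tableau_occ M x T q (clause_code x T q k t p u) v b.
  by move=> tT' pB' oc; exists (var_code x T q t' p' g), b; split => //; apply: var_code_lt.
case k0: (k == 0).
  case cond: [&& t < T, 0 < p & p.+1 < breadth x T q].
    have /and3P[ltT p0 pB1] := cond.
    apply: (pick t.+1 p (next_column (p == (origin T).+1) (p == origin T) (p.+1 == origin T)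
      u.1.1.1 u.1.1.2 u.1.2 u.2) true) => //.
    by rewrite occ_var // k0 cond /= !eqxx.
  by apply: taut; rewrite occ_clause //= k0 cond.
case k1: (k == 1).
  pose s := if p < origin T then 2 else input_at (pair_word x [::]) (p - origin T).
  apply: (pick 0 p (start_column M s (p == origin T)) true) => //.
  rewrite occ_var // k0 k1 /= eqxx /=; apply/bexP.
  have s3 : s < 3 by rewrite /s; case: ifP => // _; rewrite ltnS; apply: input_at_le.
  exists s => //; rewrite start_codeE // eqxx /= /s.
  by case: ltnP => // _; apply: symbol_ok_pair.
case k2: (k == 2).
  case cond: ((origin T + (size x).*2 < p) && (p.+1 < breadth x T q)).
    by apply: (pick 0 p (start_column M 2 false) false) => //; rewrite occ_var // k0 k1 k2 cond /= !eqxx.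
  by apply: taut; rewrite occ_clause //= k0 k1 k2 cond.
case rej: (rejecting u.1.1.1).
  by apply: (pick T p u.1.1.1 false) => //; rewrite occ_var // k0 k1 k2 rej /= !eqxx.
by apply: taut; rewrite occ_clause //= k0 k1 k2 rej.
Qed.

Section TableauComputable.
Variables (M : machine) (T q : word -> nat).
Hypotheses (cT : comput (fun x _ => T x)) (cq : comput (fun x _ => q x)).

Lemma comput_breadth : comput (fun x _ => breadth x (T x) (q x)).
Proof. by rewrite /breadth; comp. Qed.

Lemma comput_origin : comput (fun x _ => origin (T x)).
Proof. by rewrite /origin; comp. Qed.

Lemma comput_tableau_vars : comput (fun x _ => tableau_vars M x (T x) (q x)).
Proof. by rewrite /tableau_vars; have c := comput_breadth; comp. Qed.

Lemma comput_tableau_clauses : comput (fun x _ => tableau_clauses M x (T x) (q x)).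
Proof. by rewrite /tableau_clauses; have c := comput_breadth; comp. Qed.

Lemma comput_next_code f g : comput f -> comput g ->
  comput (fun x e => next_code M (T x) (f x e) (g x e)).
Proof.
move=> cf cg; rewrite /next_code; have co := comput_origin.
have c1 := comput_look (tab_next M true false false) cg.
have c2 := comput_look (tab_next M false true false) cg.
have c3 := comput_look (tab_next M false false true) cg.
have c4 := comput_look (tab_next M false false false) cg.
comp.
Qed.

Lemma comput_symbol_ok f g : comput f -> comput g ->
  comput (fun x e => nat_of_bool (symbol_ok x (q x) (f x e) (g x e))).
Proof. by move=> cf cg; rewrite /symbol_ok; comp. Qed.

Lemma comput_start_ok f g : comput f -> comput g ->
  comput (fun x e => nat_of_bool (start_ok M x (T x) (q x) (f x e) (g x e))).
Proof.
move=> cf cg; rewrite /start_ok; have co := comput_origin.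
have cf1 := comput_env 1 cf.
have c0 := comput_var 0 0.
have c1 : comput (fun x e => nat_of_bool (symbol_ok x (q x) (f x (behead e) - origin (T x)) (nth 0 e 0))).
  by apply: comput_symbol_ok; comp.
have c2 : comput (fun x e => look (tab_start M) (3 * (f x (behead e) == origin (T x)) + nth 0 e 0)).
  by apply: comput_look; comp.
comp.
Qed.

Lemma comput_tableau_occ f g p : comput f -> comput g -> comput (fun x e => nat_of_bool (p x e)) ->
  comput (fun x e => nat_of_bool (tableau_occ M x (T x) (q x) (f x e) (g x e) (p x e))).
Proof.
move=> cf cg cp; rewrite /tableau_occ /=.
have cB := comput_breadth; have co := comput_origin.
have cu : comput (fun x e => f x e %% quad_count M) by comp.
have cpos : comput (fun x e => f x e %/ quad_count M %% breadth x (T x) (q x)) by comp.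
have cv : comput (fun x e => g x e %% col_count M) by comp.
have c1 := comput_look (tab1 M) cu; have c2 := comput_look (tab2 M) cu.
have c3 := comput_look (tab3 M) cu; have c4 := comput_look (tab4 M) cu.
have c5 := comput_look (tab_reject M) cu.
have c6 := comput_next_code cpos cu; have c7 := comput_start_ok cpos cv.
have c8 : comput (fun x e => look (tab_start M) 2) by exact: comput_const.
comp.
Qed.

End TableauComputable.

(** * Encodings of instances and hardness *)

Lemma nth_matrix (n : nat) (e : rel 'I_n) (i j : 'I_n) :
  nth false [seq e i j | i <- enum 'I_n, j <- enum 'I_n] (i * n + j) = e i j.
Proof.
case: n e i j => [|n] e i j; first by case: i.
have -> : [seq e i j | i <- enum 'I_n.+1, j <- enum 'I_n.+1]
   = mkseq (fun u => e (inord (u %/ n.+1)) (inord (u %% n.+1))) (n.+1 * n.+1).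
  rewrite -(allpairs_mkseq n.+1 (fun i j => e (inord i) (inord j))).
  by apply: eq_allpairs => ? ?; rewrite !inord_val.
rewrite nth_mkseq; last by have := ltn_ord i; have := ltn_ord j; nia.
by rewrite divnMDl // modnMDl divn_small // modn_small // addn0 !inord_val.
Qed.

Lemma size_matrix (n : nat) (e : rel 'I_n) :
  size [seq e i j | i <- enum 'I_n, j <- enum 'I_n] = n * n.
Proof. by rewrite size_allpairs size_enum_ord. Qed.

Lemma unary_inj n n' (w w' : word) :
  nseq n true ++ false :: w = nseq n' true ++ false :: w' -> n = n' /\ w = w'.
Proof. by elim: n n' => [|n IH] [|n'] //= []; [move=> -> | move/IH => [-> ->]]. Qed.

(** Injectivity is expressed through [cluster_editable], since [e] and [e'] have a common type only
    once [n = n'] is derived. *)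
Lemma encode_inj n n' (e : rel 'I_n) (e' : rel 'I_n') k k' l :
  encode e k = encode e' k' -> cluster_editable l e' k' -> cluster_editable l e k.
Proof.
move=> /unary_inj[En]; subst n' => /eqP.
rewrite eqseq_cat ?size_matrix // => /andP[/eqP Em /eqP Ek].
have -> : k = k' by rewrite -(val_bits_of_nat k) Ek val_bits_of_nat.
suff -> : e = e' by [].
apply: functional_extensionality => i; apply: functional_extensionality => j.
by rewrite -nth_matrix Em nth_matrix.
Qed.

Lemma size_pair_word x y : size (pair_word x y) = (size x).*2.+1 + size y.
Proof.
rewrite /pair_word size_cat /= addnS addSn; congr (_ + _).+1.
by elim: x => //= b x ->.
Qed.

Theorem cluster_editing_NP_hard l : 1 < l -> NP_hard (cluster_editing l).
Proof.
move=> l2 L [V [a [d [[chi [[M [a' [d' HM]]] chiP]] HL]]]].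
pose q (x : word) := a * size x ^ d + a.
(* The time bound at the longest admissible pair serves all certificates, because running on after
   halting changes nothing. *)
pose T (x : word) := a' * ((size x).*2.+1 + q x) ^ d' + a'.
have cq : comput (fun x _ => q x) by rewrite /q; comp.
have cT : comput (fun x _ => T x) by rewrite /T; comp.
have out x y : size y <= q x ->
    outputs (iter (T x) (@step M) (init M (pair_word x y))) [:: chi (pair_word x y)].
  move=> le; have [h o] := HM (pair_word x y).
  set t0 := a' * size (pair_word x y) ^ d' + a' in h o.
  have le0 : t0 <= T x.
    rewrite /t0 /T leq_add2r leq_mul2l size_pair_word; apply/orP; right.
    by case: (d') => // d2; rewrite leq_exp2r // leq_add2l.
  by rewrite -(subnK le0) iterD step_halting.
exists (fun x => encode (@reduction_graph l (tableau_vars M x (T x) (q x))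
    (tableau_clauses M x (T x) (q x)) (tableau_occ M x (T x) (q x)))
  (budget l (tableau_vars M x (T x) (q x)) (tableau_clauses M x (T x) (q x))
    (tableau_occ M x (T x) (q x)))).
split.
  apply: (polytime_reduction l (comput_tableau_vars M cT cq) (comput_tableau_clauses M cT cq)).
  by move=> f g p cf cg cp; apply: comput_tableau_occ.
move=> x; have l0 : 0 < l by apply: ltnW.
have v0 := tableau_vars_gt0 M x (T x) (q x).
have ne := @tableau_nonempty M x (T x) (q x).
have corr := reduction_correct l0 v0 ne.
split=> [|[n [e [k [ge E ed]]]]].
  case/HL => y [le /chiP acc].
  exists _, (@reduction_graph l (tableau_vars M x (T x) (q x))
    (tableau_clauses M x (T x) (q x)) (tableau_occ M x (T x) (q x))),
    (budget l (tableau_vars M x (T x) (q x)) (tableau_clauses M x (T x) (q x))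
       (tableau_occ M x (T x) (q x))).
  split; [exact: reduction_simple | reflexivity |].
  by apply/corr; apply: (accept_satisfiable (out x) le acc).
have /corr sat := encode_inj E ed.
have [y [le acc]] := satisfiable_accept (out x) sat.
by apply/HL; exists y; split => //; apply/chiP.
Qed.

(** * Verification *)

Lemma bsum_ltn n k : bsum n (fun i => i < k) = minn n k.
Proof.
elim: n => [|n IH]; first by rewrite /bsum big_ord0 min0n.
by rewrite bsumS IH; case: (ltnP n k) => h; lia.
Qed.

(* Length of the longest initial segment of [0, n) on which [p] holds *)
Definition lead (n : nat) (p : pred nat) : nat := bsum n (fun i => ball i.+1 p).

Lemma lead_uniq n (p : pred nat) k : k <= n -> (forall i, i < k -> p i) ->
  (k < n -> ~~ p k) -> lead n p = k.
Proof.
move=> kn Hp nk; rewrite /lead (_ : bsum n _ = bsum n (fun i => i < k)).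
  by rewrite bsum_ltn (minn_idPr kn).
apply: eq_bsum => i lt; congr nat_of_bool; apply/ballP/idP => [H|ik j].
  rewrite ltnNge; apply/negP => ki; have /negP := nk (leq_ltn_trans ki lt).
  by apply; apply: H.
by rewrite ltnS => ji; apply: Hp; apply: leq_ltn_trans ji ik.
Qed.

Lemma leadP n (p : pred nat) :
  [/\ lead n p <= n, forall i, i < lead n p -> p i & lead n p < n -> ~~ p (lead n p)].
Proof.
pose k := find (predC p) (iota 0 n).
have kn : k <= n by rewrite -[X in _ <= X](size_iota 0 n) find_size.
have Hp i : i < k -> p i.
  move=> lt; have := before_find 0 lt; rewrite nth_iota ?(leq_trans lt) //.
  by move/negbFE.
have nk : k < n -> ~~ p k.
  move=> lt; have : has (predC p) (iota 0 n) by rewrite has_find size_iota.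
  by move/(nth_find 0); rewrite nth_iota.
by rewrite (lead_uniq kn Hp nk).
Qed.

Lemma comput_lead n p : comput n ->
  comput (fun x e => nat_of_bool (p x (behead (behead e)) (nth 0 e 0))) ->
  comput (fun x e => lead (n x e) (p x e)).
Proof. by move=> cn cp; rewrite /lead; comp. Qed.

Lemma nth_input_at w i : nth false w i = (input_at w i == 1).
Proof.
rewrite /input_at; case: (ltnP i (size w)) => lt; last by rewrite !nth_default ?size_map.
by rewrite (nth_map false) //; case: nth.
Qed.

Definition graph_size (w : word) : nat := lead (size w) (fun j => input_at w j == 1).
Definition edge (w : word) (i j : nat) : bool :=
  input_at w ((graph_size w).+1 + (i * graph_size w + j)) == 1.
Definition budget_start (w : word) : nat := (graph_size w).+1 + graph_size w * graph_size w.

(** The last conjunct excludes padded numerals, which no encoding produces. *)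
Definition well_formed (w : word) : bool :=
  [&& budget_start w <= size w,
      ball (graph_size w) (fun i => ~~ edge w i i),
      ball (graph_size w) (fun i => ball (graph_size w) (fun j => edge w i j == edge w j i))
    & (budget_start w == size w) || (input_at w (size w).-1 == 1)].

(* Row [i] of the certificate holds the label and the part of vertex [i] in unary. *)
Definition label_of (l : nat) (w y : word) (i : nat) : nat :=
  bsum (graph_size w).*2 (fun j => input_at y (i * ((graph_size w).*2 + l) + j) == 1).
(** Summing over [l.-1] cells keeps the part below a positive [l] whatever the certificate
    contains. *)
Definition part_of (l : nat) (w y : word) (i : nat) : nat :=
  bsum l.-1 (fun j =>
    input_at y (i * ((graph_size w).*2 + l) + ((graph_size w).*2 + j)) == 1).

Definition target_edge (l : nat) (w y : word) (i j : nat) : bool :=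
  [&& i != j, label_of l w y i == label_of l w y j
    & odd (label_of l w y i) || (part_of l w y i != part_of l w y j)].

Definition disagreements (l : nat) (w y : word) : nat :=
  bsum (graph_size w) (fun i => bsum (graph_size w) (fun j =>
    edge w i j != target_edge l w y i j)).

(** The budget in [w] may be exponential in the length of [w], but comparing it with [D] only needs
    powers of 2 truncated at [D.+1]. *)
Definition capped_budget (w : word) (D : nat) : nat :=
  bsum (size w - budget_start w) (fun i =>
    (input_at w (budget_start w + i) == 1) * cap2 D.+1 i).

Definition check (l : nat) (w y : word) : bool :=
  well_formed w && (disagreements l w y <= 2 * capped_budget w (disagreements l w y)).

Lemma val_bitsE z : val_bits z = bsum (size z) (fun i => nth false z i * 2 ^ i).
Proof.
elim: z => [|b z IH]; first by rewrite /bsum big_ord0.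
rewrite /bsum big_ord_recl /= muln1 IH -mul2n /bsum big_distrr /=; congr (_ + _).
by apply: eq_bigr => i _; rewrite /bump /= add1n expnS mulnCA.
Qed.

(** If a set bit belongs to a truncated power, its summand alone exceeds [D], and both inequalities
    hold; otherwise no summand is changed. *)
Lemma capped_val z D :
  (D <= 2 * bsum (size z) (fun i => nth false z i * cap2 D.+1 i)) = (D <= 2 * val_bits z).
Proof.
rewrite val_bitsE; apply/idP/idP => H.
  apply: leq_trans H _; rewrite leq_mul2l /=; apply: leq_sum => i _.
  by rewrite cap2E leq_mul2l geq_minr orbT.
case: (boolP [exists i : 'I_(size z), nth false z i && (D < 2 ^ i)]) => [/existsP[i /andP[zi lt]]|no].
  rewrite /bsum (bigD1 i) //= zi cap2E (minn_idPl lt); lia.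
rewrite (@eq_bsum _ _ (fun i => nth false z i * 2 ^ i)) // => i lt.
rewrite cap2E; case zi: (nth false z i) => //; congr (_ * _); apply/minn_idPr.
apply: ltnW; rewrite ltnS leqNgt; apply: contra no => lt2.
by apply/existsP; exists (Ordinal lt); rewrite /= zi.
Qed.

Section Encoding.
Variables (n : nat) (e : rel 'I_n) (k : nat).
Let w := encode e k.

Lemma nth_encode_lead i : i < n -> nth false w i.
Proof. by move=> lt; rewrite /w /encode nth_cat size_nseq lt nth_nseq lt. Qed.

Lemma size_encode : size w = n.+1 + n * n + size (bits_of_nat k).
Proof. by rewrite /w /encode size_cat size_nseq /= size_cat size_matrix; lia. Qed.

Lemma nth_encode_matrix (i j : 'I_n) : nth false w (n.+1 + (i * n + j)) = e i j.
Proof.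
rewrite /w /encode nth_cat size_nseq ltnNge addSn ltnW ?leq_addr //= ?ltnS ?leq_addr //.
have -> : (n + (i * n + j)).+1 - n = (i * n + j).+1 by lia.
rewrite /= nth_cat size_matrix nth_matrix ifT //.
by have := ltn_ord i; have := ltn_ord j; nia.
Qed.

Lemma nth_encode_bits i : nth false w (n.+1 + n * n + i) = nth false (bits_of_nat k) i.
Proof.
rewrite /w /encode nth_cat size_nseq ifF; last by lia.
have -> : n.+1 + n * n + i - n = (n * n + i).+1 by lia.
by rewrite /= nth_cat size_matrix ifF ?addKn //; lia.
Qed.

Lemma graph_size_encode : graph_size w = n.
Proof.
apply: lead_uniq; first by rewrite size_encode; lia.
  by move=> i /nth_encode_lead; rewrite nth_input_at.
by move=> _; rewrite -nth_input_at /w /encode nth_cat size_nseq ltnn subnn.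
Qed.

End Encoding.

Lemma capped_budgetE w D : capped_budget w D =
  bsum (size (drop (budget_start w) w))
    (fun i => nth false (drop (budget_start w) w) i * cap2 D.+1 i).
Proof.
rewrite /capped_budget size_drop; apply: eq_bsum => i _.
by rewrite nth_drop nth_input_at.
Qed.

Lemma check_sound l w y : 1 < l -> check l w y -> cluster_editing l w.
Proof.
move=> l2 /andP[/and4P[le_size /ballP irr /ballP sym last1] le].
set n := graph_size w; set D := disagreements l w y in le.
pose e : rel 'I_n := fun i j => edge w i j.
pose z := drop (budget_start w) w.
have ge : simple_graph e.
  split=> [i j|i]; last exact: (negbTE (irr _ (ltn_ord i))).
  have /ballP H := sym _ (ltn_ord i); exact: (eqP (H j (ltn_ord j))).
have cz : canonical_bits z.
  rewrite /canonical_bits; case/orP: last1 => [/eqP E|last1].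
    by rewrite /z E drop_size eqxx.
  apply/orP; case: (leqP (size w) (budget_start w)) => lt.
    by left; rewrite /z drop_oversize.
  right; rewrite -nth_last /z nth_drop size_drop.
  have -> : budget_start w + (size w - budget_start w).-1 = (size w).-1 by lia.
  by rewrite nth_input_at.
have [nle Hlead nlead] := leadP (size w) (fun j => input_at w j == 1).
rewrite -/(graph_size w) -/n in nle Hlead nlead.
have ltn_size : n < size w by move: le_size; rewrite /budget_start -/n; lia.
exists n, e, (val_bits z); split => //.
  apply: (@eq_from_nth _ false).
    rewrite size_encode bits_of_val // /z size_drop -/n.
    by rewrite -/(budget_start w) subnKC.
  move=> i lti; case: (ltngtP i n) => [lt|gt|->].
  - by rewrite nth_encode_lead // nth_input_at Hlead.
  - case: (ltnP i (budget_start w)) => lt2.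
      pose m := i - n.+1.
      have ltm : m < n * n by move: lt2; rewrite /budget_start -/n /m; lia.
      have n0 : 0 < n by case: (n) ltm.
      have i1 : m %/ n < n by rewrite ltn_divLR.
      have i2 : m %% n < n by rewrite ltn_pmod.
      have := nth_encode_matrix e (val_bits z) (Ordinal i1) (Ordinal i2).
      have -> : n.+1 + (Ordinal i1 * n + Ordinal i2) = i.
        by rewrite /= -divn_eq /m subnKC.
      move=> ->; rewrite /e /edge -/n /= -divn_eq /m subnKC //.
      by rewrite nth_input_at.
    have := nth_encode_bits e (val_bits z) (i - budget_start w).
    rewrite bits_of_val // -/(budget_start w) subnKC // => ->.
    by rewrite /z nth_drop subnKC.
  rewrite nth_input_at (negbTE (nlead ltn_size)).
  by rewrite /encode nth_cat size_nseq ltnn subnn.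
apply: (labels_editable (c := fun i : 'I_n => label_of l w y i)
  (p := fun i : 'I_n => part_of l w y i) (ltnW l2) ge) => [i|].
  rewrite /part_of; apply: (@leq_ltn_trans l.-1); last by lia.
  by rewrite /bsum -[X in _ <= X]card_ord -sum1_card; apply: leq_sum => j _; apply: leq_b1.
have : D <= 2 * val_bits z by rewrite -capped_val -capped_budgetE.
by rewrite mul2n.
Qed.

Lemma check_complete l n (e : rel 'I_n) k : 1 < l -> simple_graph e -> cluster_editable l e k ->
  exists y, size y <= n * (n.*2 + l) /\ check l (encode e k) y.
Proof.
move=> l2 ge ed; have [c [p [Hp Hc Hle]]] := editable_labels (ltnW l2) ge ed.
set w := encode e k; set r := n.*2 + l.
have gw : graph_size w = n by apply: graph_size_encode.
have bw : budget_start w = n.+1 + n * n by rewrite /budget_start gw.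
have edgeE (i j : 'I_n) : edge w i j = e i j.
  by rewrite /edge gw -nth_input_at nth_encode_matrix.
pose ext (f : 'I_n -> nat) i := if insub i is Some i' then f i' else 0.
have extE f (i : 'I_n) : ext f i = f i by rewrite /ext valK.
pose bit u := if u %% r < n.*2 then u %% r < ext c (u %/ r)
              else u %% r - n.*2 < ext p (u %/ r).
pose y := mkseq bit (n * r).
exists y; split; first by rewrite size_mkseq.
have bitE (i : 'I_n) j : j < r -> (input_at y (i * r + j) == 1) =
    if j < n.*2 then j < c i else j - n.*2 < p i.
  move=> lt; have ltir : i * r + j < n * r by have := ltn_ord i; nia.
  rewrite -nth_input_at nth_mkseq // /bit.
  by rewrite modnMDl modn_small // divnMDl ?divn_small ?addn0 ?extE //; lia.
have cE (i : 'I_n) : label_of l w y i = c i.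
  rewrite /label_of gw -/r (@eq_bsum _ _ (fun j => j < c i)).
    rewrite bsum_ltn; apply/minn_idPr; apply: ltnW; have := Hc i.
    by rewrite card_ord.
  by move=> j lt; rewrite bitE ?lt // /r; lia.
have pE (i : 'I_n) : part_of l w y i = p i.
  rewrite /part_of gw -/r (@eq_bsum _ _ (fun j => j < p i)).
    by rewrite bsum_ltn; apply/minn_idPr; have := Hp i; lia.
  move=> j lt; rewrite bitE; last by rewrite /r; lia.
  by rewrite ifF ?addKn //; lia.
have [se ie] := ge.
apply/andP; split.
  apply/and4P; split.
  - by rewrite bw size_encode leq_addr.
  - by apply/ballP => i; rewrite gw => lt; rewrite (edgeE (Ordinal lt) (Ordinal lt)) ie.
  - apply/ballP => i; rewrite gw => lt; apply/ballP => j lt2.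
    by rewrite (edgeE (Ordinal lt) (Ordinal lt2)) (edgeE (Ordinal lt2) (Ordinal lt)) se.
  have := canonical_bits_of_nat k; rewrite /canonical_bits bw size_encode => /orP[/eqP ->|cz].
    by rewrite addn0 eqxx.
  have s0 : 0 < size (bits_of_nat k) by case: (bits_of_nat k) cz.
  apply/orP; right; rewrite -nth_input_at.
  have -> : (n.+1 + n * n + size (bits_of_nat k)).-1
          = n.+1 + n * n + (size (bits_of_nat k)).-1 by lia.
  by rewrite nth_encode_bits nth_last.
have drE : drop (budget_start w) w = bits_of_nat k.
  apply: (@eq_from_nth _ false); first by rewrite size_drop bw size_encode addKn.
  by move=> i _; rewrite nth_drop bw nth_encode_bits.
rewrite capped_budgetE capped_val drE val_bits_of_nat mul2n.
apply: leq_trans Hle; rewrite /disagreements gw.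
apply: leq_sum => i _; apply: leq_sum => j _.
by rewrite edgeE /target_edge !cE !pE.
Qed.

(** * Unpairing and membership *)

Definition first_size (u : word) : nat := lead (size u) (fun i => input_at u i.*2 == 1).
Definition first_word (u : word) : word :=
  mkseq (fun i => input_at u i.*2.+1 == 1) (first_size u).
Definition second_word (u : word) : word := drop (first_size u).*2.+1 u.

(** All even positions before the separator hold [true], and the separator itself is at an even
    position. *)
Lemma first_size_pair x y : first_size (pair_word x y) = size x.
Proof.
apply: lead_uniq; first by rewrite size_pair_word; lia.
  by move=> i lt; rewrite input_at_pair ltn_double lt odd_double.
by move=> _; rewrite input_at_pair ltnn eqxx.
Qed.

Lemma first_word_pair x y : first_word (pair_word x y) = x.
Proof.
apply: (@eq_from_nth _ false); first by rewrite size_mkseq first_size_pair.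
move=> i; rewrite size_mkseq first_size_pair => lt.
rewrite nth_mkseq ?first_size_pair // input_at_pair.
have -> : i.*2.+1 < (size x).*2 by lia.
by rewrite /= odd_double /= uphalf_double nth_input_at.
Qed.

Lemma second_word_pair x y : second_word (pair_word x y) = y.
Proof.
have E : pair_word x y = (flatten [seq [:: true; b] | b <- x] ++ [:: false]) ++ y.
  by rewrite /pair_word -catA.
rewrite /second_word first_size_pair E drop_size_cat // size_cat addn1.
by congr _.+1; elim: x {E} => //= b x ->.
Qed.

Section CheckComputable.
Variables (l : nat) (dw dy : word -> word).
Hypothesis cs : comput (fun u _ => size (dw u)).
Hypothesis cw : forall f, comput f -> comput (fun u e => input_at (dw u) (f u e)).
Hypothesis cy : forall f, comput f -> comput (fun u e => input_at (dy u) (f u e)).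

Lemma comput_graph_size : comput (fun u _ => graph_size (dw u)).
Proof.
rewrite /graph_size; have c := cw (comput_var 0 0).
apply: (@comput_lead (fun u _ => size (dw u)) (fun u _ j => input_at (dw u) j == 1)) => //; comp.
Qed.

Lemma comput_budget_start : comput (fun u _ => budget_start (dw u)).
Proof. by rewrite /budget_start; have c := comput_graph_size; comp. Qed.

Lemma comput_edge f g : comput f -> comput g ->
  comput (fun u e => nat_of_bool (edge (dw u) (f u e) (g u e))).
Proof.
move=> cf cg; have c := comput_graph_size; rewrite /edge.
have c1 : comput (fun u e => input_at (dw u)
  ((graph_size (dw u)).+1 + (f u e * graph_size (dw u) + g u e))) by apply: cw; comp.
comp.
Qed.

Lemma comput_well_formed : comput (fun u _ => nat_of_bool (well_formed (dw u))).
Proof.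
rewrite /well_formed; have c1 := comput_graph_size; have c2 := comput_budget_start.
have c3 := comput_edge (comput_var 0 0) (comput_var 0 0).
have c4 := comput_edge (comput_var 1 0) (comput_var 0 0).
have c5 := comput_edge (comput_var 0 0) (comput_var 1 0).
have c6 := cw (comput_pred cs).
comp.
Qed.

Lemma comput_label_of f : comput f -> comput (fun u e => label_of l (dw u) (dy u) (f u e)).
Proof.
move=> cf; rewrite /label_of; have c1 := comput_graph_size; have cf1 := comput_env 1 cf.
have c2 : comput (fun u e => input_at (dy u)
  (f u (behead e) * ((graph_size (dw u)).*2 + l) + nth 0 e 0)) by apply: cy; comp.
comp.
Qed.

Lemma comput_part_of f : comput f -> comput (fun u e => part_of l (dw u) (dy u) (f u e)).
Proof.
move=> cf; rewrite /part_of; have c1 := comput_graph_size; have cf1 := comput_env 1 cf.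
have c2 : comput (fun u e => input_at (dy u) (f u (behead e) * ((graph_size (dw u)).*2 + l)
  + ((graph_size (dw u)).*2 + nth 0 e 0))) by apply: cy; comp.
comp.
Qed.

Lemma comput_disagreements : comput (fun u _ => disagreements l (dw u) (dy u)).
Proof.
rewrite /disagreements /target_edge; have c1 := comput_graph_size.
have c2 := comput_edge (comput_var 1 0) (comput_var 0 0).
have c3 := comput_label_of (comput_var 1 0); have c4 := comput_label_of (comput_var 0 0).
have c5 := comput_part_of (comput_var 1 0); have c6 := comput_part_of (comput_var 0 0).
comp.
Qed.

Lemma comput_check : comput (fun u _ => nat_of_bool (check l (dw u) (dy u))).
Proof.
rewrite /check /capped_budget; have c1 := comput_well_formed.
have c2 := comput_disagreements; have c3 := comput_budget_start.
have c4 : comput (fun u e => input_at (dw u) (budget_start (dw u) + nth 0 e 0)).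
  by apply: cw; comp.
comp.
Qed.

End CheckComputable.

Lemma comput_first_size : comput (fun u _ => first_size u).
Proof.
apply: (@comput_lead (fun u _ => size u) (fun u _ i => input_at u i.*2 == 1)); comp.
Qed.

Lemma comput_input_first f : comput f -> comput (fun u e => input_at (first_word u) (f u e)).
Proof.
move=> cf; have c := comput_first_size.
apply: (@eq_comput _ (fun u e => if f u e < first_size u
  then nat_of_bool (input_at u (f u e).*2.+1 == 1) else 2)); last by comp.
move=> u e; rewrite /input_at; case: ltnP => lt.
  by rewrite (nth_map false) ?size_mkseq // nth_mkseq.
by rewrite nth_default // size_map size_mkseq.
Qed.

Lemma comput_input_second f : comput f -> comput (fun u e => input_at (second_word u) (f u e)).
Proof.
move=> cf; have c := comput_first_size.
apply: (@eq_comput _ (fun u e => input_at u ((first_size u).*2.+1 + f u e))); last by comp.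
by move=> u e; rewrite /input_at /second_word map_drop nth_drop.
Qed.

Theorem cluster_editing_NP l : 1 < l -> in_NP (cluster_editing l).
Proof.
move=> l2; pose chi u := check l (first_word u) (second_word u).
(* A certificate has at most $n(2n + l)$ bits, which is at most $(2 + l) s^2$ for an encoding of
   length $s > n$. *)
exists (fun u => chi u), (2 + l), 2; split.
  exists chi; split => //.
  apply: (polytime_mkseq (L := fun=> 1) (B := fun u _ => chi u)); [by comp | | by []].
  apply: comput_check comput_input_first comput_input_second.
  apply: (@eq_comput _ (fun u _ => first_size u)); last exact: comput_first_size.
  by move=> u e; rewrite size_mkseq.
move=> w; split=> [[n [e [k [ge -> ed]]]]|[y [_]]].
  have [y [le ok]] := check_complete l2 ge ed; exists y; split.
    apply: leq_trans le _; have := size_encode e k; move: (size (encode e k)) => s E.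
    have ns : n <= s by lia.
    have nn : n * n <= s * s by apply: leq_mul.
    have ln : n * l <= s * s * l by rewrite leq_mul2r; apply/orP; right; nia.
    rewrite -mulnn; lia.
  by rewrite /chi first_word_pair second_word_pair.
by rewrite /chi first_word_pair second_word_pair; apply: check_sound.
Qed.

Theorem theorem4 (l : nat) (hl : 2 <= l) : NP_complete (cluster_editing l).
Proof. by split; [apply: cluster_editing_NP | apply: cluster_editing_NP_hard]. Qed.
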